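(* The index transform $$(Ff)(\tau)=\int_0^\infty \Psi_\tau(x)\, f(x)\,dx$$ is well-defined as a bounded operator from $L^0$ into the space $C_0(\mathbb{R})$ of bounded continuous functions on $\mathbb{R}$ vanishing at infinity (with the supremum norm). Besides, for every $f\in L^0$ the following composition representation holds: $$(Ff)(\tau)=\left(F_c\,\big[t\mapsto (\mathcal{K}_0 f)(\cosh t)\big]\right)(\tau),$$ where $F_c$ is the Fourier cosine transform and $$(\mathcal{K}_0 f)(x)=-\sqrt{\frac{2}{\pi}}\int_0^\infty \mathrm{Re}\left[K_0\left(4e^{\pi i/4}\sqrt{xt}\right)\right] f(t)\,dt .$$
   Context: $J_\mu$ is the Bessel function of the first kind and $K_\mu$ the modified Bessel function of the second kind (Macdonald function). For $x>0$ and $\tau\in\mathbb{R}\setminus\{0\}$ the kernel is $$\Psi_\tau(x)=\frac{K_{i\tau}(2\sqrt{2x})\,\mathrm{Im}\left[J_{i\tau}(2\sqrt{2x})\right]}{\sinh(\pi\tau/2)},$$ and at $\tau=0$ it is understood as the limit $\tau\to0$. The space $L^0$ is the weighted $L_1$-space $$L^0=L_1\left(\mathbb{R}_+;K_0^2(\sqrt{2x})\,dx\right)=\left\{f:\ \|f\|_{L^0}=\int_0^\infty K_0^2(\sqrt{2x})\,|f(x)|\,dx<\infty\right\}.$$ The Fourier cosine transform is $(F_c h)(x)=\sqrt{2/\pi}\int_0^\infty h(t)\cos(xt)\,dt$. *)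

(* Defs.v *)
From HB Require Import structures.
From mathcomp Require Import all_boot all_order all_algebra.
From mathcomp Require Import complex.
From mathcomp Require Import all_classical all_reals all_analysis.

Set Implicit Arguments.
Unset Strict Implicit.
Unset Printing Implicit Defensive.

Import Order.TTheory GRing.Theory Num.Theory.
Import numFieldNormedType.Exports.

Local Open Scope classical_set_scope.
Local Open Scope complex_scope.
Local Open Scope ring_scope.

(* Num.Theory also exports an [Re]/[Im], with values in the complex field. *)
Notation reC := complex.Re.
Notation imC := complex.Im.
Notation modC := ComplexField.Normc.normc.

Definition coshR {R : realType} (x : R) : R := (expR x + expR (- x)) / 2.
Definition sinhR {R : realType} (x : R) : R := (expR x - expR (- x)) / 2.

Definition cexp {R : realType} (z : R[i]) : R[i] :=
  (expR (reC z) * cos (imC z)) +i* (expR (reC z) * sin (imC z)).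

Definition ccosh {R : realType} (z : R[i]) : R[i] :=
  (cexp z + cexp (- z)) / 2.

(* Principal value of x ^ z, for a real base x > 0. *)
Definition cpow {R : realType} (x : R) (z : R[i]) : R[i] :=
  cexp (z * (ln x)%:C).

Definition halfline {R : realType} : set R := `]0, +oo[%classic.

(* The Lebesgue integral of a complex-valued function is taken componentwise;
   it is meaningful under [cintegrable]. *)
Definition cintegrable {R : realType} (D : set R) (f : R -> R[i]) : Prop :=
  lebesgue_measure.-integrable D (fun x => (reC (f x))%:E) /\
  lebesgue_measure.-integrable D (fun x => (imC (f x))%:E).

Definition cintegral {R : realType} (D : set R) (f : R -> R[i]) : R[i] :=
  (\int[lebesgue_measure]_(x in D) reC (f x)) +i*
  (\int[lebesgue_measure]_(x in D) imC (f x)).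

(* Euler's integral: this is the Gamma function for Re z > 0 only. *)
Definition cGamma {R : realType} (z : R[i]) : R[i] :=
  cintegral halfline (fun t => cpow t (z - 1) * (expR (- t))%:C).

(* J_nu(x), for x > 0, by its ascending series; the domain of [cGamma] limits
   this to Re nu > -1.  The regular module R[i]^o carries the topology. *)
Definition besselJ {R : realType} (nu : R[i]) (x : R) : R[i] :=
  limn (series (fun k : nat =>
    (-1) ^+ k / (k`!%:R * cGamma (nu + k.+1%:R)) *
    cpow (x / 2) (nu + (2 * k)%:R)) : nat -> R[i]^o).

(* K_nu(z), for Re z > 0, by the integral of exp(-z cosh u) cosh(nu u). *)
Definition besselK {R : realType} (nu z : R[i]) : R[i] :=
  cintegral halfline (fun u => cexp (- z * (coshR u)%:C) * ccosh (nu * u%:C)).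

(* K_{i tau}(x) is real for x > 0, so that taking its real part in the real
   kernel and in the real weight below loses nothing. *)
Lemma besselK_real {R : realType} (tau x : R) :
  imC (besselK (0 +i* tau) x%:C) = 0.
Proof.
have im0 u : imC (cexp (- x%:C * (coshR u)%:C) *
                  ccosh ((0 +i* tau) * u%:C)) = 0.
  have -> : - x%:C * (coshR u)%:C = (- (x * coshR u))%:C.
    by rewrite -rmorphN -rmorphM mulNr.
  have -> : (0 +i* tau) * u%:C = 0 +i* (tau * u).
    by apply/eqP; rewrite eq_complex /= !(mul0r, mulr0, subr0, add0r, oppr0) !eqxx.
  have -> : ccosh (0 +i* (tau * u)) = (cos (tau * u))%:C.
    have c2 : (2 : R[i]) = (2 : R)%:C by rewrite rmorph_nat.
    have n2 : (2 : R[i]) != 0 by rewrite pnatr_eq0.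
    apply: (mulIf n2); rewrite /ccosh mulfVK // c2 -rmorphM.
    apply/eqP; rewrite eq_complex /= oppr0 expR0 !mul1r cosN sinN subrr eqxx.
    by rewrite mulr_natr mulr2n eqxx.
  by rewrite /cexp /= sin0 !mulr0 mul0r addr0.
rewrite (_ : imC _ = \int[lebesgue_measure]_(u in (halfline : set R)) 0) /=.
  by rewrite Rintegral_cst ?mul0r //; exact: measurable_itv.
by apply: eq_Rintegral => u _; exact: im0.
Qed.

(* The quotient K_{i tau} Im J_{i tau} / sinh(pi tau / 2), for tau <> 0. *)
Definition Psi_quot {R : realType} (tau x : R) : R :=
  let y := 2 * Num.sqrt (2 * x) in
  reC (besselK (0 +i* tau) y%:C) * imC (besselJ (0 +i* tau) y) /
  sinhR (pi * tau / 2).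

Definition Psi {R : realType} (tau x : R) : R :=
  if tau == 0 then lim (Psi_quot s x @[s --> (0 : R)^']) else Psi_quot tau x.

Definition index_transform {R : realType} (f : R -> R[i]) (tau : R) : R[i] :=
  cintegral halfline (fun x => (Psi tau x)%:C * f x).

Definition L0_weight {R : realType} (x : R) : R :=
  reC (besselK 0 (Num.sqrt (2 * x))%:C) ^+ 2.

Definition L0_norm {R : realType} (f : R -> R[i]) : \bar R :=
  (\int[lebesgue_measure]_(x in halfline) (L0_weight x * modC (f x))%:E)%E.

(* Representatives of the elements of L^0; only the values of f on the
   half-line matter. *)
Definition in_L0 {R : realType} (f : R -> R[i]) : Prop :=
  [/\ measurable_fun halfline (fun x => reC (f x)),
      measurable_fun halfline (fun x => imC (f x)) &
      (L0_norm f < +oo)%E].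

Definition in_C0 {R : realType} (g : R -> R[i]) : Prop :=
  [/\ continuous (g : R -> R[i]^o),
      exists M : R, forall t, modC (g t) <= M,
      (g : R -> R[i]^o) t @[t --> +oo] --> (0 : R[i]^o) &
      (g : R -> R[i]^o) t @[t --> -oo] --> (0 : R[i]^o)].

Definition sup_norm {R : realType} (g : R -> R[i]) : R :=
  sup [set modC (g t) | t in [set: R]].

(* T acts on representatives: linearity and the norm bound make T f and T g
   equal whenever f = g almost everywhere on the half-line. *)
Definition bounded_operator_L0_C0 {R : realType}
    (T : (R -> R[i]) -> (R -> R[i])) : Prop :=
  [/\ forall f, in_L0 f -> in_C0 (T f),
      forall (a : R[i]) f g, in_L0 f -> in_L0 g ->
        T (fun x => a * f x + g x) = (fun tau => a * T f tau + T g tau) &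
      exists2 M : R, 0 <= M &
        forall f, in_L0 f -> ((sup_norm (T f))%:E <= M%:E * L0_norm f)%E].

Definition Fcos {R : realType} (h : R -> R[i]) (x : R) : R[i] :=
  (Num.sqrt (2 / pi))%:C * cintegral halfline (fun t => h t * (cos (x * t))%:C).

Definition K0_kernel {R : realType} (x t : R) : R :=
  reC (besselK 0 (4 * cexp (0 +i* (pi / 4)) * (Num.sqrt (x * t))%:C)).

Definition K0_op {R : realType} (f : R -> R[i]) (x : R) : R[i] :=
  - (Num.sqrt (2 / pi))%:C *
    cintegral halfline (fun t => (K0_kernel x t)%:C * f t).

(* Main.v *)
(* Write y = 2 sqrt (2 x).  The kernel is itself a cosine transform,
     Psi_tau (x) = - (2 / pi) int_0^oo Re K_0 (y sqrt (cosh t) (1 + i)) cos (tau t) dt,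
   and everything else follows from Fubini and dominated convergence, since
   |Re K_0 (Y (1 + i))| <= K_0 (Y), sqrt (cosh t) >= cosh (t / 2) and
   int_0^oo K_0 (y cosh (t / 2)) dt = K_0 (y / 2) ^ 2, which is the weight of L^0.
   The decay at infinity is the Riemann-Lebesgue lemma for each x.

   To get the cosine transform, rotating the contour turns 2 Re K_0 into
   int_R exp (- y cosh u) cos (y cosh (u - t)) du; multiplying by cos (tau t) and
   integrating over t by translation gives K_{i tau} (y) times the Mehler-Sonine integral
   of cos (y cosh v) cos (tau v) over the half-line.  That the latter is
   - (pi / 2) Im J_{i tau} (y) / sinh (pi tau / 2) is read off Schlaefli's contour
   integral, obtained by inserting Hankel's integral for 1 / Gamma in the series of
   J_{i tau}.  Hankel's integral satisfies the recurrence of 1 / Gamma by parts; at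
   -1 + i tau it is a conjugate Gamma value, so its normalisation is
   |Gamma (1 + i tau)|^2 = pi tau / sinh (pi tau), which comes from the Fourier transform
   of 1 / cosh^2, computed with the Poisson kernel of a strip. *)
Require Import Defs.
From HB Require Import structures.
From mathcomp Require Import all_boot all_order all_algebra.
From mathcomp Require Import complex.
From mathcomp Require Import all_classical all_reals all_analysis.
From mathcomp Require Import measurable_realfun ring lra.

Set Implicit Arguments.
Unset Strict Implicit.
Unset Printing Implicit Defensive.

Import Order.TTheory GRing.Theory Num.Theory.
Import numFieldNormedType.Exports.

Local Open Scope classical_set_scope.
Local Open Scope complex_scope.
Local Open Scope ring_scope.

(** Two integrals resist a direct treatment. That of cos (y cosh v) cos (tau v) converges only
    conditionally, so the interchange behind the cosine transform is carried out on windows -n <= s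
    <= n; a bound on the window integrals that is uniform in the window and in its position,
    together with their limit, then allows dominated convergence against exp (- y cosh u). The Gamma
    function is available only through Euler's integral in Re z > 0, so its reciprocal has to be
    found as a Hankel integral normalised by a direct computation. All contours are written in the
    variable w = log t, where the two sides of the cut are the lines Im w = - pi and Im w = pi and
    nothing is multivalued. Cauchy's theorem is used only for segments and lines swept parallel to
    themselves: for an entire integrand the derivative in the direction of the sweep is a multiple
    of the derivative along the line, hence the derivative of the integral is a boundary term. At
    tau = 0 the quotient has no value of its own, and the cosine transform, which is continuous in
    tau, supplies the limit. *)

Local Notation mu := lebesgue_measure.

(** * Real integrals and derivatives *)

Section RealIntegrals.
Context {R : realType}.
Implicit Types (f g : R -> R) (D : set R) (x a b c d e : R).

Definition intble D f := (@lebesgue_measure R).-integrable D (EFin \o f).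

Definition der f x (d : R) := is_derive x (1 : R) (f : R -> R) d.

Lemma der_cst c x : der (fun=> c) x 0.
Proof. exact: is_derive_cst. Qed.

Lemma der_id x : der (fun t => t) x 1.
Proof. exact: is_derive_id. Qed.

Lemma derD f g x d e : der f x d -> der g x e -> der (fun t => f t + g t) x (d + e).
Proof. by move=> df dg; exact: (@is_deriveD _ _ _ f g). Qed.

Lemma derN f x d : der f x d -> der (fun t => - f t) x (- d).
Proof. by move=> df; have := @is_deriveN _ _ _ f x 1 d df. Qed.

Lemma derB f g x d e : der f x d -> der g x e -> der (fun t => f t - g t) x (d - e).
Proof. by move=> df dg; have := @is_deriveB _ _ _ f g x 1 d e df dg. Qed.

Lemma derM f g x d e : der f x d -> der g x e ->
  der (fun t => f t * g t) x (d * g x + f x * e).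
Proof.
move=> df dg; apply: is_derive_eq; first by move: (@is_deriveM _ _ f g x 1 d e df dg); apply.
by rewrite /GRing.scale /= addrC [g x * d]mulrC.
Qed.

Lemma der_comp f g x d e : der f x d -> der g (f x) e -> der (fun t => g (f t)) x (e * d).
Proof. by move=> df dg; exact: (@is_derive1_comp _ g f). Qed.

Lemma der_eq f x d e : der f x d -> d = e -> der f x e.
Proof. by move=> ? <-. Qed.

Lemma der_expR f x d : der f x d -> der (fun t => expR (f t)) x (expR (f x) * d).
Proof. by move=> df; apply: (der_comp df); exact: is_derive_expR. Qed.

Lemma der_cos f x d : der f x d -> der (fun t => cos (f t)) x (- sin (f x) * d).
Proof. by move=> df; apply: (der_comp df); exact: is_derive_cos. Qed.

Lemma der_sin f x d : der f x d -> der (fun t => sin (f t)) x (cos (f x) * d).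
Proof. by move=> df; apply: (der_comp df); exact: is_derive_sin. Qed.

Lemma derX n f x d : der f x d -> der (fun t => f t ^+ n.+1) x (n.+1%:R * f x ^+ n * d).
Proof.
move=> df; elim: n => [|n IH].
  by apply: der_eq df _; rewrite expr0; ring.
under eq_fun do rewrite exprS.
apply: der_eq (derM df IH) _.
by rewrite -[n.+2%:R]natr1 -[n.+1%:R]natr1 exprS; ring.
Qed.

Lemma derV f x d : f x != 0 -> der f x d -> der (fun t => (f t)^-1) x (- d / f x ^+ 2).
Proof.
move=> fx df; apply: is_derive_eq; first by move: (@is_deriveV _ f x d 1 fx df); apply.
by rewrite /GRing.scale /= !mulNr mulrC.
Qed.

Lemma der_derivable f x d : der f x d -> derivable f x 1.
Proof. by case. Qed.

Lemma der_val f x d : der f x d -> derive1 f x = d.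
Proof. by move=> H; rewrite derive1E; exact: derive_val. Qed.

Lemma der_continuous f x d : der f x d -> {for x, continuous f}.
Proof.
by move=> /der_derivable/derivable1_diffP; exact: differentiable_continuous.
Qed.

Lemma derP_continuous f (f' : R -> R) : (forall x, der f x (f' x)) -> continuous f.
Proof. by move=> H x; exact: der_continuous (H x). Qed.

Lemma ex_der_continuous f : (forall x, exists d, der f x d) -> continuous f.
Proof. by move=> H x; have [d] := H x; exact: der_continuous. Qed.

(** Stated on an open interval, since the parameter integrals below are differentiated in open
    strips. *)
Lemma der_zero_cst f u v a b : (forall x, u < x < v -> der f x 0) ->
  u < a < v -> u < b < v -> f a = f b.
Proof.
move=> df; wlog ab : a b / a <= b.
  move=> W ua ub; have [ab|/ltW ba] := leP a b; first exact: W.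
  by apply/esym/W.
move=> /andP[ua av] /andP[ub bv].
have [||c _] := @MVT_segment R f (fun=> 0) a b ab.
- move=> x; rewrite in_itv/= => /andP[ax xb]; apply: df.
  by rewrite (lt_trans ua ax) (lt_trans xb bv).
- apply: continuous_in_subspaceT => x; rewrite inE/= in_itv/= => /andP[ax xb].
  apply: (@der_continuous _ _ 0); apply: df.
  by rewrite (lt_le_trans ua ax) (le_lt_trans xb bv).
- by rewrite mul0r => /eqP; rewrite subr_eq0 => /eqP.
Qed.

Lemma intble_le D f g : measurable D -> measurable_fun D f -> intble D g ->
  (forall x, D x -> `|f x| <= g x) -> intble D f.
Proof.
rewrite /intble => mD mf ig fg; apply: (@le_integrable _ _ _ mu D mD _ _ _ _ ig).
  exact/measurable_EFinP.
move=> x Dx; rewrite /= lee_fin (le_trans (fg _ Dx))//.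
by rewrite ger0_norm// (le_trans _ (fg _ Dx)).
Qed.

Lemma intbleD D f g : measurable D -> intble D f -> intble D g -> intble D (fun x => f x + g x).
Proof. by move=> mD; exact: integrableD. Qed.

Lemma intbleN D f : measurable D -> intble D f -> intble D (fun x => - f x).
Proof.
by move=> mD; exact: integrableN.
Qed.

Lemma intbleB D f g : measurable D -> intble D f -> intble D g -> intble D (fun x => f x - g x).
Proof. by move=> mD F G; apply: intbleD => //; exact: intbleN. Qed.

Lemma intbleZl D c f : measurable D -> intble D f -> intble D (fun x => c * f x).
Proof. by move=> mD; exact: integrableZl. Qed.

Lemma intbleZr D c f : measurable D -> intble D f -> intble D (fun x => f x * c).
Proof.
by move=> mD /(intbleZl c mD); apply: eq_integrable => // x _; rewrite /= mulrC.
Qed.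

Lemma intble_norm D f : measurable D -> intble D f -> intble D (fun x => `|f x|).
Proof. by move=> mD /integrable_abse. Qed.

Lemma intble_meas D f : intble D f -> measurable_fun D f.
Proof. by move=> /measurable_int/measurable_EFinP. Qed.

Lemma intbleS D (E : set R) f : measurable E -> measurable D -> D `<=` E -> intble E f -> intble D f.
Proof. by move=> mE mD DE; rewrite /intble; exact: integrableS. Qed.

Lemma eq_intble D f g : measurable D -> (forall x, D x -> f x = g x) -> intble D f -> intble D g.
Proof.
by move=> mD fg; apply: eq_integrable => // x; rewrite inE => Dx; rewrite /= fg.
Qed.

Lemma eq_Rint D f g : (forall x, D x -> f x = g x) ->
  \int[mu]_(x in D) f x = \int[mu]_(x in D) g x :> R.
Proof. by move=> H; apply: eq_Rintegral => x; rewrite inE => /H. Qed.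

Lemma RintD D f g : measurable D -> intble D f -> intble D g ->
  \int[mu]_(x in D) (f x + g x) = \int[mu]_(x in D) f x + \int[mu]_(x in D) g x.
Proof. by move=> mD F G; exact: RintegralD. Qed.

Lemma RintZl D c f : measurable D -> intble D f ->
  \int[mu]_(x in D) (c * f x) = c * \int[mu]_(x in D) f x.
Proof. by move=> mD F; exact: RintegralZl. Qed.

Lemma RintN D f : measurable D -> intble D f ->
  \int[mu]_(x in D) (- f x) = - \int[mu]_(x in D) f x.
Proof.
move=> mD F; rewrite -mulN1r -RintZl//.
by apply: eq_Rint => x _; rewrite mulN1r.
Qed.

Lemma RintB D f g : measurable D -> intble D f -> intble D g ->
  \int[mu]_(x in D) (f x - g x) = \int[mu]_(x in D) f x - \int[mu]_(x in D) g x.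
Proof. by move=> mD F G; rewrite RintD// ?RintN//; exact: intbleN. Qed.

Lemma Rint_zero D : \int[mu]_(x in D) (0 : R) = 0 :> R.
Proof. by rewrite /Rintegral integral0_eq. Qed.

Lemma Rint_le (D : set R) (f g : R -> R) : measurable D -> intble D f -> intble D g ->
  (forall x, D x -> f x <= g x) -> \int[mu]_(x in D) f x <= \int[mu]_(x in D) g x.
Proof. by move=> mD fi gi fg; apply: le_Rintegral. Qed.

Lemma Rint_le_norm D f g : measurable D -> measurable_fun D f -> intble D g ->
  (forall x, D x -> `|f x| <= g x) -> `|\int[mu]_(x in D) f x| <= \int[mu]_(x in D) g x.
Proof.
move=> mD mf ig fg; have jf := intble_le mD mf ig fg.
apply: le_trans; first exact: (@le_normr_Rintegral _ _ _ mu).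
by apply: le_Rintegral => //; exact: intble_norm.
Qed.

Lemma Rint_dct D (f_ : nat -> R -> R) f g : measurable D ->
  (forall n, measurable_fun D (f_ n)) -> intble D g ->
  (forall n x, D x -> `|f_ n x| <= g x) ->
  (forall x, D x -> f_ n x @[n --> \oo] --> f x) ->
  intble D f /\ \int[mu]_(x in D) f_ n x @[n --> \oo] --> \int[mu]_(x in D) f x.
Proof.
move=> mD mf ig fg cf.
have mlim : measurable_fun D f by apply: (measurable_fun_cvg mf).
have [|||||h1 h2 h3] := @dominated_convergence _ _ _ mu D mD
    (fun n x => (f_ n x)%:E) (EFin \o f) (EFin \o g).
- by move=> n; apply/measurable_EFinP; exact: mf.
- exact/measurable_EFinP.
- by apply: aeW => x Dx; apply: cvg_EFin; [exact: nearW|exact: cf].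
- exact: ig.
- by apply: aeW => x n Dx /=; rewrite lee_fin; exact: fg.
split => //; apply: fine_cvg.
rewrite /Rintegral fineK//; exact: integrable_fin_num.
Qed.

(** Convergence at infinity over the reals is tested on sequences, where dominated convergence
    applies. *)
Lemma Rint_dct_pinfty D (F : R -> R -> R) f g : measurable D ->
  (forall t, measurable_fun D (F t)) -> intble D g ->
  (forall t x, D x -> `|F t x| <= g x) ->
  (forall x, D x -> F t x @[t --> +oo] --> f x) ->
  \int[mu]_(x in D) F t x @[t --> +oo] --> \int[mu]_(x in D) f x.
Proof.
move=> mD mF ig Fg cF; apply/cvg_pinftyP => u uoo.
apply: (proj2 (@Rint_dct D (fun n => F (u n)) f g _ _ _ _ _)) => //.
- by move=> n x; exact: Fg.
- by move=> x Dx; move/cvg_pinftyP: (cF x Dx); exact.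
Qed.

Lemma Rint_continuous D (F : R -> R -> R) g u v a : measurable D -> u < a < v ->
  (forall t, u < t < v -> measurable_fun D (F t)) -> intble D g ->
  (forall t x, u < t < v -> D x -> `|F t x| <= g x) ->
  (forall x, D x -> forall t, u < t < v -> {for t, continuous (F^~ x)}) ->
  {for a, continuous (fun t => \int[mu]_(x in D) F t x)}.
Proof.
move=> mD ua mF ig Fg cF.
have I t : `]u, v[%classic t -> u < t < v by rewrite /= in_itv.
have h1 t : `]u, v[%classic t -> mu.-integrable D (EFin \o F t).
  by move=> /I H; apply: (intble_le mD (mF _ H) ig) => x; exact: Fg.
have h2 : {ae mu, forall y, D y -> {in `]u, v[%classic, continuous (F ^~ y)}}.
  by apply: aeW => y Dy t /set_mem/I H; exact: cF.
have h3 t : `]u, v[%classic t -> {ae mu, forall y, D y -> `|F t y| <= g y}.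
  by move=> /I H; apply: aeW => y; exact: Fg.
have h4 : a \in `]u, v[%classic by rewrite inE/= in_itv.
exact: (@continuity_under_integral _ _ (measurableTypeR R) mu F D mD u v h1 h2 g ig h3 a h4).
Qed.

Lemma der_Rint D (F F' : R -> R -> R) g u v a : measurable D -> u < a < v ->
  (forall t, u < t < v -> intble D (F t)) -> intble D g ->
  (forall t x, u < t < v -> D x -> der (F^~ x) t (F' t x) /\ `|F' t x| <= g x) ->
  der (fun t => \int[mu]_(x in D) F t x) a (\int[mu]_(x in D) F' a x).
Proof.
move=> mD ua iF ig HF.
have I t : `]u, v[%classic t -> u < t < v by rewrite /= in_itv.
have Ia : `]u, v[%classic a by rewrite /= in_itv.
have E t x : u < t < v -> D x -> partial1of2 F t x = F' t x.
  by move=> ut Dx; rewrite /partial1of2 (der_val (proj1 (HF _ _ ut Dx))).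
have h1 t : `]u, v[%classic t -> mu.-integrable D (EFin \o F t) by move=> /I; exact: iF.
have h2 t x : `]u, v[%classic t -> D x -> derivable (F^~ x) t 1.
  by move=> /I ut Dx; exact: der_derivable (proj1 (HF _ _ ut Dx)).
have h3 x : 0 <= `|g x| by [].
have h4 : mu.-integrable D (EFin \o (fun x => `|g x|)) by exact: intble_norm.
have h5 t x : `]u, v[%classic t -> D x -> `|partial1of2 F t x| <= `|g x|.
  move=> /I ut Dx; rewrite E//; have [_ H] := HF _ _ ut Dx.
  by rewrite (le_trans H)// ler_norm.
have d1 := @derivable_under_integral _ _ (measurableTypeR R) mu F D mD a u v Ia h1 h2 _ h3 h4 h5.
have d2 := @differentiation_under_integral _ _ (measurableTypeR R) mu F D mD a u v Ia h1 h2 _ h3 h4 h5.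
have -> : \int[mu]_(x in D) F' a x = 'D_1 (fun t => \int[mu]_(x in D) F t x) a.
  rewrite -derive1E d2; apply: eq_Rint => x Dx.
  by rewrite -(E _ _ ua Dx).
exact: derivableP.
Qed.

(** The restrictions of [f] to the sets [E n] are dominated by its absolute value. This replaces
    improper integrals by limits of proper ones, for the fundamental theorem of calculus and for
    substitutions. *)
Lemma Rint_exhaust D (E : nat -> set R) f : measurable D -> (forall n, measurable (E n)) ->
  (forall n, E n `<=` D) -> (forall x, D x -> \forall n \near \oo, E n x) ->
  intble D f -> \int[mu]_(x in E n) f x @[n --> \oo] --> \int[mu]_(x in D) f x.
Proof.
move=> mD mE ED Ex fi.
have H n : \int[mu]_(x in E n) f x = \int[mu]_(x in D) (f \_ (E n)) x.
  rewrite [RHS]Rintegral_mkcond [LHS]Rintegral_mkcond; congr Rintegral.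
  apply/funext => x; rewrite !patchE; case: ifPn => //; case: ifPn => // xD.
  by rewrite !inE in xD * => /ED/mem_set; rewrite (negbTE xD).
under eq_fun do rewrite H.
apply: (proj2 (@Rint_dct D (fun n => f \_ (E n)) f (fun x => `|f x|) _ _ _ _ _)) => //.
- move=> n; apply/(measurable_restrict _ (mE n) mD).
  apply: measurable_funS (intble_meas fi) => //; exact: subIsetl.
- exact: intble_norm.
- by move=> n x Dx; rewrite patchE; case: ifP; rewrite ?normr0.
- move=> x Dx; apply: cvg_near_cst; apply: filterS (Ex x Dx) => n En.
  by rewrite patchE mem_set.
Qed.

Lemma FTC_itv f (f' : R -> R) a b : a <= b -> (forall x, der f x (f' x)) -> continuous f' ->
  \int[mu]_(x in `[a, b]) f' x = f b - f a.
Proof.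
rewrite le_eqVlt => /predU1P[<-|ab] df cf.
  by rewrite set_itv1 Rintegral_set1 subrr.
have cF := derP_continuous df.
rewrite /Rintegral (@continuous_FTC2 _ _ f)//.
- exact: continuous_subspaceT.
- split.
  + by move=> x _; exact: der_derivable (df x).
  + by apply: cvg_at_right_filter; exact: cF.
  + by apply: cvg_at_left_filter; exact: cF.
- by move=> x _; exact: der_val (df x).
Qed.

Lemma near_natD_ge (a x : R) : \forall n \near \oo, x <= a + n%:R.
Proof.
near=> n; rewrite -lerBlDl.
near: n; exact: nbhs_infty_ger.
Unshelve. all: by end_near. Qed.

Lemma near_natB_le (a x : R) : \forall n \near \oo, a - n%:R <= x.
Proof.
near=> n; rewrite lerBlDl -lerBlDr.
near: n; exact: nbhs_infty_ger.
Unshelve. all: by end_near. Qed.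

Lemma cvg_natD (a : R) : a + n%:R @[n --> \oo] --> +oo.
Proof. by apply/cvgryPge => A; exact: near_natD_ge. Qed.

Lemma cvg_natB (a : R) : a - n%:R @[n --> \oo] --> -oo.
Proof. by apply/cvgrNyPle => A; exact: near_natB_le. Qed.

Lemma FTC_y f (f' : R -> R) a l : (forall x, der f x (f' x)) -> continuous f' ->
  intble `]a, +oo[ f' -> f x @[x --> +oo] --> l ->
  \int[mu]_(x in `]a, +oo[) f' x = l - f a.
Proof.
move=> df cf fi fl.
have H : \int[mu]_(x in `]a, (a + n%:R)]) f' x @[n --> \oo]
    --> \int[mu]_(x in `]a, +oo[) f' x.
  apply: Rint_exhaust => //.
    by move=> n x /=; rewrite !in_itv/= => /andP[->].
  move=> x; rewrite /= in_itv/= andbT => ax.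
  by apply: filterS (near_natD_ge a x) => n; rewrite /= in_itv/= ax.
have H2 : \int[mu]_(x in `]a, (a + n%:R)]) f' x @[n --> \oo] --> l - f a.
  have E n : \int[mu]_(x in `]a, (a + n%:R)]) f' x = f (a + n%:R) - f a.
    have fin : intble `]a, (a + n%:R)] f'.
      apply: (@intbleS _ `]a, +oo[) => //.
      by move=> y /=; rewrite !in_itv/= => /andP[->].
    by rewrite Rintegral_itv_obnd_cbnd ?(FTC_itv _ df) ?lerDl//; exact: fin.
  under eq_fun do rewrite E.
  apply: cvgB; last exact: cvg_cst.
  by move/cvg_pinftyP: fl; apply; exact: cvg_natD.
exact: (cvg_unique _ H H2).
Qed.

Lemma FTC_T f (f' : R -> R) l m : (forall x, der f x (f' x)) -> continuous f' ->
  intble setT f' -> f x @[x --> +oo] --> l -> f x @[x --> -oo] --> m ->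
  \int[mu]_x f' x = l - m.
Proof.
move=> df cf fi fl fm.
have H : \int[mu]_(x in `[- n%:R, n%:R]) f' x @[n --> \oo] --> \int[mu]_x f' x.
  apply: Rint_exhaust => // x _.
  near=> n; rewrite /= in_itv/=; apply/andP; split; near: n.
    by have := near_natB_le 0 x; under eq_near do rewrite sub0r.
  by have := near_natD_ge 0 x; under eq_near do rewrite add0r.
have H2 : \int[mu]_(x in `[- n%:R, n%:R]) f' x @[n --> \oo] --> l - m.
  under eq_fun do rewrite (FTC_itv _ df cf) ?ge0_cp//.
  apply: cvgB.
    by move/cvg_pinftyP: fl; apply; have := cvg_natD 0; under eq_fun do rewrite add0r.
  by move/cvg_ninftyP: fm; apply; have := cvg_natB 0; under eq_fun do rewrite sub0r.
exact: (cvg_unique _ H H2).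
Unshelve. all: by end_near. Qed.

End RealIntegrals.

(** Differentiation directed by syntax: the derivative is left as an existential variable that the
    rules fill in, so after [dsolve] only the algebraic identity with the expected value remains. *)
Ltac dauto := first
  [ exact: der_cst | exact: der_id | assumption
  | (apply: derB; dauto) | (apply: derD; dauto) | (apply: derN; dauto)
  | (apply: derM; dauto) | (apply: derX; dauto) | (apply: der_expR; dauto)
  | (apply: der_cos; dauto) | (apply: der_sin; dauto) ].
Ltac dsolve := apply: der_eq; [dauto | cbv beta; rewrite ?/id].

(** * Hyperbolic functions *)

Section HyperbolicIntegrals.
Context {R : realType}.
Implicit Types (f g : R -> R) (D : set R) (x a b c d e : R).

Lemma der_coshR x : der (@coshR R) x (sinhR x).
Proof. by rewrite /coshR /sinhR; dsolve; field. Qed.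

Lemma der_sinhR x : der (@sinhR R) x (coshR x).
Proof. by rewrite /coshR /sinhR; dsolve; field. Qed.

Lemma coshRN x : coshR (- x) = coshR x.
Proof. by rewrite /coshR opprK addrC. Qed.

Lemma sinhRN x : sinhR (- x) = - sinhR x.
Proof. by rewrite /sinhR opprK; lra. Qed.

Lemma coshR0 : coshR 0 = 1 :> R.
Proof. by rewrite /coshR oppr0 expR0; lra. Qed.

Lemma sinhR0 : sinhR 0 = 0 :> R.
Proof. by rewrite /sinhR oppr0 expR0; lra. Qed.

Lemma coshR_gt0 x : 0 < coshR x.
Proof. by rewrite /coshR divr_gt0// addr_gt0// expR_gt0. Qed.

Lemma expRNM x : expR x * expR (- x) = 1.
Proof. by rewrite -expRD subrr expR0. Qed.

Lemma cosh2_sinh2 x : coshR x ^+ 2 - sinhR x ^+ 2 = 1.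
Proof. by rewrite /coshR /sinhR -[RHS](expRNM x); field. Qed.

Lemma coshR_ge1 x : 1 <= coshR x.
Proof.
have := cosh2_sinh2 x; have := coshR_gt0 x; have := sqr_ge0 (sinhR x).
by move=> s0 c0 E; nra.
Qed.

Lemma expR_le_coshR x : expR x <= 2 * coshR x.
Proof. by rewrite /coshR; have := expR_gt0 (- x); lra. Qed.

Lemma sinhR_ge0 x : 0 <= x -> 0 <= sinhR x.
Proof.
by move=> x0; rewrite /sinhR divr_ge0// subr_ge0 ler_expR; lra.
Qed.

Lemma coshRD x y : coshR (x + y) = coshR x * coshR y + sinhR x * sinhR y.
Proof. by rewrite /coshR /sinhR opprD !expRD; field. Qed.

(** With p the midpoint and q the half difference, cosh (p + q) - cosh (p - q) = 2 sinh p sinh q,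
    which is nonnegative. *)
Lemma coshR_le x y : 0 <= x -> x <= y -> coshR x <= coshR y.
Proof.
move=> x0 xy; rewrite -subr_ge0.
pose p := (x + y) / 2; pose q := (y - x) / 2.
have -> : y = p + q by rewrite /p /q; lra.
have -> : x = p + - q by rewrite /p /q; lra.
rewrite !coshRD coshRN sinhRN.
have : 0 <= sinhR p * sinhR q by rewrite mulr_ge0// sinhR_ge0// /p /q; lra.
lra.
Qed.

Lemma cosh_half x : coshR x = 2 * coshR (x / 2) ^+ 2 - 1.
Proof.
have {1}-> : x = x / 2 + x / 2 by lra.
by rewrite coshRD; have := cosh2_sinh2 (x / 2); nra.
Qed.

Lemma sinhR_ge_id x : 0 <= x -> x <= sinhR x.
Proof.
move=> x0; have [||c _] := @MVT_segment R (fun t => sinhR t - t) (fun t => coshR t - 1) 0 x x0.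
- by move=> t _; apply: derB; [exact: der_sinhR|exact: der_id].
- apply: continuous_subspaceT; apply: (derP_continuous (f' := fun t => coshR t - 1)) => t.
  by apply: derB; [exact: der_sinhR|exact: der_id].
- rewrite sinhR0 !subr0 => E; rewrite -subr_ge0 E mulr_ge0// subr_ge0; exact: coshR_ge1.
Qed.

Lemma continuous_coshR : continuous (@coshR R).
Proof. exact: derP_continuous der_coshR. Qed.

(** One term of the exponential series bounds exp x from below. This is the source of the later
    dominations of exponentials by 1 / cosh. *)
Lemma expR_pow_le x n : 0 <= x -> x ^+ n * expR (- x) <= n`!%:R.
Proof.
move=> x0; case: n => [|n]; first by rewrite fact0 expr0 mul1r -expR0 ler_expR; lra.
have := expR_ge1Dxn n x0; rewrite expRN => H.
rewrite ler_pdivrMr ?expR_gt0//.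
have f0 : 0 < n.+1`!%:R :> R by rewrite ltr0n fact_gt0.
rewrite mulrC -ler_pdivrMr//; apply: le_trans H; by rewrite lerDr.
Qed.

(** The antiderivative 2 atan (e^x) is bounded. The function 1 / cosh is smooth, even and decays
    exponentially, which makes it a convenient majorant on the whole line. *)
Lemma intble_sech : intble setT (fun x : R => (coshR x)^-1).
Proof.
have c0 x : 0 <= (coshR x)^-1 by rewrite invr_ge0 ltW// coshR_gt0.
have cc : continuous (fun x : R => (coshR x)^-1).
  by move=> x; apply: continuousV; [rewrite gt_eqF// coshR_gt0|exact: continuous_coshR].
apply/integrableP; split.
  by apply/measurable_EFinP; exact: continuous_measurable_fun.
under eq_integral do rewrite /= ger0_norm//.
rewrite ge0_symfun_integralT//; last by move=> x; rewrite /= coshRN.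
have df x : der (fun t => 2 * atan (expR t)) x (coshR x)^-1.
  apply: der_eq.
    apply: derM; first exact: der_cst.
    apply: (der_comp (f := expR)); first exact: is_derive_expR.
    exact: is_derive1_atan.
  rewrite mul0r add0r /coshR expRN.
  have := expR_gt0 x; move=> e0; field.
  by apply/andP; split; rewrite gt_eqF//; nra.
rewrite -set_itvcy (ge0_continuous_FTC2y (F := fun t => 2 * atan (expR t)) (l := 2 * (pi / 2))).
- by rewrite -EFinB -EFinM ltry.
- by move=> x _.
- exact: continuous_subspaceT.
- apply: (@cvgM _ _ _ _ (fun=> 2) (atan \o expR)); first exact: cvg_cst.
  apply: (@cvg_comp _ _ _ expR atan); last exact: cvgy_atan.
  apply/cvgryPge => A; near=> x.
  have : A <= x by near: x; apply: nbhs_pinfty_ge; exact: num_real.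
  by have := expR_ge1Dx x; lra.
- by move=> x _; exact: der_derivable (df x).
- by apply: cvg_at_right_filter; exact: der_continuous (df 0).
- by move=> x _; exact: der_val (df x).
Unshelve. all: by end_near. Qed.

Lemma intble_sech_dom D C f : measurable D -> measurable_fun D f ->
  (forall x, D x -> `|f x| <= C / coshR x) -> intble D f.
Proof.
move=> mD mf H; apply: (intble_le mD mf _ H).
by apply: intbleZl => //; exact: (intbleS measurableT mD _ intble_sech).
Qed.

(** * Integrals under measure-preserving maps of the line *)

Section Preserving.
Variable phi : R -> R.
Hypothesis mphi : measurable_fun setT (phi : measurableTypeR R -> measurableTypeR R).
Hypothesis phiI : forall a b : R, a < b ->
  @lebesgue_measure R (phi @^-1` `]a, b]) = (b - a)%:E.

(** Lebesgue measure is determined by its values on half-open intervals, hence equals its image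
    under [phi]. Translations and the reflection are the two instances used. *)
Let phimu : forall A : set (measurableTypeR R), measurable A ->
  pushforward mu (phi : _ -> measurableTypeR R) A = mu A.
Proof.
move=> A mA.
apply/esym/lebesgue_measure_unique => //= _ [[a b]] _ <-.
rewrite /pushforward /=.
have [ab|ba] := ltP a b.
  by rewrite phiI// lebesgue_measure_itv/= lte_fin ab EFinB.
by rewrite set_itv_ge ?bnd_simp -?leNgt// preimage_set0 !measure0.
Qed.

Lemma ge0_integral_preserving D (f : R -> \bar R) : measurable D ->
  measurable_fun D f -> (forall x, D x -> 0 <= f x)%E ->
  (\int[mu]_(x in phi @^-1` D) f (phi x) = \int[mu]_(x in D) f x)%E.
Proof.
move=> mD mf f0.
rewrite -(@ge0_integral_pushforward _ _ (measurableTypeR R) (measurableTypeR R) R phi mphi mu D f)//.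
  by apply: eq_measure_integral => A mA _; exact/phimu.
by move=> x; rewrite inE; exact: f0.
Qed.

Lemma intble_preserving D f : measurable D -> intble D f -> intble (phi @^-1` D) (f \o phi).
Proof.
move=> mD fi; have mf := intble_meas fi.
apply/integrableP; split.
  apply/measurable_EFinP.
  apply: (@measurable_comp _ _ _ (measurableTypeR R) (measurableTypeR R) _ D) => //.
    by move=> _ [x Dx <-].
  exact: measurable_funS mphi.
have -> : (\int[mu]_(x in phi @^-1` D) `|(EFin \o (f \o phi)) x| =
  \int[mu]_(x in D) `|(f x)%:E|)%E.
  rewrite -(ge0_integral_preserving (f := fun x => `|(f x)%:E|%E))//.
  by apply: measurableT_comp => //; exact/measurable_EFinP.
by move/integrableP: fi => [].
Qed.

Lemma Rint_preserving D f : measurable D -> intble D f ->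
  \int[mu]_(x in phi @^-1` D) f (phi x) = \int[mu]_(x in D) f x.
Proof.
move=> mD fi; rewrite [RHS]Rintegral_mkcond [LHS]Rintegral_mkcond.
have gi : intble setT (f \_ D).
  by have := proj1 (@integrable_mkcond _ _ R mu D (EFin \o f) mD) fi; rewrite restrict_EFin.
have E : (fun x => f (phi x)) \_ (phi @^-1` D) = (f \_ D) \o phi.
  apply/funext => x; rewrite /= !patchE.
  suff -> : (x \in phi @^-1` D) = (phi x \in D) by [].
  by apply/idP/idP => /set_mem H; apply/mem_set.
rewrite E /Rintegral; congr fine.
transitivity (\int[pushforward mu (phi : _ -> measurableTypeR R)]_y ((f \_ D) y)%:E)%E.
  apply/esym; rewrite (@integral_pushforward _ _ (measurableTypeR R) (measurableTypeR R) R phi mphi mu setT (EFin \o (f \_ D)))//.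
    by apply/measurable_EFinP; exact: intble_meas gi.
  exact: (intble_preserving measurableT gi).
by apply: eq_measure_integral => A mA _; exact/phimu.
Qed.

End Preserving.

Lemma mshift c : measurable_fun setT ((fun x => x + c) : measurableTypeR R -> measurableTypeR R).
Proof. by apply: (@measurable_funD _ _ R setT (fun x => x) (fun=> c)). Qed.

Lemma shift_preimage_itv c a b (p q : bool) :
  (fun x => x + c) @^-1` [set` Interval (BSide p a) (BSide q b)] =
  [set` Interval (BSide p (a - c)) (BSide q (b - c))].
Proof.
by case: p; case: q; apply/seteqP; split => x /=; rewrite !in_itv/= => /andP[]; lra.
Qed.

Lemma mushift c a b : a < b -> @lebesgue_measure R ((fun x => x + c) @^-1` `]a, b]) = (b - a)%:E.
Proof.
move=> ab; rewrite shift_preimage_itv lebesgue_measure_itv/= lte_fin ltrD2r ab -EFinB.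
by congr EFin; lra.
Qed.

Lemma munegate a b : a < b -> @lebesgue_measure R ((fun x => - x) @^-1` `]a, b]) = (b - a)%:E.
Proof.
move=> ab.
have -> : (fun x => - x) @^-1` `]a, b] = `[- b, - a[%classic.
  by apply/seteqP; split => x /=; rewrite !in_itv/= => /andP[]; lra.
rewrite lebesgue_measure_itv/= lte_fin ltrN2 ab -EFinB.
by congr EFin; lra.
Qed.

Lemma mnegate : measurable_fun setT ((fun x => - x) : measurableTypeR R -> measurableTypeR R).
Proof. exact: oppr_measurable. Qed.

Definition intble_shift c := intble_preserving (mshift c) (@mushift c).
Definition Rint_shift c := Rint_preserving (mshift c) (@mushift c).
Definition Rint_negate := Rint_preserving mnegate munegate.

Lemma Rint_even f : intble setT f -> (forall x, f (- x) = f x) ->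
  \int[mu]_x f x = 2 * \int[mu]_(x in `]0, +oo[) f x.
Proof.
move=> fi fe.
have E : [set: R] = `]-oo, 0[ `|` `[0, +oo[.
  apply/seteqP; split => x //= _; rewrite !in_itv/= andbT.
  by have [] := ltP x 0; [left|right].
rewrite E Rintegral_setU//=; last 2 first.
- by rewrite -E.
- by rewrite disj_set2E; apply/eqP/seteqP; split => x //=; rewrite !in_itv/= andbT => -[]; lra.
have f1 : intble `]0, +oo[ f by exact: (intbleS measurableT _ _ fi).
rewrite -(Rintegral_itv_obnd_cbnd f1).
rewrite mulr_natl mulr2n; congr (_ + _).
rewrite -(Rint_negate _ f1)//.
have -> : (fun x : R => - x) @^-1` `]0, +oo[ = `]-oo, 0[%classic.
  by apply/seteqP; split => x /=; rewrite !in_itv/=; lra.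
by apply: eq_Rint => x _; rewrite fe.
Qed.

(** The point 0, where continuity is not assumed, is avoided by substituting on the compact
    intervals [e^-n, e^n] and letting n grow. *)
Lemma Rint_expR f : (forall t, 0 < t -> {for t, continuous f}) ->
  intble `]0, +oo[ f -> intble setT (fun u => f (expR u) * expR u) ->
  \int[mu]_(t in `]0, +oo[) f t = \int[mu]_u (f (expR u) * expR u).
Proof.
move=> cf fi gi.
have H1 : \int[mu]_(t in `[expR (- n%:R), expR n%:R]) f t @[n --> \oo] -->
    \int[mu]_(t in `]0, +oo[) f t.
  apply: Rint_exhaust => //.
    move=> n x /=; rewrite !in_itv/= => /andP[+ _]; rewrite andbT.
    by apply: lt_le_trans; exact: expR_gt0.
  move=> x; rewrite /= in_itv/= andbT => x0.
  have a1 := near_natB_le 0 (ln x); have a2 := near_natD_ge 0 (ln x).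
  near=> n; rewrite /= in_itv/= -{1}[x]lnK// -{2}[x]lnK// !ler_expR.
  apply/andP; split; near: n.
    by move: a1; under eq_near do rewrite sub0r.
  by move: a2; under eq_near do rewrite add0r.
have H2 : \int[mu]_(u in `[- n%:R, n%:R]) (f (expR u) * expR u) @[n --> \oo] -->
    \int[mu]_u (f (expR u) * expR u).
  apply: Rint_exhaust => // x _.
  near=> n; rewrite /= in_itv/=; apply/andP; split; near: n.
    by have := near_natB_le 0 x; under eq_near do rewrite sub0r.
  by have := near_natD_ge 0 x; under eq_near do rewrite add0r.
suff E n : \int[mu]_(t in `[expR (- n%:R), expR n%:R]) f t =
    \int[mu]_(u in `[- n%:R, n%:R]) (f (expR u) * expR u).
  by move: H1; rewrite (funext E) => H1; exact: (cvg_unique _ H1 H2).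
have dE : derive1 (@expR R) = expR.
  by apply/funext => x; apply: der_val; exact: is_derive_expR.
have cE := @continuous_expR R.
rewrite /Rintegral; congr fine.
rewrite (@integration_by_substitution_increasing R expR f (- n%:R) n%:R).
- by rewrite dE.
- by rewrite ge0_cp.
- by move=> x y _ _; rewrite ltr_expR.
- by move=> x _; rewrite dE; exact: cE.
- by rewrite dE; apply/cvg_ex; exists (expR (- n%:R)); apply: cvg_at_right_filter; exact: cE.
- by rewrite dE; apply/cvg_ex; exists (expR (n%:R)); apply: cvg_at_left_filter; exact: cE.
- split.
  + by move=> x _; exact: derivable_expR.
  + by apply: cvg_at_right_filter; exact: cE.
  + by apply: cvg_at_left_filter; exact: cE.
- apply: continuous_in_subspaceT => x; rewrite inE/= in_itv/= => /andP[h _].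
  by apply: cf; apply: lt_le_trans h; exact: expR_gt0.
Unshelve. all: by end_near. Qed.

End HyperbolicIntegrals.

Ltac dauto ::= first
  [ exact: der_cst | exact: der_id | exact: der_coshR | exact: der_sinhR | assumption
  | (apply: derB; dauto) | (apply: derD; dauto) | (apply: derN; dauto)
  | (apply: derM; dauto) | (apply: derX; dauto) | (apply: der_expR; dauto)
  | (apply: der_cos; dauto) | (apply: der_sin; dauto) ].

(** * Complex-valued functions of a real variable *)

Section ComplexIntegrals.
Context {R : realType}.
Implicit Types (f g : R -> R[i]) (D : set R) (x a b c d e : R) (z w : R[i]).

Local Notation ic := ((0 : R) +i* (1 : R)).

Lemma reD z w : reC (z + w) = reC z + reC w. Proof. by case: z; case: w. Qed.
Lemma imD z w : imC (z + w) = imC z + imC w. Proof. by case: z; case: w. Qed.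
Lemma reN z : reC (- z) = - reC z. Proof. by case: z. Qed.
Lemma imN z : imC (- z) = - imC z. Proof. by case: z. Qed.
Lemma reM z w : reC (z * w) = reC z * reC w - imC z * imC w.
Proof. by case: z; case: w. Qed.
Lemma imM z w : imC (z * w) = reC z * imC w + imC z * reC w.
Proof. by case: z; case: w. Qed.
Lemma reR a : reC a%:C = a. Proof. by []. Qed.
Lemma imR a : imC a%:C = 0. Proof. by []. Qed.
Lemma re0 : reC (0 : R[i]) = 0. Proof. by []. Qed.
Lemma im0 : imC (0 : R[i]) = 0. Proof. by []. Qed.
Lemma re1 : reC (1 : R[i]) = 1. Proof. by []. Qed.
Lemma im1 : imC (1 : R[i]) = 0. Proof. by []. Qed.
Lemma re_nat n : reC (n%:R : R[i]) = n%:R. Proof. by rewrite -(rmorph_nat (real_complex R)). Qed.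
Lemma im_nat n : imC (n%:R : R[i]) = 0. Proof. by rewrite -(rmorph_nat (real_complex R)). Qed.

Lemma reMk a b : reC (a +i* b) = a. Proof. by []. Qed.
Lemma imMk a b : imC (a +i* b) = b. Proof. by []. Qed.
Lemma reE_cexp z : reC (cexp z) = expR (reC z) * cos (imC z). Proof. by []. Qed.
Lemma imE_cexp z : imC (cexp z) = expR (reC z) * sin (imC z). Proof. by []. Qed.

Definition reimE := (reMk, imMk, reE_cexp, imE_cexp, reD, imD, reN, imN, reM, imM, reR, imR, re0, im0, re1, im1, re_nat, im_nat).

Lemma reMR z a : reC (z * a%:C) = reC z * a. Proof. by rewrite !reimE; ring. Qed.
Lemma imMR z a : imC (z * a%:C) = imC z * a. Proof. by rewrite !reimE; ring. Qed.

Lemma complex_eq z w : reC z = reC w -> imC z = imC w -> z = w.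
Proof. by case: z => ? ?; case: w => ? ? /= -> ->. Qed.

Lemma RtoCD a b : (a + b)%:C = a%:C + b%:C. Proof. exact: rmorphD. Qed.
Lemma RtoCM a b : (a * b)%:C = a%:C * b%:C. Proof. exact: rmorphM. Qed.
Lemma RtoCN a : (- a)%:C = - a%:C. Proof. exact: rmorphN. Qed.

Lemma ii2 : ic * ic = -1.
Proof. by apply: complex_eq; rewrite !reimE; ring. Qed.

Lemma modC_ge0 z : 0 <= modC z. Proof. by case: z => p q /=; exact: sqrtr_ge0. Qed.
Lemma modCM z w : modC (z * w) = modC z * modC w.
Proof. exact: ComplexField.Normc.normcM. Qed.
Lemma modCD z w : modC (z + w) <= modC z + modC w.
Proof. by have := ler_normD z w; rewrite /Num.norm /= -RtoCD lecR. Qed.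
Lemma modCN z : modC (- z) = modC z.
Proof. by case: z => p q /=; rewrite !sqrrN. Qed.
Lemma modCR a : modC a%:C = `|a|.
Proof. by rewrite /= expr0n addr0 sqrtr_sqr. Qed.
Lemma modCB z w : modC (z - w) <= modC z + modC w.
Proof. by rewrite -(modCN w); exact: modCD. Qed.
Lemma modC_ii : modC ic = 1.
Proof. by rewrite /= expr0n expr1n add0r sqrtr1. Qed.
Lemma re_le_modC z : `|reC z| <= modC z.
Proof. by case: z => p q /=; rewrite -sqrtr_sqr ler_wsqrtr// lerDl sqr_ge0. Qed.
Lemma im_le_modC z : `|imC z| <= modC z.
Proof. by case: z => p q /=; rewrite -sqrtr_sqr ler_wsqrtr// lerDr sqr_ge0. Qed.
Lemma modC_le z : modC z <= `|reC z| + `|imC z|.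
Proof.
have {1}-> : z = (reC z)%:C + ic * (imC z)%:C.
  by apply: complex_eq; rewrite !reimE; ring.
by rewrite (le_trans (modCD _ _))// modCM modC_ii mul1r !modCR.
Qed.

Lemma modC_sqr z : modC z ^+ 2 = reC z ^+ 2 + imC z ^+ 2.
Proof. by case: z => p q /=; rewrite sqr_sqrtr// addr_ge0// sqr_ge0. Qed.

Lemma cexpD z w : cexp (z + w) = cexp z * cexp w.
Proof.
apply: complex_eq; rewrite !reimE expRD ?cosD ?sinD; ring.
Qed.

Lemma cexp0 : cexp (0 : R[i]) = 1.
Proof. by apply: complex_eq; rewrite !reimE expR0 ?cos0 ?sin0; ring. Qed.

Lemma cexpR a : cexp a%:C = (expR a)%:C.
Proof. by apply: complex_eq; rewrite !reimE ?cos0 ?sin0; ring. Qed.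

Lemma cexpNM z : cexp z * cexp (- z) = 1.
Proof. by rewrite -cexpD subrr cexp0. Qed.

Lemma modC_cexp z : modC (cexp z) = expR (reC z).
Proof.
rewrite /= !exprMn -mulrDr cos2Dsin2 mulr1 sqrtr_sqr ger0_norm//; exact: expR_ge0.
Qed.

Definition cder f x (d : R[i]) :=
  der (fun t => reC (f t)) x (reC d) /\ der (fun t => imC (f t)) x (imC d).

Lemma cder_cst (c : R[i]) x : cder (fun=> c) x 0.
Proof. by split; exact: der_cst. Qed.

Lemma cder_real (f : R -> R) x d : der f x d -> cder (fun t => (f t)%:C) x d%:C.
Proof. by move=> df; split => //; exact: der_cst. Qed.

Lemma cder_id x : cder (fun t => t%:C) x 1.
Proof. exact: cder_real (der_id x). Qed.

Lemma cder_eq f x (d e : R[i]) : cder f x d -> d = e -> cder f x e.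
Proof. by move=> ? <-. Qed.

Lemma cder_ext f g x (d : R[i]) : f =1 g -> cder f x d -> cder g x d.
Proof. by move=> /funext ->. Qed.

Lemma cderD f g x (d e : R[i]) : cder f x d -> cder g x e -> cder (fun t => f t + g t) x (d + e).
Proof.
move=> [d1 d2] [e1 e2]; split.
  by under [fun t => _]eq_fun do rewrite reD; rewrite reD; exact: derD.
by under [fun t => _]eq_fun do rewrite imD; rewrite imD; exact: derD.
Qed.

Lemma cderN f x (d : R[i]) : cder f x d -> cder (fun t => - f t) x (- d).
Proof.
move=> [d1 d2]; split.
  by under [fun t => _]eq_fun do rewrite reN; rewrite reN; exact: derN.
by under [fun t => _]eq_fun do rewrite imN; rewrite imN; exact: derN.
Qed.

Lemma cderB f g x (d e : R[i]) : cder f x d -> cder g x e -> cder (fun t => f t - g t) x (d - e).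
Proof. by move=> df dg; apply: cderD => //; exact: cderN. Qed.

Lemma cderM f g x (d e : R[i]) : cder f x d -> cder g x e ->
  cder (fun t => f t * g t) x (d * g x + f x * e).
Proof.
move=> [d1 d2] [e1 e2]; split.
  under [fun t => _]eq_fun do rewrite reM.
  apply: der_eq; first by apply: derB; apply: derM; eassumption.
  by rewrite !reimE; ring.
under [fun t => _]eq_fun do rewrite imM.
apply: der_eq; first by apply: derD; apply: derM; eassumption.
by rewrite !reimE; ring.
Qed.

Lemma cder_cexp f x (d : R[i]) : cder f x d -> cder (fun t => cexp (f t)) x (cexp (f x) * d).
Proof.
move=> [d1 d2]; split; rewrite /cexp /=.
  apply: der_eq; first by apply: derM; [exact: der_expR d1|exact: der_cos d2].
  by rewrite !reimE; ring.
apply: der_eq; first by apply: derM; [exact: der_expR d1|exact: der_sin d2].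
by rewrite !reimE; ring.
Qed.

Lemma cder_ii x : cder (fun t => 0 +i* t) x ic.
Proof. by split; [exact: der_cst|exact: der_id]. Qed.

Definition ccont f := continuous (fun t => reC (f t)) /\ continuous (fun t => imC (f t)).

Lemma cder_ccont f (f' : R -> R[i]) : (forall x, cder f x (f' x)) -> ccont f.
Proof.
move=> H; split; [apply: (derP_continuous (f' := fun x => reC (f' x)))|
  apply: (derP_continuous (f' := fun x => imC (f' x)))] => x; by case: (H x).
Qed.

Definition cmeas D f := measurable_fun D (fun t => reC (f t)) /\ measurable_fun D (fun t => imC (f t)).

Lemma ccont_cmeas D f : measurable D -> ccont f -> cmeas D f.
Proof.
by move=> mD [c1 c2]; split; apply: (@measurable_funS _ _ _ _ setT) => //; exact: continuous_measurable_fun.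
Qed.

Lemma cintegrable_le D f (g : R -> R) : measurable D -> cmeas D f -> intble D g ->
  (forall x, D x -> modC (f x) <= g x) -> cintegrable D f.
Proof.
move=> mD [m1 m2] ig H; split.
  by apply: (intble_le mD m1 ig) => x Dx; exact: le_trans (re_le_modC _) (H x Dx).
by apply: (intble_le mD m2 ig) => x Dx; exact: le_trans (im_le_modC _) (H x Dx).
Qed.

Lemma cintegrable_sech D f C : measurable D -> cmeas D f ->
  (forall x, D x -> modC (f x) <= C / coshR x) -> cintegrable D f.
Proof.
move=> mD mf; apply: cintegrable_le => //.
by apply: intbleZl => //; exact: (intbleS measurableT mD _ intble_sech).
Qed.

Lemma cintegrable_itv f a b : ccont f -> cintegrable `[a, b] f.
Proof.
move=> [c1 c2]; split.
  apply: (@continuous_compact_integrable _ (fun t => reC (f t))).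
    exact: segment_compact.
  exact: continuous_subspaceT.
apply: (@continuous_compact_integrable _ (fun t => imC (f t))).
  exact: segment_compact.
exact: continuous_subspaceT.
Qed.

Lemma eq_cintegral D f g : (forall x, D x -> f x = g x) -> cintegral D f = cintegral D g.
Proof.
by move=> H; apply: complex_eq; rewrite /=; apply: eq_Rint => x Dx; rewrite H.
Qed.

Lemma eq_cintegrable D f g : measurable D -> (forall x, D x -> f x = g x) ->
  cintegrable D f -> cintegrable D g.
Proof.
by move=> mD H [i1 i2]; split; [apply: eq_intble i1|apply: eq_intble i2] => // x Dx; rewrite H.
Qed.

Lemma cintegrableD D f g : measurable D -> cintegrable D f -> cintegrable D g ->
  cintegrable D (fun x => f x + g x).
Proof.
move=> mD [f1 f2] [g1 g2]; split.
  by apply: (eq_intble mD _ (intbleD mD f1 g1)) => x _; rewrite reD.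
by apply: (eq_intble mD _ (intbleD mD f2 g2)) => x _; rewrite imD.
Qed.

Lemma cintegrableZ D (c : R[i]) f : measurable D -> cintegrable D f ->
  cintegrable D (fun x => c * f x).
Proof.
move=> mD [f1 f2]; split.
  apply: (eq_intble mD _ (intbleB mD (intbleZl (reC c) mD f1) (intbleZl (imC c) mD f2))) => x _.
  by rewrite reM.
apply: (eq_intble mD _ (intbleD mD (intbleZl (reC c) mD f2) (intbleZl (imC c) mD f1))) => x _.
by rewrite imM.
Qed.

Lemma cintegralD D f g : measurable D -> cintegrable D f -> cintegrable D g ->
  cintegral D (fun x => f x + g x) = cintegral D f + cintegral D g.
Proof.
move=> mD [f1 f2] [g1 g2]; apply: complex_eq; rewrite !reimE /= -RintD//;
  by apply: eq_Rint => x _; rewrite !reimE.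
Qed.

Lemma cintegralZ D (c : R[i]) f : measurable D -> cintegrable D f ->
  cintegral D (fun x => c * f x) = c * cintegral D f.
Proof.
move=> mD [f1 f2]; apply: complex_eq; rewrite !reimE /= -!RintZl//.
  by rewrite -RintB//; [apply: eq_Rint => x _; rewrite reM|exact: intbleZl..].
by rewrite -RintD//; [apply: eq_Rint => x _; rewrite imM|exact: intbleZl..].
Qed.

Lemma cintegralZr D (c : R[i]) f : measurable D -> cintegrable D f ->
  cintegral D (fun x => f x * c) = cintegral D f * c.
Proof.
by move=> mD fi; rewrite mulrC -cintegralZ//; apply: eq_cintegral => x _; rewrite mulrC.
Qed.

Lemma cintegralN D f : measurable D -> cintegrable D f ->
  cintegral D (fun x => - f x) = - cintegral D f.
Proof.
by move=> mD fi; rewrite -mulN1r -cintegralZ//; apply: eq_cintegral => x _; rewrite mulN1r.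
Qed.

Lemma cintegrableN D f : measurable D -> cintegrable D f -> cintegrable D (fun x => - f x).
Proof.
by move=> mD /(cintegrableZ (-1) mD); apply: eq_cintegrable => // x _; rewrite mulN1r.
Qed.

Lemma cintegralB D f g : measurable D -> cintegrable D f -> cintegrable D g ->
  cintegral D (fun x => f x - g x) = cintegral D f - cintegral D g.
Proof. by move=> mD fi gi; rewrite cintegralD ?cintegralN//; exact: cintegrableN. Qed.

(** The factor 2 comes from bounding the real and imaginary parts separately. *)
Lemma modC_cintegral_le D f (g : R -> R) : measurable D -> cmeas D f -> intble D g ->
  (forall x, D x -> modC (f x) <= g x) ->
  modC (cintegral D f) <= 2 * \int[mu]_(x in D) g x.
Proof.
move=> mD [m1 m2] ig H; apply: (le_trans (modC_le _)).
rewrite mulr_natl mulr2n; apply: lerD; apply: Rint_le_norm => // x Dx.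
  exact: le_trans (re_le_modC _) (H x Dx).
exact: le_trans (im_le_modC _) (H x Dx).
Qed.

Lemma cintegral_setU D (E : set R) f : measurable D -> measurable E ->
  cintegrable (D `|` E) f -> [disjoint D & E] ->
  cintegral (D `|` E) f = cintegral D f + cintegral E f.
Proof.
move=> mD mE [f1 f2] DE; apply: complex_eq; rewrite !reimE /=; exact: Rintegral_setU.
Qed.

(** This stands in for Cauchy's theorem: contours are moved by differentiating in the displacement
    and recognising a derivative along the contour under the integral. *)
Lemma cder_cint D (F F' : R -> R -> R[i]) (g : R -> R) u v a : measurable D -> u < a < v ->
  (forall t, u < t < v -> cintegrable D (F t)) -> intble D g ->
  (forall t x, u < t < v -> D x -> cder (F^~ x) t (F' t x) /\ modC (F' t x) <= g x) ->
  cder (fun t => cintegral D (F t)) a (cintegral D (F' a)).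
Proof.
move=> mD ua iF ig H; split => /=.
  apply: (@der_Rint R D (fun t x => reC (F t x)) (fun t x => reC (F' t x)) g u v) => //.
    by move=> t /iF [].
  move=> t x ut Dx; have [[d1 d2] h] := H _ _ ut Dx.
  by split => //; exact: le_trans (re_le_modC _) h.
apply: (@der_Rint R D (fun t x => imC (F t x)) (fun t x => imC (F' t x)) g u v) => //.
  by move=> t /iF [].
move=> t x ut Dx; have [[d1 d2] h] := H _ _ ut Dx.
by split => //; exact: le_trans (im_le_modC _) h.
Qed.

Lemma cder_zero_cst f u v a b : (forall x, u < x < v -> cder f x 0) ->
  u < a < v -> u < b < v -> f a = f b.
Proof.
move=> df ua ub; apply: complex_eq.
  by apply: (@der_zero_cst R (fun t => reC (f t)) u v) => // x /df [].
by apply: (@der_zero_cst R (fun t => imC (f t)) u v) => // x /df [].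
Qed.

Lemma cFTC_itv f (f' : R -> R[i]) a b : a <= b -> (forall x, cder f x (f' x)) -> ccont f' ->
  cintegral `[a, b] f' = f b - f a.
Proof.
move=> ab df [c1 c2]; apply: complex_eq; rewrite !reimE /=.
  by rewrite (@FTC_itv R (fun t => reC (f t)))// => x; case: (df x).
by rewrite (@FTC_itv R (fun t => imC (f t)))// => x; case: (df x).
Qed.

(** Convergence by components keeps the proofs over the reals; [ccvg_cvg] passes to the norm
    topology of the complex field where the statement asks for it. *)
Definition ccvg {T} (F : set_system T) (f : T -> R[i]) (l : R[i]) :=
  reC (f t) @[t --> F] --> reC l /\ imC (f t) @[t --> F] --> imC l.

Lemma ccvg_unique {T} (F : set_system T) {FF : ProperFilter F} (f : T -> R[i]) (l m : R[i]) :
  ccvg F f l -> ccvg F f m -> l = m.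
Proof.
move=> [a1 a2] [b1 b2]; apply: complex_eq.
  exact: (cvg_unique _ a1 b1).
exact: (cvg_unique _ a2 b2).
Qed.

Lemma ccvg_cst {T} (F : set_system T) {FF : Filter F} (c : R[i]) : ccvg F (fun=> c) c.
Proof. by split; exact: cvg_cst. Qed.

Lemma ccvgD {T} (F : set_system T) {FF : Filter F} (f g : T -> R[i]) (l m : R[i]) :
  ccvg F f l -> ccvg F g m -> ccvg F (fun t => f t + g t) (l + m).
Proof.
move=> [a1 a2] [b1 b2]; split; rewrite !reimE.
  by under eq_fun do rewrite reD; exact: (cvgD a1 b1).
by under eq_fun do rewrite imD; exact: (cvgD a2 b2).
Qed.

Lemma ccvgM {T} (F : set_system T) {FF : Filter F} (f g : T -> R[i]) (l m : R[i]) :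
  ccvg F f l -> ccvg F g m -> ccvg F (fun t => f t * g t) (l * m).
Proof.
move=> [a1 a2] [b1 b2]; split; rewrite !reimE.
  under eq_fun do rewrite reM.
  exact: (cvgB (cvgM a1 b1) (cvgM a2 b2)).
under eq_fun do rewrite imM.
exact: (cvgD (cvgM a1 b2) (cvgM a2 b1)).
Qed.

Lemma ccvg0_modC {T} (F : set_system T) {FF : Filter F} (f : T -> R[i]) (h : T -> R) :
  (\forall t \near F, modC (f t) <= h t) -> h t @[t --> F] --> 0 -> ccvg F f 0.
Proof.
move=> fh h0; split => /=.
  apply: norm_cvg0; apply: (squeeze_cvgr _ (cvg_cst 0) h0).
  by apply: filterS fh => t H; rewrite normr_ge0/=; exact: le_trans (re_le_modC _) H.
apply: norm_cvg0; apply: (squeeze_cvgr _ (cvg_cst 0) h0).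
by apply: filterS fh => t H; rewrite normr_ge0/=; exact: le_trans (im_le_modC _) H.
Qed.

Lemma cFTC_y f (f' : R -> R[i]) a (l : R[i]) : (forall x, cder f x (f' x)) -> ccont f' ->
  cintegrable `]a, +oo[ f' -> ccvg +oo f l ->
  cintegral `]a, +oo[ f' = l - f a.
Proof.
move=> df [c1 c2] [i1 i2] [l1 l2]; apply: complex_eq; rewrite !reimE /=.
  by rewrite (@FTC_y R (fun t => reC (f t)) _ _ (reC l))// => x; case: (df x).
by rewrite (@FTC_y R (fun t => imC (f t)) _ _ (imC l))// => x; case: (df x).
Qed.

Lemma cFTC_T f (f' : R -> R[i]) (l m : R[i]) : (forall x, cder f x (f' x)) -> ccont f' ->
  cintegrable setT f' -> ccvg +oo f l -> ccvg -oo f m ->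
  cintegral setT f' = l - m.
Proof.
move=> df [c1 c2] [i1 i2] [l1 l2] [m1 m2]; apply: complex_eq; rewrite !reimE /=.
  by rewrite (@FTC_T R (fun t => reC (f t)) _ (reC l) (reC m))// => x; case: (df x).
by rewrite (@FTC_T R (fun t => imC (f t)) _ (imC l) (imC m))// => x; case: (df x).
Qed.

Lemma cint_dct D (f_ : nat -> R -> R[i]) f (g : R -> R) : measurable D ->
  (forall n, cmeas D (f_ n)) -> intble D g ->
  (forall n x, D x -> modC (f_ n x) <= g x) ->
  (forall x, D x -> ccvg \oo (fun n => f_ n x) (f x)) ->
  cintegrable D f /\ ccvg \oo (fun n => cintegral D (f_ n)) (cintegral D f).
Proof.
move=> mD mf ig H cf.
have [||||i1 l1] := @Rint_dct R D (fun n x => reC (f_ n x)) (fun x => reC (f x)) g mD.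
- by move=> n; case: (mf n).
- exact: ig.
- by move=> n x Dx; exact: le_trans (re_le_modC _) (H n x Dx).
- by move=> x /cf [].
have [||||i2 l2] := @Rint_dct R D (fun n x => imC (f_ n x)) (fun x => imC (f x)) g mD.
- by move=> n; case: (mf n).
- exact: ig.
- by move=> n x Dx; exact: le_trans (im_le_modC _) (H n x Dx).
- by move=> x /cf [].
by split.
Qed.

End ComplexIntegrals.

Ltac cdauto := first
  [ exact: cder_cst | exact: cder_id | exact: cder_ii | assumption
  | (apply: cderB; cdauto) | (apply: cderD; cdauto) | (apply: cderN; cdauto)
  | (apply: cderM; cdauto) | (apply: cder_cexp; cdauto) | (apply: cder_real; dauto) ].
Ltac cdsolve := apply: cder_eq; [cdauto | cbv beta; rewrite ?/id].

(** * Fubini and the Gamma integral *)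

Section Fubini.
Context {R : realType}.
Implicit Types (D E : set R).

(** Sections are required integrable at every point, so that each real-valued inner integral is the
    true one and not a default value; [h] dominates the inner integrals of the absolute value and
    gives Tonelli's condition. *)
Lemma Rfubini D E (F : R -> R -> R) (h : R -> R) : measurable D -> measurable E ->
  measurable_fun (D `*` E) (fun z : R * R => F z.1 z.2) ->
  (forall x, D x -> intble E (F x)) ->
  (forall y, E y -> intble D (F ^~ y)) ->
  intble D h ->
  (forall x, D x -> \int[mu]_(y in E) `|F x y| <= h x) ->
  [/\ intble D (fun x => \int[mu]_(y in E) F x y),
      intble E (fun y => \int[mu]_(x in D) F x y) &
      \int[mu]_(x in D) \int[mu]_(y in E) F x y =
      \int[mu]_(y in E) \int[mu]_(x in D) F x y].
Proof.
move=> mD mE mF Fx Fy ih Fh.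
have mDE : measurable (D `*` E) by exact: measurableX.
(* Extension by zero reduces the claim to the whole plane, where the restricted inner integrals
   become the inner integrals of [f]. *)
pose f : measurableTypeR R * measurableTypeR R -> R := (fun z => F z.1 z.2) \_ (D `*` E).
have mf : measurable_fun setT f by exact/(measurable_restrictT _ _).1.
have fE x y : f (x, y) = if (x \in D) && (y \in E) then F x y else 0.
  rewrite /f patchE /=; congr (if _ then _ else _).
  by apply/idP/andP; rewrite !inE.
have fx x : x \in D -> (fun y => f (x, y)) = (F x) \_ E.
  by move=> xD; apply/funext => y; rewrite fE xD patchE.
have fx0 x : x \notin D -> (fun y => f (x, y)) = fun=> 0.
  by move=> xD; apply/funext => y; rewrite fE (negbTE xD).
have fy y : y \in E -> (fun x => f (x, y)) = (F ^~ y) \_ D.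
  by move=> yE; apply/funext => x; rewrite fE yE andbT patchE.
have fy0 y : y \notin E -> (fun x => f (x, y)) = fun=> 0.
  by move=> yE; apply/funext => x; rewrite fE (negbTE yE) andbF.
have ifx x : intble setT (fun y => f (x, y)).
  have [xD|xD] := boolP (x \in D).
    rewrite fx//; move: (xD); rewrite inE => /Fx.
    by move/(proj1 (@integrable_mkcond _ _ R mu E (EFin \o F x) mE)); rewrite restrict_EFin.
  by rewrite fx0//; exact: integrable0.
have ify y : intble setT (fun x => f (x, y)).
  have [yE|yE] := boolP (y \in E).
    rewrite fy//; move: (yE); rewrite inE => /Fy.
    by move/(proj1 (@integrable_mkcond _ _ R mu D (EFin \o F ^~ y) mD)); rewrite restrict_EFin.
  by rewrite fy0//; exact: integrable0.
have Ix x : \int[mu]_y f (x, y) = (fun x => \int[mu]_(y in E) F x y) \_ D x.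
  rewrite patchE; case: ifPn => xD; first by rewrite fx// -Rintegral_mkcond.
  by rewrite fx0// Rint_zero.
have Iy y : \int[mu]_x f (x, y) = (fun y => \int[mu]_(x in D) F x y) \_ E y.
  rewrite patchE; case: ifPn => yE; first by rewrite fy// -Rintegral_mkcond.
  by rewrite fy0// Rint_zero.
have Ex x : (\int[mu]_y (f (x, y))%:E = (\int[mu]_y f (x, y))%:E)%E.
  by rewrite /Rintegral fineK//; apply: integrable_fin_num => //; exact: ifx.
have Ey y : (\int[mu]_x (f (x, y))%:E = (\int[mu]_x f (x, y))%:E)%E.
  by rewrite /Rintegral fineK//; apply: integrable_fin_num => //; exact: ify.
have intf : (mu \x mu)%E.-integrable setT (EFin \o f).
  apply/integrable12ltyP; first exact/measurable_EFinP.
  have ihD : intble setT (h \_ D).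
    by have := proj1 (@integrable_mkcond _ _ R mu D (EFin \o h) mD) ih; rewrite restrict_EFin.
  have /integrableP[_ hoo] := ihD.
  apply: le_lt_trans hoo; apply: ge0_le_integral => //=.
  - by move=> x _; exact: integral_ge0.
  - apply: (measurable_fun_fubini_tonelli_F (fun z => `|(f z)%:E|%E)) => //=.
    by do 2 apply: measurableT_comp => //.
  - by do 2 apply: measurableT_comp => //; exact: (intble_meas ihD).
  - move=> x _; rewrite patchE; case: ifPn => xD.
      have xD' : D x by rewrite inE in xD.
      have -> : (\int[mu]_y `|f (x, y)|%:E = (\int[mu]_(y in E) `|F x y|)%:E)%E.
        rewrite Rintegral_mkcond /Rintegral fineK; last first.
          apply: integrable_fin_num => //.
          have := proj1 (@integrable_mkcond _ _ R mu E (EFin \o (fun y => `|F x y|)) mE) (intble_norm mE (Fx x xD')).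
          by rewrite restrict_EFin.
        apply: eq_integral => y _; rewrite fE xD patchE /=.
        by case: ifP => //; rewrite normr0.
      by rewrite lee_fin (le_trans (Fh x xD'))// ler_norm.
    rewrite (_ : (fun _ => _) = fun=> 0%E); first by rewrite integral0 lee_fin.
    by apply/funext => y; rewrite fE (negbTE xD) normr0.
have iF := integrable_fubini_F intf.
have mf' : measurable_fun setT (EFin \o f) by exact/measurable_EFinP.
have iG : (@lebesgue_measure R).-integrable setT (fun y => \int[mu]_x (f (x, y))%:E)%E.
  have mG := measurable_fubini_G intf.
  apply/integrableP; split => //.
  apply: le_lt_trans ((integrable21ltyP _ _ mf').1 intf).
  apply: ge0_le_integral => //.
  - exact: measurableT_comp.
  - apply: (measurable_fun_fubini_tonelli_G (abse \o (EFin \o f))) => //=.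
    by do 2 apply: measurableT_comp => //.
  - move=> y _; apply: le_abse_integral => //.
    by apply/measurable_EFinP; exact: (intble_meas (ify y)).
have FE := Fubini intf.
split.
- apply/(@integrable_mkcond _ _ R mu D (EFin \o (fun x => \int[mu]_(y in E) F x y)) mD).
  rewrite restrict_EFin; apply: eq_integrable iF => // x _.
  by rewrite /= -Ix -Ex.
- apply/(@integrable_mkcond _ _ R mu E (EFin \o (fun y => \int[mu]_(x in D) F x y)) mE).
  rewrite restrict_EFin; apply: eq_integrable iG => // y _.
  by rewrite /= -Iy -Ey.
- rewrite [LHS]Rintegral_mkcond [RHS]Rintegral_mkcond.
  rewrite /Rintegral; congr fine.
  transitivity (\int[mu]_x \int[mu]_y (f (x, y))%:E)%E.
    by apply: eq_integral => x _; rewrite -Ix -Ex.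
  rewrite FE; apply: eq_integral => y _; by rewrite -Iy -Ey.
Qed.

End Fubini.

Section GammaFacts.
Context {R : realType}.
Implicit Types (t u x tau : R) (k : nat).

Lemma cvg_sech_pinfty (C : R) : C / coshR u @[u --> +oo] --> 0.
Proof.
rewrite -[X in _ --> X](mulr0 C); apply: cvgM; first exact: cvg_cst.
apply/gtr0_cvgV0; first by apply: nearW => u; exact: coshR_gt0.
apply/cvgryPge => A; near=> u.
have uA : `|A| * 2 <= u by near: u; apply: nbhs_pinfty_ge; exact: num_real.
have := expR_le_coshR u; have := expR_ge1Dx u; have := ler_norm A; lra.
Unshelve. all: by end_near. Qed.

Lemma cvg_sech_ninfty (C : R) : C / coshR u @[u --> -oo] --> 0.
Proof.
apply/cvgNy_compNP; under eq_fun do rewrite /= coshRN; exact: cvg_sech_pinfty.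
Qed.

Lemma ccvg_sech_pinfty (f : R -> R[i]) C : (forall u, modC (f u) <= C / coshR u) -> ccvg +oo f 0.
Proof. by move=> H; apply: (ccvg0_modC (nearW _ H)); exact: cvg_sech_pinfty. Qed.

Lemma ccvg_sech_ninfty (f : R -> R[i]) C : (forall u, modC (f u) <= C / coshR u) -> ccvg -oo f 0.
Proof. by move=> H; apply: (ccvg0_modC (nearW _ H)); exact: cvg_sech_ninfty. Qed.

(** Multiplied by cosh u, the left side is half the sum of e^((n+2)u) exp (- e^u) and e^(nu) exp (-
    e^u), and [expR_pow_le] at e^u bounds each term by a factorial. *)
Lemma expexp_le (n : nat) u : expR (n.+1%:R * u - expR u) <= (n.+2`!%:R + n`!%:R) / 2 / coshR u.
Proof.
have c0 := coshR_gt0 u.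
rewrite ler_pdivlMr// expRD expRM_natl.
have e0 := expR_gt0 u.
have := expR_pow_le n.+2 (ltW e0); have := expR_pow_le n (ltW e0).
rewrite /coshR (expRN u) exprS exprS.
set X := expR (- expR u); set y := expR u ^+ n; move: e0; set e := expR u => e0.
move=> h1 h2.
have -> : e * y * X * ((e + e^-1) / 2) = (e * (e * y) * X + y * X) / 2.
  by field; rewrite gt_eqF.
lra.
Qed.

(* Gamma (k + 1 + i tau), after the substitution t = e^u. *)
Definition gammaT k tau := cintegral setT
  (fun u => cexp ((k.+1%:R +i* tau) * u%:C - (expR u)%:C)).

Lemma modC_gamma_integrand k tau u :
  modC (cexp ((k.+1%:R +i* tau) * u%:C - (expR u)%:C)) = expR (k.+1%:R * u - expR u).
Proof. by rewrite modC_cexp !reimE; congr expR; ring. Qed.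

Lemma cder_gamma_integrand (z : R[i]) u :
  cder (fun u => cexp (z * u%:C - (expR u)%:C)) u
    (z * cexp (z * u%:C - (expR u)%:C) - cexp ((z + 1) * u%:C - (expR u)%:C)).
Proof.
cdsolve; have -> : (z + 1) * u%:C - (expR u)%:C = (z * u%:C - (expR u)%:C) + u%:C by ring.
by rewrite [cexp (_ + u%:C)]cexpD cexpR mulr1; ring.
Qed.

Lemma ccont_gamma_integrand (z : R[i]) : ccont (fun u => cexp (z * u%:C - (expR u)%:C)).
Proof. exact: cder_ccont (cder_gamma_integrand z). Qed.

Lemma cintegrable_gammaT k tau :
  cintegrable setT (fun u => cexp ((k.+1%:R +i* tau) * u%:C - (expR u)%:C)).
Proof.
apply: cintegrable_sech => //; first by apply: ccont_cmeas => //; exact: ccont_gamma_integrand.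
by move=> u _; rewrite modC_gamma_integrand; exact: expexp_le.
Qed.

(** Integration by parts: exp (z u - e^u) tends to 0 at both ends, and its derivative is z times
    itself minus the same function at z + 1. *)
Lemma gammaT_rec k tau : gammaT k.+1 tau = (k.+1%:R +i* tau) * gammaT k tau.
Proof.
set z := (k.+1%:R +i* tau).
have Ez : z + 1 = k.+2%:R +i* tau.
  by apply: complex_eq; rewrite !reimE ?addr0// -[in RHS]natr1.
have i0 := cintegrable_gammaT k tau; have i1 := cintegrable_gammaT k.+1 tau.
have := @cFTC_T R _ _ 0 0 (cder_gamma_integrand z).
rewrite Ez => H.
have H1 : cintegral setT (fun u => z * cexp (z * u%:C - (expR u)%:C) -
   cexp ((k.+2%:R +i* tau) * u%:C - (expR u)%:C)) = 0 - 0.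
  apply: H.
  - have [a1 a2] := ccont_gamma_integrand z.
    have [b1 b2] := ccont_gamma_integrand (k.+2%:R +i* tau).
    split.
      under eq_fun do rewrite reD reM reN.
      by move=> u; apply: cvgB; [apply: cvgB; apply: cvgM; (try exact: cvg_cst); [exact: a1|exact: a2]|exact: b1].
    under eq_fun do rewrite imD imM imN.
    by move=> u; apply: cvgB; [apply: cvgD; apply: cvgM; (try exact: cvg_cst); [exact: a2|exact: a1]|exact: b2].
  - apply: cintegrableD => //; first exact: cintegrableZ.
    exact: cintegrableN.
  - by apply: ccvg_sech_pinfty => u; rewrite modC_gamma_integrand; exact: expexp_le.
  - by apply: ccvg_sech_ninfty => u; rewrite modC_gamma_integrand; exact: expexp_le.
move: H1; rewrite cintegralB//; last exact: cintegrableZ.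
by rewrite cintegralZ// subr0 => /eqP; rewrite subr_eq0 => /eqP E; rewrite /gammaT -E.
Qed.

Lemma intble_oneDsqr : intble `]0, +oo[ (fun x : R => (oneDsqr x)^-1).
Proof.
apply: (@intbleS _ _ `[0, +oo[) => //.
  by move=> x /=; rewrite !in_itv/= !andbT => /ltW.
apply/integrableP; split.
  apply/measurable_EFinP; apply: (measurable_funS measurableT) => //.
  by apply: continuous_measurable_fun; exact: continuous_oneDsqrV.
under eq_integral => x _ do rewrite /= ger0_norm ?invr_ge0 ?oneDsqr_ge0//.
by rewrite integral0y_oneDsqr ltry.
Qed.

Lemma cGammaE k tau : cGamma ((0 +i* tau) + k.+1%:R) = gammaT k tau.
Proof.
have Ez : (0 +i* tau) + k.+1%:R - 1 = k%:R +i* tau :> R[i].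
  apply: complex_eq; rewrite !reimE ?addr0 ?oppr0 ?addr0 ?add0r//.
  by rewrite -natr1 addrK.
rewrite /cGamma Ez.
pose f t := cpow t (k%:R +i* tau) * (expR (- t))%:C.
have mf t : 0 < t -> modC (f t) = t ^+ k * expR (- t).
  move=> t0; rewrite /f modCM modCR ger0_norm ?expR_ge0// modC_cexp !reimE mulr0 subr0.
  by rewrite expRM_natl lnK.
have cf t : 0 < t -> {for t, continuous (fun t => reC (f t))} /\ {for t, continuous (fun t => imC (f t))}.
  move=> t0; have dl : der (@ln R) t t^-1 by exact: is_derive1_ln.
  have : cder f t (cexp ((k%:R +i* tau) * (ln t)%:C) * ((0 * (ln t)%:C) + (k%:R +i* tau) * (t^-1)%:C) * (expR (- t))%:C +
     cexp ((k%:R +i* tau) * (ln t)%:C) * (expR (- t) * - 1)%:C).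
    apply: cderM.
      by apply: cder_cexp; apply: cderM; [exact: cder_cst|exact: cder_real].
    by apply: cder_real; dauto.
  by move=> [d1 d2]; split; [exact: der_continuous d1|exact: der_continuous d2].
have fu u : f (expR u) * (expR u)%:C = cexp ((k.+1%:R +i* tau) * u%:C - (expR u)%:C).
  rewrite /f /cpow expRK -!cexpR -!cexpD; congr cexp.
  apply: complex_eq; rewrite !reimE ?cos0 ?sin0; last by ring.
  by rewrite -[k.+1%:R]natr1; ring.
have [g1 g2] := cintegrable_gammaT k tau.
have if_ : cintegrable `]0, +oo[ f.
  (* By [expR_pow_le] with exponents k and k + 2, t^k e^-t (1 + t^2) is at most k! + (k + 2)!. *)
  apply: (cintegrable_le _ _ (intbleZl (k`!%:R + k.+2`!%:R) _ intble_oneDsqr)) => //.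
    split; apply: open_continuous_measurable_fun => // t; rewrite inE/= in_itv/= andbT => t0;
    by case: (cf t t0).
  move=> t t_; have t0 : 0 < t by move: t_; rewrite /= in_itv/= andbT.
  rewrite mf// ler_pdivlMr ?oneDsqr_gt0//.
  have := expR_pow_le k (ltW t0); have := expR_pow_le k.+2 (ltW t0).
  rewrite /oneDsqr !exprS; lra.
have [f1 f2] := if_.
rewrite /gammaT /cintegral; congr (_ +i* _).
  rewrite (@Rint_expR _ (fun t => reC (f t)))//.
  - by apply: eq_Rint => u _; rewrite -fu ?reMR ?imMR.
  - by move=> t /cf [].
  - by apply: eq_intble g1 => // u _; rewrite -fu ?reMR ?imMR.
rewrite (@Rint_expR _ (fun t => imC (f t)))//.
- by apply: eq_Rint => u _; rewrite -fu ?reMR ?imMR.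
- by move=> t /cf [].
- by apply: eq_intble g2 => // u _; rewrite -fu ?reMR ?imMR.
Qed.

End GammaFacts.

(** * The Poisson kernel of a strip and the modulus of Gamma *)

Section Reflection.
Context {R : realType}.
Implicit Types (t u x tau th : R).

Lemma sin_norm_le x : `|sin x| <= `|x|.
Proof.
suff H (y : R) : 0 <= y -> `|sin y| <= y.
  have [x0|/ltW x0] := leP 0 x; first by rewrite (ger0_norm x0); exact: H.
  by rewrite -normrN -sinN (ler0_norm x0) H// oppr_ge0.
move=> y0; have [|c _] := @MVT_segment R (@sin R) (@cos R) 0 y y0.
- exact: continuous_subspaceT (@continuous_sin R).
- rewrite sin0 !subr0 => ->; rewrite normrM (ger0_norm y0) ler_piMl//.
  exact: cos_max.
Qed.

Lemma one_sub_cos_le x : 1 - cos x <= x ^+ 2 / 2.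
Proof.
have {1}-> : x = (x / 2) *+ 2 by rewrite mulr2n; lra.
rewrite cos_mulr2n mulr2n; have := cos2Dsin2 (x / 2).
have := sin_norm_le (x / 2); rewrite -(ler_pXn2r (n := 2))// ?nnegrE// !real_normK ?num_real//.
set s := sin _; set c := cos _; nra.
Qed.

(** Paired with [one_sub_cos_le], it compares 1 - cos (tau u) with cosh u - 1 near u = 0, where the
    Poisson kernel becomes singular as th tends to pi. *)
Lemma coshR_sub1_ge x : x ^+ 2 / 2 <= coshR x - 1.
Proof.
rewrite cosh_half; have := cosh2_sinh2 (x / 2).
suff : (x / 2) ^+ 2 <= sinhR (x / 2) ^+ 2 by nra.
have [x0|/ltW x0] := leP 0 x.
  by rewrite ler_pXn2r// ?nnegrE ?sinhR_ge_id ?sinhR_ge0//; lra.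
rewrite -(sqrrN (x / 2)) -(sqrrN (sinhR _)) -sinhRN.
by rewrite ler_pXn2r// ?nnegrE ?sinhR_ge_id ?sinhR_ge0//; lra.
Qed.

(* The Poisson kernel of the strip |Im z| < pi, i.e. the imaginary part of
   tanh ((u + i th) / 2), and its first two derivatives in th. *)
Definition pois u th := sin th / (coshR u + cos th).
Definition pois1 u th := (1 + cos th * coshR u) / (coshR u + cos th) ^+ 2.
Definition pois2 u th :=
  sin th * (2 + cos th * coshR u - coshR u ^+ 2) / (coshR u + cos th) ^+ 3.

Section Strip.
Variable c : R.
Hypothesis c1 : pi / 2 <= c.
Hypothesis c2 : c < pi.
Let m := 1 + cos c.

Let m_gt0 : 0 < m.
Proof.
have p2 := @pi_gt0 R; have q1 := c1; have q2 := c2.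
have hc : c \in `[0, pi] by rewrite in_itv/=; lra.
have hp : (pi : R) \in `[0, pi] by rewrite in_itv/=; lra.
have : cos (pi : R) < cos c by rewrite ltr_cos.
by rewrite cospi /m; lra.
Qed.

Let cosc_le0 : cos c <= 0.
Proof.
have p2 := @pi_gt0 R; have q1 := c1; have q2 := c2.
have hc : c \in `[0, pi] by rewrite in_itv/=; lra.
have hp : (pi / 2 : R) \in `[0, pi] by rewrite in_itv/=; lra.
by rewrite -(cos_pihalf R) leNgt ltr_cos// -leNgt.
Qed.

Let m_le1 : m <= 1. Proof. by have := cosc_le0; rewrite /m; lra. Qed.

(** Keeping th away from pi gives one majorant for all th. Since cos c <= 0 and cosh u >= 1, one has
    cos th >= cos c >= cos c cosh u. *)
Let D_ge u th : - c < th < c -> m * coshR u <= coshR u + cos th.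
Proof.
move=> /andP[h1 h2].
have cc : cos c <= cos th.
  have p2 := @pi_gt0 R; have q1 := c1; have q2 := c2.
  have hn : `|th| <= c by rewrite ler_norml; lra.
  have hc : c \in `[0, pi] by rewrite in_itv/=; lra.
  have hp : `|th| \in `[0, pi] by rewrite in_itv/= normr_ge0/=; lra.
  by rewrite -(cos_norm th) leNgt ltr_cos// -leNgt.
have := cosc_le0; have := coshR_ge1 u; rewrite /m; nra.
Qed.

Let D_gt0 u th : - c < th < c -> 0 < coshR u + cos th.
Proof.
by move=> h; apply: lt_le_trans (D_ge u h); rewrite mulr_gt0// coshR_gt0.
Qed.

Let mC_gt0 u : 0 < m * coshR u.
Proof. by rewrite mulr_gt0 ?coshR_gt0//; exact: m_gt0. Qed.

Lemma der_pois u th : - c < th < c -> der (pois u) th (pois1 u th).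
Proof.
move=> h; have D1 : coshR u + cos th != 0 by rewrite gt_eqF// D_gt0.
rewrite /pois /pois1; apply: der_eq.
  apply: derM; first by dauto.
  by apply: derV; [exact: D1|dauto].
cbv beta; have -> : 1 + cos th * coshR u = sin th ^+ 2 + cos th ^+ 2 + cos th * coshR u.
  by rewrite sin2cos2; ring.
by field.
Qed.

Lemma der_pois1 u th : - c < th < c -> der (pois1 u) th (pois2 u th).
Proof.
move=> h; have D1 : coshR u + cos th != 0 by rewrite gt_eqF// D_gt0.
rewrite /pois1 /pois2; apply: der_eq.
  apply: derM; first by dauto.
  by apply: derV; [rewrite expf_neq0|dauto].
by cbv beta; field.
Qed.

Lemma pois_le u th : - c < th < c -> `|pois u th| <= m^-1 / coshR u.
Proof.
move=> h; have D0 := D_gt0 u h; have Dg := D_ge u h; have C0 := coshR_gt0 u.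
rewrite /pois normrM normfV (gtr0_norm D0) -invfM.
rewrite -[leRHS]mul1r ler_pM ?invr_ge0 ?(ltW D0) ?sin_max//.
by rewrite lef_pV2 ?posrE//; exact: mC_gt0.
Qed.

Lemma pois1_le u th : - c < th < c -> `|pois1 u th| <= 2 * m ^- 2 / coshR u.
Proof.
move=> h; have D0 := D_gt0 u h; have Dg := D_ge u h; have C1 := coshR_ge1 u.
have C0 := coshR_gt0 u; have m0 := m_gt0.
rewrite /pois1 normrM normfV (gtr0_norm (exprn_gt0 2 D0)).
have -> : 2 * m ^- 2 / coshR u = 2 * coshR u * ((m * coshR u) ^+ 2)^-1.
  by field; rewrite !gt_eqF.
rewrite ler_pM ?invr_ge0 ?exprn_ge0 ?(ltW D0)//.
  have := cos_max th; rewrite ler_norml => /andP[k1 k2].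
  by rewrite ler_norml; apply/andP; split; nra.
by rewrite lef_pV2 ?posrE ?exprn_gt0 ?mC_gt0// ler_pXn2r// nnegrE ltW// mC_gt0.
Qed.

Lemma pois2_le u th : - c < th < c -> `|pois2 u th| <= 4 * m ^- 3 / coshR u.
Proof.
move=> h; have D0 := D_gt0 u h; have Dg := D_ge u h; have C1 := coshR_ge1 u.
have C0 := coshR_gt0 u; have m0 := m_gt0.
rewrite /pois2 normrM normfV (gtr0_norm (exprn_gt0 3 D0)).
have -> : 4 * m ^- 3 / coshR u = 4 * coshR u ^+ 2 * ((m * coshR u) ^+ 3)^-1.
  by field; rewrite !gt_eqF.
rewrite ler_pM ?invr_ge0 ?exprn_ge0 ?(ltW D0)//.
  rewrite normrM -[leRHS]mul1r ler_pM ?sin_max//.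
  have := cos_max th; rewrite ler_norml => /andP[k1 k2].
  by rewrite ler_norml; apply/andP; split; nra.
by rewrite lef_pV2 ?posrE ?exprn_gt0 ?mC_gt0// ler_pXn2r// nnegrE ltW// mC_gt0.
Qed.

Lemma pois_continuous th : - c < th < c -> continuous (pois^~ th).
Proof.
move=> h; apply: ex_der_continuous => u; eexists; rewrite /pois.
apply: derM; first by dauto.
by apply: derV; [rewrite gt_eqF// D_gt0|dauto].
Qed.

Lemma pois1_continuous th : - c < th < c -> continuous (pois1^~ th).
Proof.
move=> h; apply: ex_der_continuous => u; eexists; rewrite /pois1.
apply: derM; first by dauto.
by apply: derV; [rewrite gt_eqF// exprn_gt0// D_gt0|dauto].
Qed.

Lemma pois2_continuous th : - c < th < c -> continuous (pois2^~ th).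
Proof.
move=> h; apply: ex_der_continuous => u; eexists; rewrite /pois2.
apply: derM; first by dauto.
by apply: derV; [rewrite gt_eqF// exprn_gt0// D_gt0|dauto].
Qed.

Lemma intble_cos_sech tau (g : R -> R) C : continuous g ->
  (forall u, `|g u| <= C / coshR u) -> intble setT (fun u => cos (tau * u) * g u).
Proof.
move=> cg H; apply: (@intble_sech_dom R setT C) => //.
  apply: continuous_measurable_fun => u; apply: cvgM; last exact: cg.
  apply: (continuous_comp (f := fun u => tau * u)); last exact: continuous_cos.
  by apply: der_continuous; dauto.
by move=> u _; rewrite normrM -[leRHS]mul1r ler_pM ?cos_max.
Qed.

Let P tau th := \int[mu]_u (cos (tau * u) * pois u th).
Let V tau th := \int[mu]_u (cos (tau * u) * pois1 u th).

Let der_P tau th : - c < th < c -> der (P tau) th (V tau th).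
Proof.
move=> h.
refine (@der_Rint R setT (fun t u => cos (tau * u) * pois u t)
  (fun t u => cos (tau * u) * pois1 u t) (fun u => 2 * m ^- 2 / coshR u) (- c) c th
  measurableT h _ _ _).
- by move=> t ht; apply: intble_cos_sech; [exact: pois_continuous|move=> u; exact: pois_le].
- exact/intbleZl/intble_sech.
- move=> t u ht _; split.
    by apply: der_eq; [apply: derM; [exact: der_cst|exact: der_pois]|cbv beta; rewrite mul0r add0r].
  by rewrite normrM -[leRHS]mul1r ler_pM ?cos_max ?pois1_le.
Qed.

(** The Poisson kernel is harmonic, so [pois2] is minus its second derivative in u, and two
    integrations by parts move that derivative to the cosine. *)
Let poisE tau th : - c < th < c ->
  \int[mu]_u (cos (tau * u) * pois2 u th) = tau ^+ 2 * P tau th.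
Proof.
move=> h.
have i2 : intble setT (fun u => cos (tau * u) * pois2 u th).
  by apply: intble_cos_sech; [exact: pois2_continuous|move=> u; exact: pois2_le].
have i0 : intble setT (fun u => cos (tau * u) * pois u th).
  by apply: intble_cos_sech; [exact: pois_continuous|move=> u; exact: pois_le].
(* The boundary term: minus cos (tau u) times the u-derivative of [pois], minus tau sin (tau u)
   times [pois]. *)
pose f u := sin th * (sinhR u * cos (tau * u) / (coshR u + cos th) ^+ 2
   - tau * sin (tau * u) / (coshR u + cos th)).
have fb u : `|f u| <= (m ^- 2 + `|tau| * m^-1) / coshR u.
  have D0 := D_gt0 u h; have Dg := D_ge u h; have C0 := coshR_gt0 u; have m0 := m_gt0.
  rewrite /f normrM -[leRHS]mul1r ler_pM ?sin_max// mulrDl.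
  apply: (le_trans (ler_normB _ _)); apply: lerD.
    rewrite normrM normfV (gtr0_norm (exprn_gt0 2 D0)) normrM.
    have -> : m ^- 2 / coshR u = coshR u * 1 * ((m * coshR u) ^+ 2)^-1.
      by field; rewrite !gt_eqF.
    rewrite ler_pM ?invr_ge0 ?exprn_ge0 ?(ltW D0)//.
      rewrite ler_pM ?cos_max// ler_norml; have := cosh2_sinh2 u => E.
      by apply/andP; split; nra.
    by rewrite lef_pV2 ?posrE ?exprn_gt0 ?mC_gt0// ler_pXn2r// nnegrE ltW// mC_gt0.
  rewrite normrM normfV (gtr0_norm D0) normrM -mulrA -[leRHS]mulrA ler_wpM2l//.
  rewrite -invfM -[leRHS]mul1r ler_pM ?invr_ge0 ?(ltW D0) ?sin_max//.
  by rewrite lef_pV2 ?posrE//; exact: mC_gt0.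
have df u : der f u (cos (tau * u) * pois2 u th - tau ^+ 2 * (cos (tau * u) * pois u th)).
  have D1 : coshR u + cos th != 0 by rewrite gt_eqF// D_gt0.
  rewrite /f; apply: der_eq.
    apply: derM; first exact: der_cst.
    apply: derB; apply: derM; [dauto| |dauto|].
      by apply: derV; [rewrite expf_neq0|dauto].
    by apply: derV; [|dauto].
  rewrite /pois /pois2; cbv beta.
  have -> : 2 + cos th * coshR u - coshR u ^+ 2 =
      2 * (coshR u ^+ 2 - sinhR u ^+ 2) + cos th * coshR u - coshR u ^+ 2.
    by rewrite cosh2_sinh2; ring.
  by field.
have ii : intble setT (fun u => tau ^+ 2 * (cos (tau * u) * pois u th)) by exact: intbleZl.
have := @FTC_T R f _ 0 0 df.
rewrite RintB// RintZl// subr0 => H; apply/eqP; rewrite -subr_eq0; apply/eqP; apply: H.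
- have cc : continuous (fun u => cos (tau * u)).
    by apply: ex_der_continuous => u; eexists; dauto.
  move=> u; apply: cvgB; first by apply: cvgM; [exact: cc|exact: pois2_continuous].
  apply: cvgM; first exact: cvg_cst.
  by apply: cvgM; [exact: cc|exact: pois_continuous].
- exact: intbleB.
- apply: norm_cvg0; apply: (squeeze_cvgr _ (cvg_cst 0) (cvg_sech_pinfty (m ^- 2 + `|tau| * m^-1))).
  by apply: nearW => u; rewrite normr_ge0/=.
- apply: norm_cvg0; apply: (squeeze_cvgr _ (cvg_cst 0) (cvg_sech_ninfty (m ^- 2 + `|tau| * m^-1))).
  by apply: nearW => u; rewrite normr_ge0/=.
Qed.

Let der_V tau th : - c < th < c -> der (V tau) th (tau ^+ 2 * P tau th).
Proof.
move=> h; rewrite -poisE//.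
refine (@der_Rint R setT (fun t u => cos (tau * u) * pois1 u t)
  (fun t u => cos (tau * u) * pois2 u t) (fun u => 4 * m ^- 3 / coshR u) (- c) c th
  measurableT h _ _ _).
- by move=> t ht; apply: intble_cos_sech; [exact: pois1_continuous|move=> u; exact: pois1_le].
- exact/intbleZl/intble_sech.
- move=> t u ht _; split.
    by apply: der_eq; [apply: derM; [exact: der_cst|exact: der_pois1]|cbv beta; rewrite mul0r add0r].
  by rewrite normrM -[leRHS]mul1r ler_pM ?cos_max ?pois2_le.
Qed.

Let P0 tau : P tau 0 = 0.
Proof.
rewrite /P (_ : (fun u => _) = fun=> 0) ?Rint_zero//.
by apply/funext => u; rewrite /pois sin0 mul0r mulr0.
Qed.

(** As a function of th the cosine transform P satisfies P'' = tau^2 P and P(0) = 0, so tau P is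
    P'(0) sinh (tau th). *)
Lemma pois_integral tau th : - c < th < c ->
  tau * \int[mu]_u (cos (tau * u) * pois u th) =
  sinhR (tau * th) * \int[mu]_u (cos (tau * u) / (1 + coshR u)).
Proof.
move=> h; rewrite -/(P tau th).
have h0 : - c < 0 < c by have := @pi_gt0 R; have := c1; lra.
have -> : \int[mu]_u (cos (tau * u) / (1 + coshR u)) = V tau 0.
  rewrite /V; apply: eq_Rint => u _; rewrite /pois1 cos0; congr (_ * _).
  by have := coshR_gt0 u => C0; field; rewrite !gt_eqF//; lra.
have dT t : der (fun t => tau * t) t tau.
  by apply: der_eq; [dauto|rewrite mul0r add0r mulr1].
have dS t := der_comp (dT t) (der_sinhR (tau * t)).
have dC t := der_comp (dT t) (der_coshR (tau * t)).
(* [Z] and [Y] are constant along solutions; eliminating V between them by cosh^2 - sinh^2 = 1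
   solves the equation without a uniqueness theorem. *)
pose Z t := V tau t * sinhR (tau * t) - tau * P tau t * coshR (tau * t).
pose Y t := V tau t * coshR (tau * t) - tau * P tau t * sinhR (tau * t).
have Z0 : Z th = Z 0.
  apply: (@der_zero_cst R Z (- c) c) => // t ht; rewrite /Z; apply: der_eq.
    apply: derB; apply: derM; [exact: der_V|exact: dS| |exact: dC].
    by apply: derM; [exact: der_cst|exact: der_P].
  by cbv beta; ring.
have Y0 : Y th = Y 0.
  apply: (@der_zero_cst R Y (- c) c) => // t ht; rewrite /Y; apply: der_eq.
    apply: derB; apply: derM; [exact: der_V|exact: dC| |exact: dS].
    by apply: derM; [exact: der_cst|exact: der_P].
  by cbv beta; ring.
move: Z0 Y0; rewrite /Z /Y P0 !mulr0 sinhR0 coshR0 !mulr0 ?mulr1 ?mul0r ?subr0 => Z0 Y0.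
rewrite -Y0; have := cosh2_sinh2 (tau * th).
move: Z0; set S := sinhR _; set K := coshR _ => Z0 E.
transitivity (tau * P tau th * (K ^+ 2 - S ^+ 2) + (V tau th * S - tau * P tau th * K) * K).
  by rewrite E Z0; ring.
by ring.
Qed.

(** At tau = 0 the equation reads P'' = 0, and the slope P'(0) is the integral of 1 / (1 + cosh u),
    which is 2. *)
Lemma pois_mass th : - c < th < c -> \int[mu]_u pois u th = 2 * th.
Proof.
move=> h.
have h0 : - c < 0 < c by have := @pi_gt0 R; have := c1; lra.
have E (g : R -> R) : \int[mu]_u (cos (0 * u) * g u) = \int[mu]_u g u.
  by apply: eq_Rint => u _; rewrite mul0r cos0 mul1r.
have VE : V 0 0 = 2.
  rewrite /V E (_ : (fun u => _) = fun u => (1 + coshR u)^-1); last first.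
    apply/funext => u; rewrite /pois1 cos0.
    by have := coshR_gt0 u => C0; field; rewrite !gt_eqF//; lra.
  (* The antiderivative is tanh (u / 2), with limits 1 and -1. *)
  rewrite (@FTC_T R (fun u => sinhR u / (1 + coshR u)) _ 1 (-1)); first by lra.
  - move=> u; have C0 := coshR_gt0 u; apply: der_eq.
      apply: derM; first by dauto.
      by apply: derV; [rewrite gt_eqF//; lra|dauto].
    cbv beta; apply/eqP; rewrite -subr_eq0; apply/eqP.
    transitivity ((coshR u ^+ 2 - sinhR u ^+ 2 - 1) / (1 + coshR u) ^+ 2).
      by field; rewrite gt_eqF//; lra.
    by rewrite cosh2_sinh2 subrr mul0r.
  - apply: ex_der_continuous => u; eexists; apply: derV; last by dauto.
    by have C0 := coshR_gt0 u; rewrite gt_eqF//; lra.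
  - apply: (@intble_sech_dom R setT 1) => //.
      apply: continuous_measurable_fun; apply: ex_der_continuous => u; eexists; apply: derV; last by dauto.
      by have C0 := coshR_gt0 u; rewrite gt_eqF//; lra.
    move=> u _; have C0 := coshR_gt0 u; rewrite ger0_norm ?invr_ge0; last lra.
    by rewrite mul1r lef_pV2 ?posrE//; lra.
  - have H : 1 - (1 + expR (- u)) / (1 + coshR u) @[u --> +oo] --> (1 : R).
      rewrite -[X in _ --> X]subr0; apply: cvgB; first exact: cvg_cst.
      apply: norm_cvg0; apply: (squeeze_cvgr _ (cvg_cst 0) (cvg_sech_pinfty 2)).
      near=> u; have C0 := coshR_gt0 u; have e0 := expR_gt0 (- u).
      rewrite normr_ge0/= ger0_norm; last by rewrite divr_ge0//; lra.
      have e1 : expR (- u) <= 1.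
        by rewrite -expR0 ler_expR oppr_le0; near: u; apply: nbhs_pinfty_ge; exact: num_real.
      by rewrite ler_pM ?invr_ge0 ?lef_pV2 ?posrE//; lra.
    apply: cvg_trans H; apply: near_eq_cvg; apply: nearW => u.
    have C0 := coshR_gt0 u.
    rewrite -[X in X - _](@divff _ (1 + coshR u)) ?gt_eqF//; last lra.
    rewrite -mulrBl /sinhR /coshR; congr (_ / _); lra.
  - have H : -1 + (1 + expR u) / (1 + coshR u) @[u --> -oo] --> (-1 : R).
      rewrite -[X in _ --> X]addr0; apply: cvgD; first exact: cvg_cst.
      apply: norm_cvg0; apply: (squeeze_cvgr _ (cvg_cst 0) (cvg_sech_ninfty 2)).
      near=> u; have C0 := coshR_gt0 u; have e0 := expR_gt0 u.
      rewrite normr_ge0/= ger0_norm; last by rewrite divr_ge0//; lra.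
      have e1 : expR u <= 1.
        by rewrite -expR0 ler_expR; near: u; apply: nbhs_ninfty_le; exact: num_real.
      by rewrite ler_pM ?invr_ge0 ?lef_pV2 ?posrE//; lra.
    apply: cvg_trans H; apply: near_eq_cvg; apply: nearW => u.
    have C0 := coshR_gt0 u.
    rewrite -[X in - X + _](@divff _ (1 + coshR u)) ?gt_eqF//; last lra.
    rewrite -mulNr -mulrDl /sinhR /coshR; congr (_ / _); lra.
have V0 t : - c < t < c -> V 0 t = 2.
  move=> ht; rewrite -VE; apply: (@der_zero_cst R (V 0) (- c) c) => // s hs.
  by apply: der_eq; [exact: der_V|rewrite expr0n mul0r].
rewrite -E -/(P 0 th).
suff : P 0 th - 2 * th = P 0 0 - 2 * 0.
  by rewrite P0 mulr0 subr0 => /eqP; rewrite subr_eq0 => /eqP.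
apply: (@der_zero_cst R (fun t => P 0 t - 2 * t) (- c) c) => // t ht.
apply: der_eq; first by apply: derB; [exact: der_P|dauto].
by rewrite V0//; cbv beta; ring.
Unshelve. all: by end_near. Qed.

End Strip.
End Reflection.

Section GammaModulus.
Context {R : realType}.
Implicit Types (t u v x tau th : R).

Lemma ge0_left_limit (q : R -> R) a b : a < b -> continuous q ->
  (forall x, a < x < b -> 0 <= q x) -> 0 <= q b.
Proof.
move=> ab cq H.
have L : q x @[x --> b^'-] --> q b by apply: cvg_at_left_filter; exact: cq.
rewrite -(cvg_lim _ L)//; apply: limr_ge; first exact: cvgP L.
near=> x; apply: H; apply/andP; split; near: x.
  exact: nbhs_left_gt.
exact: nbhs_left_lt.
Unshelve. all: by end_near. Qed.

(** As th tends to pi the kernel concentrates at u = 0, where the cosine is 1; away from 0 it is of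
    order sin th, and near 0 the difference 1 - cos (tau u) compensates the singularity. *)
Let pois_bound tau u th : 0 < th < pi ->
  `|pois u th - cos (tau * u) * pois u th| <= sin th * ((2 * tau ^+ 2 + 4) / coshR u).
Proof.
move=> ht; have s0 : 0 < sin th by exact: sin_gt0_pi.
have C1 := coshR_ge1 u; have C0 := coshR_gt0 u.
have k1 : -1 < cos th.
  have p2 := @pi_gt0 R.
  have h1 : th \in `[0, pi] by rewrite in_itv/=; lra.
  have h2 : (pi : R) \in `[0, pi] by rewrite in_itv/=; lra.
  by rewrite -cospi ltr_cos//; case/andP: ht.
have D0 : 0 < coshR u + cos th by lra.
have o1 := one_sub_cos_le (tau * u); have o2 := coshR_sub1_ge u.
have o0 : 0 <= 1 - cos (tau * u) by rewrite subr_ge0 cos_le1.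
have o3 := cos_geN1 (tau * u).
have -> : pois u th - cos (tau * u) * pois u th = sin th * ((1 - cos (tau * u)) / (coshR u + cos th)).
  by rewrite /pois; ring.
rewrite normrM (gtr0_norm s0) ler_pM2l// ger0_norm; last by rewrite divr_ge0// ltW.
rewrite ler_pdivrMr// mulrAC ler_pdivlMr//.
have t2 : 0 <= tau ^+ 2 by rewrite sqr_ge0.
have := o1; rewrite exprMn => o1'.
(* For cosh u <= 2 the quotient of 1 - cos (tau u) by cosh u + cos th is at most tau^2; otherwise
   the denominator is at least cosh u / 2 and the numerator at most 2. *)
have [c2|c2] := leP (coshR u) 2; first by nra.
by nra.
Qed.

(** The limit th = pi in [pois_integral]: there the kernel has mass 2 pi concentrated at u = 0. The
    integrand factor 1 / (1 + cosh u) is half of 1 / cosh^2 (u / 2). *)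
Lemma cos_sech2_integral tau : sinhR (tau * pi) * \int[mu]_u (cos (tau * u) / (1 + coshR u)) = 2 * pi * tau.
Proof.
set V := Rintegral _ _ _.
pose B := \int[mu]_u ((2 * tau ^+ 2 + 4) / coshR u).
(* [q] is nonnegative to the left of pi and continuous; at pi its first term vanishes with sin pi,
   which leaves a nonpositive quantity and forces equality. *)
pose q th := `|tau| * (sin th * B) - `|2 * th * tau - sinhR (tau * th) * V|.
have p2 := @pi_gt0 R.
have q0 th : pi / 2 < th < pi -> 0 <= q th.
  move=> /andP[h1 h2]; rewrite /q subr_ge0.
  pose c := (th + pi) / 2.
  have c1 : pi / 2 <= c by rewrite /c; lra.
  have c2 : c < pi by rewrite /c; lra.
  have hc : - c < th < c by rewrite /c; lra.
  have h3 : 0 < th < pi by lra.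
  have E := pois_integral c1 c2 tau hc.
  have i1 : intble setT (fun u => cos (tau * u) * pois u th).
    exact: (intble_cos_sech tau (pois_continuous c1 c2 hc) (fun u => pois_le c1 c2 u hc)).
  have i0 : intble setT (pois^~ th).
    apply: (@intble_sech_dom R setT (1 + cos c)^-1) => //.
      by apply: continuous_measurable_fun; exact: (pois_continuous c1 c2 hc).
    by move=> u _; exact: (pois_le c1 c2 u hc).
  rewrite -E [2 * th * tau]mulrC -(pois_mass c1 c2 hc) -mulrBr -RintB// normrM.
  rewrite ler_wpM2l// /B -RintZl//; last exact/intbleZl/intble_sech.
  apply: Rint_le_norm => //.
  - exact: intble_meas (intbleB _ _ _).
  - by apply: intbleZl => //; exact/intbleZl/intble_sech.
  - by move=> u _; exact: pois_bound.
have cq : continuous q.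
  have cS : continuous (fun th => sin th * B).
    by apply: ex_der_continuous => x; eexists; dauto.
  have cN : continuous (fun th => 2 * th * tau - sinhR (tau * th) * V).
    apply: ex_der_continuous => x; eexists; apply: derB; first by dauto.
    apply: derM; last exact: der_cst.
    by apply: (der_comp (f := fun th => tau * th)); [dauto|exact: der_sinhR].
  move=> th; apply: cvgB; last by apply: cvg_norm; exact: cN.
  by apply: cvgM; [exact: cvg_cst|exact: cS].
have := @ge0_left_limit q (pi / 2) pi _ cq q0.
rewrite /q sinpi mul0r mulr0 sub0r oppr_ge0 normr_le0 subr_eq0 => H.
apply/esym; rewrite -mulrA [pi * tau]mulrC mulrA [2 * tau]mulrC.
have {}H : 2 * pi * tau == sinhR (tau * pi) * V by apply: H; lra.
by rewrite -(eqP H); ring.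
Qed.

Lemma intble_cos_sech2 tau : intble setT (fun u => cos (tau * u) / (1 + coshR u)).
Proof.
apply: (@intble_sech_dom R setT 1) => //.
  apply: continuous_measurable_fun; apply: ex_der_continuous => u; eexists.
  apply: derM; first by dauto.
  by apply: derV; [have := coshR_gt0 u => C0; rewrite gt_eqF//; lra|dauto].
move=> u _; have C0 := coshR_gt0 u.
have C1 : 0 < 1 + coshR u by lra.
rewrite normrM normfV (gtr0_norm C1) ler_pM ?cos_max ?invr_ge0 ?(ltW C1)//.
by rewrite lef_pV2 ?posrE//; lra.
Qed.

(** The modulus of the integrand of Gamma (1 + i tau) on the logarithmic scale. *)
Let a u := expR (u - expR u).

Let a_ge0 u : 0 <= a u. Proof. exact: expR_ge0. Qed.

Let a_le u : a u <= (2`!%:R + 0`!%:R) / 2 / coshR u.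
Proof. by have := expexp_le 0 u; rewrite mul1r. Qed.

Let a_le1 u : a u <= 1.
Proof.
by have := expR_pow_le 1 (expR_ge0 u); rewrite /a expRD expr1 (_ : 1`! = 1%N).
Qed.

Let ca : continuous a.
Proof. by apply: ex_der_continuous => u; eexists; rewrite /a; dauto. Qed.

Let ia : intble setT a.
Proof.
apply: (@intble_sech_dom R setT ((2`!%:R + 0`!%:R) / 2)) => //.
  exact: continuous_measurable_fun.
by move=> u _; rewrite ger0_norm.
Qed.

(** In t = e^v this is the integral of e^x t exp (- (1 + e^x) t), that is e^x / (1 + e^x)^2. *)
Let inner x : \int[mu]_v (a v * a (x + v)) = 2^-1 / (1 + coshR x).
Proof.
pose m := 1 + expR x; have x0 := expR_gt0 x.
have m0 : 0 < m by rewrite /m; lra.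
have m1 : m != 0 by rewrite gt_eqF.
pose A v := - (expR x) * ((expR v * m^-1 + m ^- 2) * expR (- (m * expR v))).
have dA v : der A v (a v * a (x + v)).
  rewrite /A; apply: der_eq; first by dauto.
  have -> : a v * a (x + v) = expR x * (expR v * expR v) * expR (- (m * expR v)).
    by rewrite /a -!expRD; congr expR; rewrite /m (expRD x v); ring.
  cbv beta; set E := expR (- (m * expR v)).
  have -> : m ^- 2 = m^-1 * m^-1 by rewrite -invfM.
  by field.
have cA : continuous (fun v => a v * a (x + v)).
  by apply: ex_der_continuous => v; eexists; rewrite /a; dauto.
have iA : intble setT (fun v => a v * a (x + v)).
  apply: (intble_le _ _ ia) => //; first exact: continuous_measurable_fun.
  by move=> v _; rewrite ger0_norm ?mulr_ge0// ler_piMr.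
rewrite (@FTC_T R A _ 0 (- (expR x) * m ^- 2) dA cA iA).
- rewrite sub0r /m /coshR expRN; field.
  by rewrite !gt_eqF//; nra.
- apply: norm_cvg0; apply: (squeeze_cvgr _ (cvg_cst 0) (cvg_sech_pinfty (expR x * (m^-1 + m ^- 2) * ((2`!%:R + 0`!%:R) / 2)))).
  near=> v; rewrite normr_ge0/= /A normrM normrN (gtr0_norm x0) -!mulrA ler_pM2l//.
  have v0 : 0 <= v by near: v; apply: nbhs_pinfty_ge; exact: num_real.
  have v1 : 1 <= expR v by rewrite -expR0 ler_expR.
  have i1 : 0 < m^-1 by rewrite invr_gt0.
  have i2 : 0 < m ^- 2 by rewrite invr_gt0 exprn_gt0.
  have w0 : 0 <= expR v * m^-1 + m ^- 2 by rewrite addr_ge0 ?(ltW i2)// mulr_ge0 ?expR_ge0 ?(ltW i1).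
  rewrite ger0_norm; last by rewrite mulr_ge0 ?expR_ge0.
  apply: (@le_trans _ _ ((m^-1 + m ^- 2) * a v)).
    rewrite /a expRD mulrA ler_pM ?expR_ge0//.
    + rewrite mulrDl; apply: lerD; first by rewrite mulrC.
      by rewrite ler_peMr// ltW.
    + rewrite ler_expR lerN2 ler_peMl ?expR_ge0// /m; lra.
  rewrite ler_wpM2l//; first by rewrite addr_ge0// ltW.
  by have := a_le v; rewrite -mulrA.
- have E0 : expR v @[v --> -oo] --> (0 : R).
    by apply/cvgNy_compNP; exact: cvgr_expR.
  have cphi : {for 0, continuous (fun t => - (expR x) * ((t * m^-1 + m ^- 2) * expR (- (m * t))))}.
    by apply: der_continuous; dauto.
  have := cvg_comp _ _ E0 cphi.
  by rewrite mul0r add0r mulr0 oppr0 expR0 mulr1.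
Unshelve. all: by end_near. Qed.

(** Gamma (1 + i tau) is the Fourier transform of [a], so its squared modulus is that of the
    autocorrelation computed in [inner], a multiple of 1 / (1 + cosh x). *)
Lemma gammaT0_sqr tau : sinhR (tau * pi) * modC (gammaT 0 tau) ^+ 2 = pi * tau.
Proof.
have mcos : measurable_fun setT (@cos R) by apply: continuous_measurable_fun; exact: continuous_cos.
have cc w : continuous (fun x => cos (tau * (x - w))).
  by apply: ex_der_continuous => x; eexists; dauto.
have cC : continuous (fun x => cos (tau * x)) by apply: ex_der_continuous => x; eexists; dauto.
have cS : continuous (fun x => sin (tau * x)) by apply: ex_der_continuous => x; eexists; dauto.
have iC : intble setT (fun u => a u * cos (tau * u)).
  apply: (intble_le _ _ ia) => //.
    by apply: measurable_funM; apply: continuous_measurable_fun.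
  by move=> u _; rewrite normrM (ger0_norm (a_ge0 u)) ler_piMr// cos_max.
have iS : intble setT (fun u => a u * sin (tau * u)).
  apply: (intble_le _ _ ia) => //.
    by apply: measurable_funM; apply: continuous_measurable_fun.
  by move=> u _; rewrite normrM (ger0_norm (a_ge0 u)) ler_piMr// sin_max.
have rE : reC (gammaT 0 tau) = \int[mu]_u (a u * cos (tau * u)).
  apply: eq_Rint => u _; rewrite !reimE /a; congr (expR _ * cos _); ring.
have iE : imC (gammaT 0 tau) = \int[mu]_u (a u * sin (tau * u)).
  apply: eq_Rint => u _; rewrite !reimE /a; congr (expR _ * sin _); ring.
pose F v x := a v * a (x + v) * cos (tau * x).
have ash v : intble setT (fun x => a (x + v)) by have := intble_shift v measurableT ia.
have ashE v : \int[mu]_x a (x + v) = \int[mu]_x a x by have := Rint_shift v measurableT ia.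
have aabs v x : `|F v x| <= a v * a (x + v).
  by rewrite /F normrM (ger0_norm (mulr_ge0 (a_ge0 _) (a_ge0 _))) ler_piMr ?mulr_ge0 ?cos_max.
have F1 v : intble setT (F v).
  apply: (@intble_le R setT _ (fun x => a v * a (x + v))) => //.
    apply: measurable_funM; last exact: continuous_measurable_fun.
    exact: intble_meas (intbleZl (a v) measurableT (ash v)).
  exact: (intbleZl (a v) measurableT (ash v)).
have F2 x : intble setT (F ^~ x).
  apply: (intble_le _ _ ia) => //.
    apply: continuous_measurable_fun.
    by apply: ex_der_continuous => v; eexists; rewrite /F /a; dauto.
  move=> v _; apply: (le_trans (aabs _ _)); exact: ler_piMr.
have mF : measurable_fun ([set: R] `*` [set: R]) (fun z : R * R => F z.1 z.2).
  rewrite setXTT /F; apply: measurable_funM; first apply: measurable_funM.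
  - by apply: (measurableT_comp (continuous_measurable_fun ca)).
  - apply: (measurableT_comp (continuous_measurable_fun ca)).
    exact: measurable_funD.
  - apply: measurableT_comp => //.
    by apply: measurable_funM => //.
have [||_ _ FE] := @Rfubini R setT setT F (fun v => a v * \int[mu]_x a x) measurableT measurableT
    mF (fun x _ => F1 x) (fun y _ => F2 y).
- exact: intbleZr.
- move=> v _; rewrite -(ashE v); have <- := RintZl (a v) measurableT (ash v).
  apply: (Rint_le measurableT (intble_norm measurableT (F1 v)) (intbleZl (a v) measurableT (ash v))).
  by move=> x _; exact: aabs.
(* After the translation by v, the addition formula for cos (tau (x - v)) separates the variables
   into the squares of the cosine and sine transforms of [a]. *)
have L : \int[mu]_v \int[mu]_x F v x = modC (gammaT 0 tau) ^+ 2.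
  pose I := \int[mu]_u (a u * cos (tau * u)); pose J := \int[mu]_u (a u * sin (tau * u)).
  rewrite modC_sqr rE iE -/I -/J.
  transitivity (\int[mu]_v (I * (a v * cos (tau * v)) + J * (a v * sin (tau * v)))).
    apply: eq_Rint => v _.
    have ic : intble setT (fun x => a x * cos (tau * (x - v))).
      apply: (intble_le measurableT _ ia).
        by apply: measurable_funM; apply: continuous_measurable_fun.
      by move=> u _; rewrite normrM (ger0_norm (a_ge0 u)) ler_piMr// cos_max.
    transitivity (a v * \int[mu]_x (a (x + v) * cos (tau * (x + v - v)))).
      have isv : intble setT (fun x => a (x + v) * cos (tau * (x + v - v))).
        by have := intble_shift v measurableT ic; rewrite preimage_setT.
      have <- := RintZl (a v) measurableT isv.
      by apply: eq_Rint => x _; rewrite /F addrK mulrA.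
    have := Rint_shift v measurableT ic; rewrite preimage_setT => ->.
    transitivity (a v * (cos (tau * v) * I + sin (tau * v) * J)); last by ring.
    congr (_ * _).
    have -> : cos (tau * v) * I = \int[mu]_u (cos (tau * v) * (a u * cos (tau * u))).
      exact: (esym (RintZl (cos (tau * v)) measurableT iC)).
    have -> : sin (tau * v) * J = \int[mu]_u (sin (tau * v) * (a u * sin (tau * u))).
      exact: (esym (RintZl (sin (tau * v)) measurableT iS)).
    have <- := RintD measurableT (intbleZl (cos (tau * v)) measurableT iC) (intbleZl (sin (tau * v)) measurableT iS).
    by apply: eq_Rint => x _; rewrite mulrBr cosB; ring.
  rewrite (RintD measurableT (intbleZl I measurableT iC) (intbleZl J measurableT iS)).
  rewrite (RintZl I measurableT iC) (RintZl J measurableT iS) -/I -/J; ring.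
rewrite -L FE.
transitivity (sinhR (tau * pi) * (2^-1 * \int[mu]_u (cos (tau * u) / (1 + coshR u)))); last first.
  by rewrite mulrCA cos_sech2_integral; field.
rewrite -(RintZl 2^-1 measurableT (intble_cos_sech2 tau)); congr (_ * _).
apply: eq_Rint => x _.
transitivity (\int[mu]_v (cos (tau * x) * (a v * a (x + v)))).
  by apply: eq_Rint => v _; rewrite /F; ring.
have iv : intble setT (fun v => a v * a (x + v)).
  apply: (intble_le measurableT _ ia).
    by apply: continuous_measurable_fun; apply: ex_der_continuous => v; eexists; rewrite /a; dauto.
  by move=> v _; rewrite (ger0_norm (mulr_ge0 (a_ge0 _) (a_ge0 _))) ler_piMr.
by rewrite (RintZl (cos (tau * x)) measurableT iv) inner; ring.
Qed.

End GammaModulus.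

(** * Hankel's integral *)

Section Hankel.
Context {R : realType}.
Implicit Types (a b u tau : R) (nu z w : R[i]) (k n : nat).

Local Notation ic := ((0 : R) +i* (1 : R)).

(** Hankel's integrand e^t t^(-nu-1) dt in the variable t = e^w. On the edges Im w = - pi and Im w =
    pi, e^w is - e^u, which leaves [hankel_ray_fun] times a phase depending on nu. *)
Definition hankel_fun nu w := cexp (cexp w - nu * w).
Definition hankel_ray_fun nu u := cexp (- (expR u)%:C - nu * u%:C).

Definition hankel_seg nu a := cintegral `[- pi, pi] (fun b => hankel_fun nu (a +i* b)).
Definition hankel_ray nu a := cintegral `]a, +oo[ (hankel_ray_fun nu).

Definition hankel_jump nu := cexp (- (ic * pi%:C * nu)) - cexp (ic * pi%:C * nu).

(* 2 pi i times Hankel's integral for 1 / Gamma (nu + 1), along the contour that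
   comes from +oo - i pi, follows Re w = a and goes back to +oo + i pi. *)
Definition hankel nu a := ic * hankel_seg nu a + hankel_jump nu * hankel_ray nu a.

Lemma hankel_fun_deriv (g : R -> R[i]) (d : R[i]) nu x : cder g x d ->
  cder (fun t => hankel_fun nu (g t)) x ((hankel_fun (nu - 1) (g x) - nu * hankel_fun nu (g x)) * d).
Proof.
move=> dg; rewrite /hankel_fun; apply: cder_eq.
  by apply/cder_cexp/cderB; [exact: cder_cexp dg|apply: cderM; [exact: cder_cst|exact: dg]].
have -> : cexp (g x) - (nu - 1) * g x = (cexp (g x) - nu * g x) + g x by ring.
by cbv beta; rewrite [cexp (_ + g x)]cexpD; ring.
Qed.

Lemma hankel_ray_fun_deriv nu u : cder (hankel_ray_fun nu) u
  (- (hankel_ray_fun (nu - 1) u + nu * hankel_ray_fun nu u)).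
Proof.
rewrite /hankel_ray_fun; apply: cder_eq.
  apply/cder_cexp/cderB; first by apply/cderN/cder_real/der_expR/der_id.
  by apply: cderM; [exact: cder_cst|exact: cder_id].
have -> : - (expR u)%:C - (nu - 1) * u%:C = (- (expR u)%:C - nu * u%:C) + u%:C by ring.
by cbv beta; rewrite /id [cexp (_ + u%:C)]cexpD cexpR mulr1; ring.
Qed.

Lemma cder_vert a b : cder (fun t => a +i* t) b ic.
Proof. by split; [exact: der_cst|exact: der_id]. Qed.

Lemma cder_horiz a b : cder (fun t => t +i* b) a 1.
Proof. by split; [exact: der_id|exact: der_cst]. Qed.

Lemma ccontD (f g : R -> R[i]) : ccont f -> ccont g -> ccont (fun t => f t + g t).
Proof.
move=> [f1 f2] [g1 g2]; split => t.
  by under eq_fun do rewrite reD; apply: cvgD; [exact: f1|exact: g1].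
by under eq_fun do rewrite imD; apply: cvgD; [exact: f2|exact: g2].
Qed.

Lemma ccontM (f g : R -> R[i]) : ccont f -> ccont g -> ccont (fun t => f t * g t).
Proof.
move=> [f1 f2] [g1 g2]; split => t.
  under eq_fun do rewrite reM.
  by apply: cvgB; apply: cvgM; [exact: f1|exact: g1|exact: f2|exact: g2].
under eq_fun do rewrite imM.
by apply: cvgD; apply: cvgM; [exact: f1|exact: g2|exact: f2|exact: g1].
Qed.

Lemma ccont_cst (c : R[i]) : ccont (fun=> c).
Proof. by split => t; exact: cvg_cst. Qed.

Lemma ccontN (f : R -> R[i]) : ccont f -> ccont (fun t => - f t).
Proof.
move=> [f1 f2]; split => t.
  by under eq_fun do rewrite reN; apply: cvgN; exact: f1.
by under eq_fun do rewrite imN; apply: cvgN; exact: f2.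
Qed.

Lemma ccont_hankel_seg nu a : ccont (fun b => hankel_fun nu (a +i* b)).
Proof. exact: cder_ccont (fun b => hankel_fun_deriv nu (cder_vert a b)). Qed.

Lemma ccont_hankel_ray nu : ccont (hankel_ray_fun nu).
Proof. exact: cder_ccont (hankel_ray_fun_deriv nu). Qed.

(** For u > a, - (Re nu) u <= u - (Re nu + 1) a. The range includes Re nu = -1, where the integral
    is normalised. *)
Lemma hankel_ray_bound nu a u : -1 <= reC nu -> a < u ->
  modC (hankel_ray_fun nu u) <=
  expR (- (reC nu + 1) * a) * ((2`!%:R + 0`!%:R) / 2) / coshR u.
Proof.
move=> n1 au; rewrite /hankel_ray_fun modC_cexp !reimE mulr0 subr0 -mulrA.
have := expexp_le 0 u; rewrite mul1r => H.
apply: (@le_trans _ _ (expR (- (reC nu + 1) * a) * expR (u - expR u))).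
  by rewrite -expRD ler_expR; nra.
by rewrite ler_wpM2l ?expR_ge0.
Qed.

Lemma cintegrable_hankel_ray nu a : -1 <= reC nu -> cintegrable `]a, +oo[ (hankel_ray_fun nu).
Proof.
move=> n1; apply: (@cintegrable_sech _ _ _ (expR (- (reC nu + 1) * a) * ((2`!%:R + 0`!%:R) / 2))) => //.
  by apply: ccont_cmeas => //; exact: ccont_hankel_ray.
by move=> u; rewrite /= in_itv/= andbT => au; exact: hankel_ray_bound.
Qed.

Lemma ccvg_hankel_ray nu : -1 <= reC nu -> ccvg +oo (hankel_ray_fun nu) 0.
Proof.
move=> n1; apply: (ccvg0_modC _ (cvg_sech_pinfty (expR (- (reC nu + 1) * 0) * ((2`!%:R + 0`!%:R) / 2)))).
have H : \forall u \near +oo, 0 < u :> R by apply: nbhs_pinfty_gt; exact: num_real.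
by apply: filterS H => u u0; exact: hankel_ray_bound.
Qed.

Lemma cexp_ipi : cexp (ic * pi%:C) = -1 :> R[i].
Proof.
apply: complex_eq; rewrite !reimE.
  have -> : 0 * pi - 1 * 0 = 0 :> R by ring.
  have -> : 0 * 0 + 1 * pi = pi :> R by ring.
  by rewrite expR0 cospi mul1r.
have -> : 0 * 0 + 1 * pi = pi :> R by ring.
by rewrite sinpi mulr0 oppr0.
Qed.

Lemma cexp_Nipi : cexp (- (ic * pi%:C)) = -1 :> R[i].
Proof.
have := cexpNM (ic * (pi : R)%:C); rewrite cexp_ipi mulN1r => /eqP.
by rewrite eqr_oppLR => /eqP.
Qed.

Lemma hankel_jumpS nu : hankel_jump (nu - 1) = - hankel_jump nu.
Proof.
rewrite /hankel_jump; set t := ic * pi%:C.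
have -> : - (t * (nu - 1)) = - (t * nu) + t by ring.
have -> : t * (nu - 1) = t * nu + - t by ring.
by rewrite !cexpD cexp_ipi cexp_Nipi; ring.
Qed.

Lemma hankel_fun_edges nu a :
  hankel_fun nu (a +i* pi) - hankel_fun nu (a +i* - pi) = hankel_jump nu * hankel_ray_fun nu a.
Proof.
have E (s : R[i]) : cexp s = -1 -> hankel_fun nu (a%:C + s) = cexp (- (s * nu)) * hankel_ray_fun nu a.
  move=> Es; rewrite /hankel_fun /hankel_ray_fun [cexp (a%:C + s)]cexpD Es cexpR -cexpD; congr cexp; ring.
have -> : a +i* pi = a%:C + ic * (pi : R)%:C by apply: complex_eq; rewrite !reimE; ring.
have -> : a +i* - pi = a%:C + - (ic * (pi : R)%:C) by apply: complex_eq; rewrite !reimE; ring.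
rewrite !E ?cexp_ipi ?cexp_Nipi// /hankel_jump mulNr opprK.
by rewrite mulrBl.
Qed.

(** Integration by parts on both pieces. By [hankel_fun_edges] the boundary term of the segment is
    the jump times the ray integrand at [a], and the boundary term of the ray cancels it; the sign
    in [hankel_jumpS] matches the one in the derivative of the ray integrand. *)
Lemma hankel_rec nu a : 0 <= reC nu -> hankel (nu - 1) a = nu * hankel nu a.
Proof.
move=> n0; have n1 : -1 <= reC (nu - 1) by rewrite !reimE; lra.
have n2 : -1 <= reC nu by lra.
have pp : - pi <= pi :> R by have := @pi_ge0 R; lra.
have s1 := @cintegrable_itv R (fun b => hankel_fun (nu - 1) (a +i* b)) (- pi) pi (ccont_hankel_seg _ _).
have s2 := @cintegrable_itv R (fun b => hankel_fun nu (a +i* b)) (- pi) pi (ccont_hankel_seg _ _).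
have r1 := cintegrable_hankel_ray a n1; have r2 := cintegrable_hankel_ray a n2.
have S := cFTC_itv pp (fun b => hankel_fun_deriv nu (cder_vert a b)) _.
have {}S : (hankel_seg (nu - 1) a - nu * hankel_seg nu a) * ic = hankel_jump nu * hankel_ray_fun nu a.
  rewrite -hankel_fun_edges -S.
    rewrite cintegralZr//; last by apply: cintegrableD => //; apply: cintegrableN => //; exact: cintegrableZ.
    by rewrite cintegralB ?cintegralZ//; exact: cintegrableZ.
  apply: ccontM; last exact: ccont_cst.
  apply: ccontD; first exact: ccont_hankel_seg.
  by apply: ccontN; apply: ccontM; [exact: ccont_cst|exact: ccont_hankel_seg].
have T : cintegral `]a, +oo[ (fun u => - (hankel_ray_fun (nu - 1) u + nu * hankel_ray_fun nu u)) =
    0 - hankel_ray_fun nu a.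
  apply: cFTC_y; first exact: hankel_ray_fun_deriv.
  - apply: ccontN; apply: ccontD; first exact: ccont_hankel_ray.
    by apply: ccontM; [exact: ccont_cst|exact: ccont_hankel_ray].
  - by apply: cintegrableN => //; apply: cintegrableD => //; exact: cintegrableZ.
  - exact: ccvg_hankel_ray.
have r3 := cintegrableZ nu (measurable_itv _) r2.
move: T; rewrite cintegralN//; last exact: cintegrableD.
rewrite cintegralD// cintegralZ// -/(hankel_ray _ _) -/(hankel_ray _ _) => T.
rewrite /hankel hankel_jumpS.
have {}T : hankel_ray_fun nu a = hankel_ray (nu - 1) a + nu * hankel_ray nu a.
  by rewrite -[RHS]opprK T sub0r opprK.
move: S; rewrite T => S; apply/eqP; rewrite -subr_eq0; apply/eqP.
transitivity ((hankel_seg (nu - 1) a - nu * hankel_seg nu a) * ic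
  - hankel_jump nu * (hankel_ray (nu - 1) a + nu * hankel_ray nu a)); first by ring.
by rewrite S subrr.
Qed.

(** A crude growth bound, enough on bounded sets of w to differentiate or pass to the limit under
    the segment integral. *)
Lemma modC_hankel_fun_le nu w : modC (hankel_fun nu w) <= expR (expR (modC w) + modC nu * modC w).
Proof.
rewrite /hankel_fun modC_cexp ler_expR; apply: (le_trans (ler_norm _)).
apply: (le_trans (re_le_modC _)); apply: (le_trans (modCB _ _)).
rewrite modCM modC_cexp lerD2r ler_expR.
exact: (le_trans (ler_norm _) (re_le_modC _)).
Qed.

(** When the segment moves horizontally, the derivative in a is - i times the derivative in b, whose
    integral is the difference of the edge values. *)
Lemma cder_hankel_seg nu a : cder (hankel_seg nu) a (- ic * (hankel_jump nu * hankel_ray_fun nu a)).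
Proof.
have p0 := @pi_ge0 R.
have pp : - pi <= pi :> R by lra.
(* Bounds the modulus of w when its real part is within 1 of [a]. *)
pose M := `|a| + 1 + pi.
have wM t b : a - 1 < t < a + 1 -> `[- pi, pi]%classic b -> modC (t +i* b) <= M.
  move=> t1 b1'; have b1 : - pi <= b <= pi by move: b1'; rewrite /= in_itv.
  apply: (le_trans (modC_le _)); rewrite !reimE /M.
  apply: lerD; last by rewrite ler_norml; lra.
  have := ler_norm a; have := ler_norm (- a); rewrite normrN => h1 h2.
  by rewrite ler_norml; lra.
have hM nu' t b : a - 1 < t < a + 1 -> `[- pi, pi]%classic b ->
    modC (hankel_fun nu' (t +i* b)) <= expR (expR M + modC nu' * M).
  move=> t1 b1; apply: (le_trans (modC_hankel_fun_le _ _)).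
  have := wM _ _ t1 b1 => h; rewrite ler_expR; apply: lerD; first by rewrite ler_expR.
  by rewrite ler_wpM2l// modC_ge0.
apply: cder_eq.
  apply: (@cder_cint R `[- pi, pi] (fun t b => hankel_fun nu (t +i* b))
    (fun t b => (hankel_fun (nu - 1) (t +i* b) - nu * hankel_fun nu (t +i* b)) * 1)
    (fun=> expR (expR M + modC (nu - 1) * M) + modC nu * expR (expR M + modC nu * M)) (a - 1) (a + 1)).
  - by [].
  - by lra.
  - by move=> t _; apply: cintegrable_itv; exact: ccont_hankel_seg.
  - by apply: (@continuous_compact_integrable R (fun=> _)); [exact: segment_compact|exact: continuous_subspaceT (fun=> cvg_cst _)].
  - move=> t b t1 b1; split.
      by apply: (@hankel_fun_deriv (fun t => t +i* b)); exact: cder_horiz.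
    rewrite mulr1; apply: (le_trans (modCB _ _)); apply: lerD; first exact: hM.
    by rewrite modCM ler_wpM2l ?modC_ge0//; exact: hM.
rewrite -hankel_fun_edges.
have S := cFTC_itv pp (fun b => hankel_fun_deriv nu (cder_vert a b)) _.
rewrite -S.
  rewrite -cintegralZ//; last first.
    apply: cintegrable_itv; apply: ccontM; last exact: ccont_cst.
    apply: ccontD; first exact: ccont_hankel_seg.
    by apply: ccontN; apply: ccontM; [exact: ccont_cst|exact: ccont_hankel_seg].
  apply: eq_cintegral => b _; set X := _ - _.
  transitivity (- (ic * ic) * X); first by rewrite ii2; ring.
  by ring.
apply: ccontM; last exact: ccont_cst.
apply: ccontD; first exact: ccont_hankel_seg.
by apply: ccontN; apply: ccontM; [exact: ccont_cst|exact: ccont_hankel_seg].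
Qed.

(** Independence of the abscissa allows a to tend to - oo for the normalisation and to be ln (y / 2)
    for the Bessel function. *)
Lemma hankel_cst nu a a' : -1 <= reC nu -> a <= a' -> hankel nu a = hankel nu a'.
Proof.
move=> n1 aa.
have r1 := cintegrable_hankel_ray a n1.
have S := @cFTC_itv R (hankel_seg nu) _ a a' aa (cder_hankel_seg nu) _.
have {}S : hankel_seg nu a' - hankel_seg nu a = - ic * (hankel_jump nu * cintegral `[a, a'] (hankel_ray_fun nu)).
  rewrite -S; last by do 2 (apply: ccontM; first exact: ccont_cst); exact: ccont_hankel_ray.
  have i1 := @cintegrable_itv R (hankel_ray_fun nu) a a' (ccont_hankel_ray nu).
  by rewrite cintegralZ ?cintegralZ//; exact: cintegrableZ.
have T : hankel_ray nu a = cintegral `[a, a'] (hankel_ray_fun nu) + hankel_ray nu a'.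
  have i1 := @cintegrable_itv R (hankel_ray_fun nu) a a' (ccont_hankel_ray nu).
  have -> : cintegral `[a, a'] (hankel_ray_fun nu) = cintegral `]a, a'] (hankel_ray_fun nu).
    have j : cintegrable `]a, a'] (hankel_ray_fun nu).
      case: i1 => i1 i2; split.
        by apply: (@intbleS _ `]a, a'] `[a, a'] _ _ _ _ i1) => // x /=; rewrite !in_itv/= => /andP[/ltW -> ->].
      by apply: (@intbleS _ `]a, a'] `[a, a'] _ _ _ _ i2) => // x /=; rewrite !in_itv/= => /andP[/ltW -> ->].
    case: j => j1 j2; apply: complex_eq => /=.
      by rewrite (Rintegral_itv_obnd_cbnd j1).
    by rewrite (Rintegral_itv_obnd_cbnd j2).
  have E : `]a, +oo[%classic = `]a, a'] `|` `]a', +oo[ :> set R.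
    apply/seteqP; split => x /=; rewrite !in_itv/= !andbT.
      by move=> ax; have [xa|xa] := leP x a'; [left; rewrite ax|right].
    by move=> [/andP[]//|]; exact: le_lt_trans.
  rewrite /hankel_ray E cintegral_setU//; first by rewrite -E.
  by rewrite disj_set2E; apply/eqP/seteqP; split => x //=; rewrite !in_itv/= andbT => -[]; lra.
rewrite /hankel T; apply/esym/eqP; rewrite -subr_eq0; apply/eqP.
transitivity (ic * (hankel_seg nu a' - hankel_seg nu a) - hankel_jump nu * cintegral `[a, a'] (hankel_ray_fun nu)).
  by move: (hankel_seg nu a) (hankel_seg nu a') (hankel_jump nu) (hankel_ray nu a') (cintegral _ _) => *; ring.
rewrite S; set X := hankel_jump nu * cintegral _ _.
transitivity (- (ic * ic) * X - X); first by ring.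
by rewrite ii2; ring.
Qed.

End Hankel.

Section ComplexLimit.
Context {R : realType}.

Lemma ccvg_cvg {T} (F : set_system T) {FF : Filter F} (f : T -> R[i]) (l : R[i]) :
  ccvg F f l -> (f t : R[i]^o) @[t --> F] --> (l : R[i]^o).
Proof.
move=> [c1 c2]; apply/cvgrPdist_lt => e e0.
have [r r0 er] : exists2 r : R, 0 < r & e = r%:C.
  case: e e0 => p q; rewrite ltcE /= => /andP[/eqP q0 p0]; exists p => //.
  by rewrite q0.
have r2 : 0 < r / 2 by rewrite divr_gt0.
move/cvgrPdist_lt: c1 => /(_ _ r2) h1; move/cvgrPdist_lt: c2 => /(_ _ r2) h2.
near=> t.
have a1 : `|reC l - reC (f t)| < r / 2 by near: t.
have a2 : `|imC l - imC (f t)| < r / 2 by near: t.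
have H : modC (l - f t) < r.
  apply: le_lt_trans (modC_le _) _; rewrite !reimE; lra.
by rewrite er /Num.norm /= ltcR; exact: H.
Unshelve. all: by end_near. Qed.

Lemma ccvg_limn (u : nat -> R[i]) (l : R[i]) : ccvg \oo u l -> limn (u : nat -> R[i]^o) = l.
Proof.
move=> /ccvg_cvg H; apply: (@cvg_lim (R[i]^o)) => //; exact: norm_hausdorff.
Qed.

End ComplexLimit.

(** * The power series of the complex exponential *)

Section ExpSeries.
Context {R : realType}.
Implicit Types (z w : R[i]) (n : nat).

Definition cexp_sum n z := \sum_(k < n) z ^+ k / k`!%:R.

Lemma cexp_sumS n z : cexp_sum n.+1 z = cexp_sum n z + z ^+ n / n`!%:R.
Proof. by rewrite /cexp_sum big_ord_recr. Qed.

Lemma modC_nat n : modC (n%:R : R[i]) = n%:R.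
Proof. by rewrite -(rmorph_nat (real_complex R)) modCR ger0_norm. Qed.

Lemma modC0 : modC (0 : R[i]) = 0.
Proof. exact: ComplexField.Normc.normc0. Qed.

Lemma modCX z n : modC (z ^+ n) = modC z ^+ n.
Proof.
elim: n => [|n IH]; last by rewrite !exprS modCM IH.
by rewrite !expr0 (_ : (1 : R[i]) = 1%:R)// modC_nat.
Qed.

Lemma modCV z : modC z^-1 = (modC z)^-1.
Proof. exact: ComplexField.Normc.normcV. Qed.

(** The bound is uniform in [n], so it dominates the partial sums when series and contour integral
    are interchanged. *)
Lemma modC_cexp_sum n z : modC (cexp_sum n z) <= expR (modC z).
Proof.
apply: (@le_trans _ _ (series (exp_coeff (modC z)) n)).
  elim: n => [|n IH]; first by rewrite /cexp_sum big_ord0 modC0 /series /= big_geq.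
  rewrite cexp_sumS seriesSr; apply: (le_trans (modCD _ _)); apply: lerD => //.
  by rewrite modCM modCX modCV modC_nat /exp_coeff.
apply: nondecreasing_cvgn_le; last exact: is_cvg_series_exp_coeff.
by apply: nondecreasing_series => k _ _; apply: exp_coeff_ge0; exact: modC_ge0.
Qed.

Lemma natC_neq0 n : (n.+1%:R : R[i]) != 0. Proof. by rewrite pnatr_eq0. Qed.

Lemma cder_monomial n z t :
  cder (fun s => (s%:C * z) ^+ n.+1 / n.+1`!%:R) t (z * ((t%:C * z) ^+ n / n`!%:R)).
Proof.
have dz s : cder (fun s => s%:C * z) s z.
  by apply: cder_eq; [apply: cderM; [exact: cder_id|exact: cder_cst]|rewrite mul1r mulr0 addr0].
elim: n => [|n IH].
  apply: (cder_ext (f := fun s => s%:C * z)); last first.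
    by rewrite expr0 (_ : 0`! = 1)%N// divr1 mulr1; exact: dz.
  by move=> s; rewrite expr1 (_ : 1`! = 1)%N// divr1.
apply: (cder_ext (f := fun s => (s%:C * z) * ((s%:C * z) ^+ n.+1 / n.+1`!%:R) / n.+2%:R)).
  move=> s; rewrite [in RHS]exprS [in RHS]factS [in RHS]natrM invfM.
  set X := s%:C * z; move: (X ^+ n.+1) (n.+1`!%:R^-1) (n.+2%:R^-1) => Y p q; ring.
apply: cder_eq; first by apply: cderM; [apply: cderM; [exact: dz|exact: IH]|exact: cder_cst].
cbv beta; rewrite mulr0 addr0 [in RHS]factS natrM invfM.
set X := (t%:C * z); set q := n`!%:R^-1.
have N1 := natC_neq0 n; have N2 := natC_neq0 n.+1.
rewrite !exprS.
have -> : (z * (X * X ^+ n * (n.+1%:R^-1 * q)) + X * (z * (X ^+ n * q))) =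
   n.+2%:R * (n.+1%:R^-1 * (z * (X * X ^+ n * q))).
  rewrite -[n.+2%:R]natr1 mulrDl mul1r mulVKf//.
  by move: (n.+1%:R^-1) => p; ring.
rewrite [n.+2%:R * _]mulrC mulfK//.
by move: (n.+1%:R^-1) => p; ring.
Qed.

Lemma cder_cexp_sum n z t :
  cder (fun s => cexp_sum n.+1 (s%:C * z)) t (z * cexp_sum n (t%:C * z)).
Proof.
elim: n => [|n IH].
  rewrite {2}/cexp_sum big_ord0 mulr0.
  apply: (cder_ext (f := fun=> 1)); last exact: cder_cst.
  by move=> s; rewrite /cexp_sum big_ord_recr big_ord0 /= expr0 (_ : 0`! = 1)%N// divr1 add0r.
apply: (cder_ext (f := fun s => cexp_sum n.+1 (s%:C * z) + (s%:C * z) ^+ n.+1 / n.+1`!%:R)).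
  by move=> s; rewrite [RHS]cexp_sumS.
by rewrite cexp_sumS mulrDr; apply: cderD => //; exact: cder_monomial.
Qed.

Lemma ccvg_cexp_sum z : ccvg \oo (fun n => cexp_sum n z) (cexp z).
Proof.
suff H : ccvg \oo (fun n => cexp_sum n.+1 z) (cexp z).
  case: H => h1 h2; split; first by rewrite -(cvg_shiftS (fun n => reC (cexp_sum n z))).
  by rewrite -(cvg_shiftS (fun n => imC (cexp_sum n z))).
(* In the derivative of e^(-tz) times the partial sum at tz all terms but the last cancel, so the
   error in e^-z times the partial sum, compared with 1, is an integral of one term of the
   series. *)
pose g n (t : R) := cexp (- (t%:C * z)) * cexp_sum n.+1 (t%:C * z).
pose g' n (t : R) := - z * (cexp (- (t%:C * z)) * ((t%:C * z) ^+ n / n`!%:R)).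
have dz s : cder (fun s => s%:C * z) s z.
  by apply: cder_eq; [apply: cderM; [exact: cder_id|exact: cder_cst]|rewrite mul1r mulr0 addr0].
have dg n t : cder (g n) t (g' n t).
  rewrite /g; apply: cder_eq.
    by apply: cderM; [exact: (cder_cexp (cderN (dz t)))|exact: cder_cexp_sum].
  by cbv beta; rewrite /g' cexp_sumS; ring.
have cg' n : ccont (g' n).
  apply: ccontM; first exact: ccont_cst.
  apply: ccontM; first exact: cder_ccont (fun t => cder_cexp (cderN (dz t))).
  case: n => [|n].
    rewrite (_ : (fun t => _) = fun=> 1); first exact: ccont_cst.
    by apply/funext => t; rewrite expr0 (_ : 0`! = 1)%N// divr1.
  exact: cder_ccont (cder_monomial n z).
have E n : cintegral `[0, 1] (g' n) = cexp (- z) * cexp_sum n.+1 z - 1.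
  rewrite (cFTC_itv _ (dg n) (cg' n)); last exact: ler01.
  rewrite /g !mul1r; congr (_ - _).
  rewrite (_ : (0 : R)%:C = 0)// mul0r oppr0 cexp0 mul1r /cexp_sum big_ord_recl /= expr0 (_ : 0`! = 1)%N// divr1.
  by rewrite big1 ?addr0// => i _; rewrite expr0n mul0r.
have B n : modC (cexp (- z) * cexp_sum n.+1 z - 1) <=
    2 * modC z * expR (modC z) * exp_coeff (modC z) n.
  rewrite -E; set K := modC z * expR (modC z) * exp_coeff (modC z) n.
  have -> : 2 * modC z * expR (modC z) * exp_coeff (modC z) n = 2 * \int[mu]_(x in `[0 : R, 1]) K.
    rewrite Rintegral_cst//= lebesgue_measure_itv/= lte01 oppr0 addr0 /K (_ : fine 1%E = 1 :> R)//; ring.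
  apply: modC_cintegral_le => //.
  - by apply: ccont_cmeas.
  - by apply: (@continuous_compact_integrable R (fun=> _)); [exact: segment_compact|exact: continuous_subspaceT (fun=> cvg_cst _)].
  - move=> t; rewrite /mkset in_itv/= => /andP[t0 t1].
    have tz : modC (t%:C * z) <= modC z by rewrite modCM modCR ger0_norm// ler_piMl// modC_ge0.
    rewrite /g' modCM modCN modCM /K -[leRHS]mulrA ler_wpM2l ?modC_ge0// ler_pM ?modC_ge0//.
      rewrite modC_cexp ler_expR; apply: (le_trans (ler_norm _)).
      by apply: (le_trans (re_le_modC _)); rewrite modCN.
    rewrite modCM modCX modCV modC_nat /exp_coeff /= ler_wpM2r ?invr_ge0// lerXn2r ?nnegrE ?modC_ge0//.
have Z : ccvg \oo (fun n => cexp (- z) * cexp_sum n.+1 z - 1) 0.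
  apply: (ccvg0_modC (nearW _ B)).
  rewrite -[X in _ --> X](mulr0 (2 * modC z * expR (modC z))); apply: cvgM; first exact: cvg_cst.
  by apply: cvg_series_cvg_0; exact: is_cvg_series_exp_coeff.
have Z2 : ccvg \oo (fun n => cexp z * (cexp (- z) * cexp_sum n.+1 z - 1 + 1)) (cexp z * (0 + 1)).
  by apply: ccvgM; [exact: ccvg_cst|apply: ccvgD => //; exact: ccvg_cst].
move: Z2; rewrite add0r mulr1.
have E2 n : cexp z * (cexp (- z) * cexp_sum n.+1 z - 1 + 1) = cexp_sum n.+1 z.
  by rewrite subrK mulrA cexpNM mul1r.
by rewrite (funext E2).
Qed.

End ExpSeries.

(** * Hankel's integral as the reciprocal of Gamma *)

Section HankelGamma.
Context {R : realType}.
Implicit Types (a b u tau : R) (nu z w : R[i]) (k n : nat).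

Local Notation ic := ((0 : R) +i* (1 : R)).

Lemma hankel_jump_imag tau : hankel_jump (0 +i* tau) = (2 * sinhR (tau * pi))%:C.
Proof.
rewrite /hankel_jump.
have -> : ic * pi%:C * (0 +i* tau) = (- (tau * pi))%:C by apply: complex_eq; rewrite !reimE; ring.
rewrite -RtoCN opprK !cexpR -RtoCN -RtoCD; congr (_%:C).
by rewrite /sinhR; field.
Qed.

Lemma hankel_jumpD tau k : hankel_jump ((0 +i* tau) + k%:R) = (-1) ^+ k * hankel_jump (0 +i* tau).
Proof.
elim: k => [|k IH]; first by rewrite addr0 expr0 mul1r.
have := hankel_jumpS ((0 +i* tau) + k.+1%:R).
rewrite -addrA (_ : k.+1%:R - 1 = k%:R :> R[i]); last by rewrite -natr1 addrK.
by rewrite IH exprS => E; rewrite mulN1r mulNr E opprK.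
Qed.

Lemma hankel_ray_fun_gamma tau u : hankel_ray_fun ((0 +i* tau) - 1) u =
  cexp ((1%:R +i* - tau) * u%:C - (expR u)%:C).
Proof.
by rewrite /hankel_ray_fun; congr cexp; apply: complex_eq; rewrite !reimE; ring.
Qed.

(** At nu = - 1 + i tau the integrand is exp (e^w) e^((1 - i tau) w): as a tends to - oo the segment
    is of order e^a, while the ray fills the line and becomes Gamma (1 - i tau). *)
Lemma hankel_base tau a : hankel ((0 +i* tau) - 1) a = hankel_jump ((0 +i* tau) - 1) * gammaT 0 (- tau).
Proof.
set nu := (0 +i* tau) - 1.
have n1 : -1 <= reC nu by rewrite /nu !reimE; lra.
have p0 := @pi_ge0 R.
have H n : hankel nu (a - n%:R) = hankel nu a by apply: hankel_cst => //; rewrite lerBlDr lerDl.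
have c0 : ccvg \oo (fun n : nat => hankel nu (a - n%:R)) (hankel nu a).
  by rewrite (funext H); exact: ccvg_cst.
apply: (ccvg_unique c0).
have cE : expR (a - n%:R) @[n --> \oo] --> (0 : R).
  have E0 : expR v @[v --> -oo] --> (0 : R) by apply/cvgNy_compNP; exact: cvgr_expR.
  exact: (cvg_comp _ _ (cvg_natB a) E0).
have cs : ccvg \oo (fun n : nat => hankel_seg nu (a - n%:R)) 0.
  pose K := expR (expR a + `|tau| * pi).
  have B n : modC (hankel_seg nu (a - n%:R)) <= 4 * pi * K * expR (a - n%:R).
    have -> : 4 * pi * K * expR (a - n%:R) = 2 * \int[mu]_(x in `[(- pi : R), pi]) (K * expR (a - n%:R)).
      rewrite Rintegral_cst//= lebesgue_measure_itv/= lte_fin.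
      by rewrite gtrN ?pi_gt0//= opprK; ring.
    apply: modC_cintegral_le => //.
    - by apply: ccont_cmeas => //; exact: ccont_hankel_seg.
    - by apply: (@continuous_compact_integrable R (fun=> _)); [exact: segment_compact|exact: continuous_subspaceT (fun=> cvg_cst _)].
    - move=> b b_; have /andP[b1 b2] : - pi <= b <= pi by move: b_; rewrite /= in_itv.
      rewrite /hankel_fun modC_cexp -expRD ler_expR !reimE.
      have e1 : expR (a - n%:R) <= expR a by rewrite ler_expR lerBlDr lerDl.
      have e2 : expR (a - n%:R) * cos b <= expR (a - n%:R).
        by rewrite ler_piMr ?expR_ge0 ?cos_le1.
      have e3 : tau * b <= `|tau| * pi.
        apply: le_trans (ler_norm _) _; rewrite normrM ler_wpM2l// ler_norml; lra.
      by rewrite oppr0 addr0; lra.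
  apply: (ccvg0_modC (nearW _ B)).
  by rewrite -[X in _ --> X](mulr0 (4 * pi * K)); apply: cvgM; [exact: cvg_cst|exact: cE].
have cr : ccvg \oo (fun n : nat => hankel_ray nu (a - n%:R)) (gammaT 0 (- tau)).
  have gi : cintegrable setT (hankel_ray_fun nu).
    by apply: eq_cintegrable (cintegrable_gammaT 0 (- tau)) => // u _; rewrite hankel_ray_fun_gamma.
  have -> : gammaT 0 (- tau) = cintegral setT (hankel_ray_fun nu).
    by apply: eq_cintegral => u _; rewrite hankel_ray_fun_gamma.
  have N x : setT x -> \forall n \near \oo, `]a - n%:R, +oo[%classic x.
    move=> _; have := near_natB_le a (x - 1); apply: filterS => n h.
    by rewrite /= in_itv/= andbT; lra.
  case: gi => g1 g2; split => /=.
    exact: (@Rint_exhaust R setT (fun n : nat => `]a - n%:R, +oo[%classic) (fun u => reC (hankel_ray_fun nu u))).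
  exact: (@Rint_exhaust R setT (fun n : nat => `]a - n%:R, +oo[%classic) (fun u => imC (hankel_ray_fun nu u))).
rewrite -[X in ccvg _ _ X]add0r -(mulr0 ic); apply: ccvgD.
  by apply: ccvgM => //; exact: ccvg_cst.
by apply: ccvgM => //; exact: ccvg_cst.
Qed.

Lemma gammaT0_conj tau : gammaT 0 tau * gammaT 0 (- tau) = (modC (gammaT 0 tau) ^+ 2)%:C.
Proof.
have r1 : reC (gammaT 0 (- tau)) = reC (gammaT 0 tau).
  apply: eq_Rint => u _; rewrite !reimE -(cosN (_ + - tau * u + - 0)); congr (expR _ * cos _); ring.
have i1 : imC (gammaT 0 (- tau)) = - imC (gammaT 0 tau).
  case: (cintegrable_gammaT 0 tau) => _ i.
  transitivity (\int[mu]_u (- imC (cexp ((1%:R +i* tau) * u%:C - (expR u)%:C)))).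
    2: by rewrite RintN.
  apply: eq_Rint => u _; rewrite !reimE -[RHS]mulrN -sinN; congr (expR _ * sin _); ring.
apply: complex_eq; rewrite (reM, imM) r1 i1.
  by rewrite -[RHS]/(modC (gammaT 0 tau) ^+ 2) modC_sqr; ring.
by rewrite -[RHS]/(0 : R); ring.
Qed.

(** The recurrences of [gammaT] and [hankel] have inverse factors, so the product is the same for
    all k; for k = 0 one more step down reaches [hankel_base] and the modulus of Gamma (1 + i
    tau). *)
Lemma hankel_gamma tau k a : tau != 0 ->
  gammaT k tau * hankel ((0 +i* tau) + k%:R) a = (2 * pi)%:C * ic.
Proof.
move=> t0; elim: k => [|k IH].
  have it0 : (0 +i* tau) != 0 :> R[i] by rewrite eq_complex /= negb_and t0 orbT.
  (* Multiplication by i tau turns the claim into - 2 sinh (pi tau) |Gamma (1 + i tau)|^2 = - 2 pi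
     tau. *)
  rewrite addr0; apply: (mulfI it0).
  have rec : hankel ((0 +i* tau) - 1) a = (0 +i* tau) * hankel (0 +i* tau) a by exact: hankel_rec.
  rewrite mulrCA -rec hankel_base hankel_jumpS hankel_jump_imag mulrCA gammaT0_conj.
  rewrite -RtoCN -RtoCM.
  have -> : - (2 * sinhR (tau * pi)) * modC (gammaT 0 tau) ^+ 2 = - (2 * (pi * tau)).
    by rewrite -gammaT0_sqr; ring.
  by apply: complex_eq; rewrite !reimE; ring.
have E : (0 +i* tau) + k.+1%:R - 1 = (0 +i* tau) + k%:R :> R[i].
  by rewrite -natr1 addrA addrK.
have rec : hankel ((0 +i* tau) + k.+1%:R - 1) a = ((0 +i* tau) + k.+1%:R) * hankel ((0 +i* tau) + k.+1%:R) a.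
  by apply: hankel_rec; rewrite !reimE add0r ler0n.
rewrite -IH -E rec gammaT_rec.
have -> : (k.+1%:R +i* tau) = (0 +i* tau) + k.+1%:R :> R[i].
  by apply: complex_eq; rewrite !reimE ?add0r ?addr0.
ring.
Qed.

End HankelGamma.

(** * Contour and Mehler-Sonine integrals for J *)

Section BesselJ.
Context {R : realType}.
Implicit Types (a b u v y tau : R) (nu z w : R[i]) (k n : nat).

Local Notation ic := ((0 : R) +i* (1 : R)).

Lemma cexp_natM k z : cexp (k%:R * z) = cexp z ^+ k.
Proof.
elim: k => [|k IH]; first by rewrite mul0r cexp0 expr0.
by rewrite -[k.+1%:R]natr1 mulrDl mul1r cexpD IH exprSr.
Qed.

(** With the contour at a = ln (y / 2), the k-th term of the series of J brings the k-th power of -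
    e^(2a - w) under Hankel's integral; e^(2a - w) is [cexp (a -i* b)] on the segment and - e^(2a -
    u) on the edges. *)
Definition segJ nu a n b :=
  hankel_fun nu (a +i* b) * cexp (nu * a%:C) * cexp_sum n (- cexp (a -i* b)).
Definition rayJ nu a n u :=
  hankel_ray_fun nu u * cexp (nu * a%:C) * cexp_sum n (cexp (2 * a - u)%:C).

Definition coefJ nu a k := (k`!%:R)^-1 * cexp ((nu + (2 * k)%:R) * a%:C).

Lemma segJ_term nu a k b :
  hankel_fun nu (a +i* b) * cexp (nu * a%:C) * ((- cexp (a -i* b)) ^+ k / k`!%:R) =
  (-1) ^+ k * coefJ nu a k * hankel_fun (nu + k%:R) (a +i* b).
Proof.
rewrite [(- cexp _) ^+ k]exprNn -cexp_natM /coefJ /hankel_fun.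
have -> : cexp (a +i* b) - (nu + k%:R) * (a +i* b) = (cexp (a +i* b) - nu * (a +i* b)) + - (k%:R * (a +i* b)) by ring.
have -> : (nu + (2 * k)%:R) * a%:C = nu * a%:C + (k%:R * (a +i* b) + k%:R * (a -i* b)).
  by rewrite natrM; apply: complex_eq; rewrite !reimE; ring.
rewrite !cexpD; set X := cexp (k%:R * (a +i* b)); set Y := cexp (- (k%:R * (a +i* b))).
have XY : X * Y = 1 by exact: cexpNM.
set P := cexp (cexp _); set Q := cexp (- _); set S := cexp (nu * _); set T := cexp (k%:R * (a -i* b)).
set c := (-1) ^+ k; set q := _^-1.
transitivity (X * Y * (P * Q * S * (c * T * q))); first by rewrite XY; ring.
by ring.
Qed.

(** In contrast to [segJ_term] there is no sign (-1)^k: it is absorbed by the value -1 of e^w / e^u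
    on the edges, and comes back through [hankel_jumpD]. *)
Lemma rayJ_term nu a k u :
  hankel_ray_fun nu u * cexp (nu * a%:C) * (cexp (2 * a - u)%:C ^+ k / k`!%:R) =
  coefJ nu a k * hankel_ray_fun (nu + k%:R) u.
Proof.
rewrite -cexp_natM /coefJ /hankel_ray_fun.
have -> : - (expR u)%:C - (nu + k%:R) * u%:C = (- (expR u)%:C - nu * u%:C) + - (k%:R * u%:C) by ring.
have -> : (nu + (2 * k)%:R) * a%:C = nu * a%:C + (k%:R * u%:C + k%:R * (2 * a - u)%:C).
  by rewrite natrM; apply: complex_eq; rewrite !reimE; ring.
rewrite !cexpD; set X := cexp (k%:R * u%:C); set Y := cexp (- (k%:R * u%:C)).
have XY : X * Y = 1 by exact: cexpNM.
set P := cexp (- _); set Q := cexp (- (nu * _)); set S := cexp (nu * _); set T := cexp (k%:R * (_ - _)%:C).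
set q := _^-1.
transitivity (X * Y * (P * Q * S * (T * q))); first by rewrite XY; ring.
by ring.
Qed.

Lemma ccont_segJ nu a n : ccont (segJ nu a n).
Proof.
elim: n => [|n IH].
  rewrite (_ : segJ nu a 0 = fun=> 0); first exact: ccont_cst.
  by apply/funext => b; rewrite /segJ /cexp_sum big_ord0 mulr0.
rewrite (_ : segJ nu a n.+1 = fun b => segJ nu a n b + (-1) ^+ n * coefJ nu a n * hankel_fun (nu + n%:R) (a +i* b)).
  by apply: ccontD => //; apply: ccontM; [exact: ccont_cst|exact: ccont_hankel_seg].
by apply/funext => b; rewrite /segJ cexp_sumS mulrDr segJ_term.
Qed.

Lemma rayJS nu a n : rayJ nu a n.+1 = fun u => rayJ nu a n u + coefJ nu a n * hankel_ray_fun (nu + n%:R) u.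
Proof. by apply/funext => u; rewrite /rayJ cexp_sumS mulrDr rayJ_term. Qed.

Lemma rayJ0 nu a : rayJ nu a 0 = fun=> 0.
Proof. by apply/funext => u; rewrite /rayJ /cexp_sum big_ord0 mulr0. Qed.

Lemma ccont_rayJ nu a n : ccont (rayJ nu a n).
Proof.
elim: n => [|n IH]; first by rewrite rayJ0; exact: ccont_cst.
rewrite rayJS; apply: ccontD => //.
by apply: ccontM; [exact: ccont_cst|exact: ccont_hankel_ray].
Qed.

Lemma cintegral0 (D : set R) : cintegral D (fun=> (0 : R[i])) = 0.
Proof. by apply: complex_eq; exact: Rint_zero. Qed.

Lemma cintegrable0 (D : set R) : cintegrable D (fun=> (0 : R[i])).
Proof. by split; exact: integrable0. Qed.

Lemma seg_sum nu a n : cintegral `[- pi, pi] (segJ nu a n) =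
  \sum_(k < n) (-1) ^+ k * coefJ nu a k * hankel_seg (nu + k%:R) a.
Proof.
elim: n => [|n IH].
  rewrite big_ord0 (_ : segJ nu a 0 = fun=> 0) ?cintegral0//.
  by apply/funext => b; rewrite /segJ /cexp_sum big_ord0 mulr0.
rewrite big_ord_recr /= -IH.
rewrite (_ : segJ nu a n.+1 = fun b => segJ nu a n b + (-1) ^+ n * coefJ nu a n * hankel_fun (nu + n%:R) (a +i* b)).
  have i1 := @cintegrable_itv R (segJ nu a n) (- pi) pi (ccont_segJ _ _ _).
  have i2 := @cintegrable_itv R (fun b => hankel_fun (nu + n%:R) (a +i* b)) (- pi) pi (ccont_hankel_seg _ _).
  by rewrite cintegralD ?cintegralZ//; exact: cintegrableZ.
by apply/funext => b; rewrite /segJ cexp_sumS mulrDr segJ_term.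
Qed.

Lemma ray_sum nu a n : 0 <= reC nu -> cintegrable `]a, +oo[ (rayJ nu a n) /\
  cintegral `]a, +oo[ (rayJ nu a n) = \sum_(k < n) coefJ nu a k * hankel_ray (nu + k%:R) a.
Proof.
move=> n0; elim: n => [|n [IH1 IH2]].
  by rewrite big_ord0 rayJ0 cintegral0; split => //; exact: cintegrable0.
have i2 : cintegrable `]a, +oo[ (hankel_ray_fun (nu + n%:R)).
  by apply: cintegrable_hankel_ray; rewrite !reimE; have : 0 <= n%:R :> R by []; lra.
rewrite big_ord_recr /= -IH2 rayJS; split.
  by apply: cintegrableD => //; exact: cintegrableZ.
by rewrite cintegralD ?cintegralZ//; exact: cintegrableZ.
Qed.

Lemma two_pi_i_neq0 : (2 * pi)%:C * ic != 0 :> R[i].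
Proof.
have h : 2 * pi != 0 :> R by rewrite gt_eqF// mulr_gt0// pi_gt0.
apply: mulf_neq0; first by rewrite eq_complex /= negb_and h.
by rewrite eq_complex /= negb_and oner_eq0 orbT.
Qed.

Lemma besselJ_partial tau a n : tau != 0 ->
  \sum_(k < n) ((-1) ^+ k / (k`!%:R * cGamma ((0 +i* tau) + k.+1%:R)) *
     cexp (((0 +i* tau) + (2 * k)%:R) * a%:C)) =
  ((2 * pi)%:C * ic)^-1 * (ic * cintegral `[- pi, pi] (segJ (0 +i* tau) a n) +
     hankel_jump (0 +i* tau) * cintegral `]a, +oo[ (rayJ (0 +i* tau) a n)).
Proof.
move=> t0; set nu := 0 +i* tau.
have n0 : 0 <= reC nu by [].
rewrite seg_sum (proj2 (ray_sum a n n0)) !mulr_sumr -big_split mulr_sumr /=.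
apply: eq_bigr => k _.
have H := hankel_gamma k a t0; rewrite -/nu in H.
have G0 : gammaT k tau != 0.
  by apply/eqP => E; move: H; rewrite E mul0r => /esym/eqP; rewrite (negbTE two_pi_i_neq0).
rewrite cGammaE -H !invfM /hankel hankel_jumpD -/nu.
set h := ic * _ + _.
have h0 : h != 0.
  apply/eqP => E; move: H; rewrite /hankel hankel_jumpD -/nu -/h E mulr0 => /esym/eqP.
  by rewrite (negbTE two_pi_i_neq0).
have -> : ic * ((-1) ^+ k * coefJ nu a k * hankel_seg (nu + k%:R) a) +
    hankel_jump nu * (coefJ nu a k * hankel_ray (nu + k%:R) a) =
    coefJ nu a k * ((-1) ^+ k * (ic * hankel_seg (nu + k%:R) a + ((-1) ^+ k * hankel_jump nu) * hankel_ray (nu + k%:R) a)).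
  have s2 : (-1) ^+ k * (-1) ^+ k = 1 :> R[i] by rewrite -exprD addnn -signr_odd odd_double expr0.
  set c := (-1) ^+ k; rewrite -/c in s2.
  transitivity (coefJ nu a k * (c * ic * hankel_seg (nu + k%:R) a + (c * c) * hankel_jump nu * hankel_ray (nu + k%:R) a)).
    by rewrite s2; ring.
  by ring.
rewrite -/h /coefJ.
set A := cexp _; set q := _^-1; set c := (-1) ^+ k; set g := (gammaT k tau)^-1.
transitivity (g * (h^-1 * h) * q * A * c); first by rewrite mulVf//; ring.
by ring.
Qed.

(** Dominated convergence in [besselJ_partial]: on the segment and on the ray the argument of the
    exponential sum has modulus at most e^a. *)
Lemma besselJ_contour tau a : tau != 0 ->
  besselJ (0 +i* tau) (2 * expR a) =
  ((2 * pi)%:C * ic)^-1 *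
  (ic * cintegral `[- pi, pi] (fun b => hankel_fun (0 +i* tau) (a +i* b) * cexp ((0 +i* tau) * a%:C) * cexp (- cexp (a -i* b))) +
     hankel_jump (0 +i* tau) * cintegral `]a, +oo[
      (fun u => hankel_ray_fun (0 +i* tau) u * cexp ((0 +i* tau) * a%:C) * cexp (cexp (2 * a - u)%:C))).
Proof.
move=> t0; set nu := 0 +i* tau.
have p0 := @pi_ge0 R.
apply: ccvg_limn.
have E n : series (fun k : nat => (-1) ^+ k / (k`!%:R * cGamma (nu + k.+1%:R)) *
    cpow (2 * expR a / 2) (nu + (2 * k)%:R)) n =
  ((2 * pi)%:C * ic)^-1 * (ic * cintegral `[- pi, pi] (segJ nu a n) +
     hankel_jump nu * cintegral `]a, +oo[ (rayJ nu a n)).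
  rewrite -besselJ_partial// /series /= big_mkord; apply: eq_bigr => k _.
  have -> : 2 * expR a / 2 = expR a by field.
  by rewrite /cpow expRK.
rewrite (funext E); apply: ccvgM; first exact: ccvg_cst.
have na : modC (cexp (nu * a%:C)) = 1.
  by rewrite modC_cexp (_ : reC _ = 0) ?expR0// !reimE; ring.
apply: ccvgD; apply: ccvgM; try exact: ccvg_cst.
- pose M := expR (expR (`|a| + pi) + modC nu * (`|a| + pi)) * expR (expR a).
  apply: (proj2 (@cint_dct R `[- pi, pi] (segJ nu a) _ (fun=> M) _ _ _ _ _)) => //.
  + by move=> n; apply: ccont_cmeas => //; exact: ccont_segJ.
  + by apply: (@continuous_compact_integrable R (fun=> _)); [exact: segment_compact|exact: continuous_subspaceT (fun=> cvg_cst _)].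
  + move=> n b b_; have /andP[b1 b2] : - pi <= b <= pi by move: b_; rewrite /= in_itv.
    rewrite /segJ modCM modCM na mulr1 /M ler_pM ?modC_ge0//.
      apply: (le_trans (modC_hankel_fun_le _ _)).
      have wM : modC (a +i* b) <= `|a| + pi.
        by apply: (le_trans (modC_le _)); rewrite !reimE lerD2l ler_norml; lra.
      rewrite ler_expR; apply: lerD; first by rewrite ler_expR.
      by rewrite ler_wpM2l// modC_ge0.
    apply: (le_trans (modC_cexp_sum _ _)); by rewrite modCN modC_cexp.
  + move=> b _; apply: ccvgM; first exact: ccvg_cst.
    exact: ccvg_cexp_sum.
- have n1 : -1 <= reC nu by rewrite /nu !reimE; lra.
  apply: (proj2 (@cint_dct R `]a, +oo[ (rayJ nu a) _
    (fun u => (expR (- (reC nu + 1) * a) * ((2`!%:R + 0`!%:R) / 2)) * expR (expR a) / coshR u) _ _ _ _ _)) => //.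
  + by move=> n; apply: ccont_cmeas => //; exact: ccont_rayJ.
  + by apply: intbleZl => //; exact: (intbleS measurableT _ _ intble_sech).
  + move=> n u u_; have au : a < u by move: u_; rewrite /= in_itv/= andbT.
    rewrite /rayJ modCM modCM na mulr1 mulrAC ler_pM ?modC_ge0//.
      exact: hankel_ray_bound.
    apply: (le_trans (modC_cexp_sum _ _)); rewrite modC_cexp !reimE ler_expR ler_expR; lra.
  + move=> u _; apply: ccvgM; first exact: ccvg_cst.
    exact: ccvg_cexp_sum.
Qed.

Definition schlaefli_ray tau y := \int[mu]_(v in `]0, +oo[) (expR (- (y * sinhR v)) * cos (tau * v)).

(** With nu = i tau and abscissa a = ln (y / 2) the exponent becomes tau b + i y sin b on the
    segment and, after translation by a, - y sinh v - i tau v on the ray. *)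
Lemma im_besselJ_schlaefli tau y : tau != 0 -> 0 < y ->
  imC (besselJ (0 +i* tau) y) =
  (2 * pi)^-1 * \int[mu]_(b in `[- pi, pi]) (expR (tau * b) * sin (y * sin b)) -
  sinhR (tau * pi) / pi * schlaefli_ray tau y.
Proof.
move=> t0 y0; set a := ln (y / 2).
have ea : expR a = y / 2 by rewrite lnK// posrE divr_gt0.
have {1}-> : y = 2 * expR a by rewrite ea; lra.
rewrite besselJ_contour// hankel_jump_imag; set nu := 0 +i* tau.
set A := cintegral _ _; set B := cintegral _ _.
have p0 := @pi_gt0 R.
have -> : ((2 * pi)%:C * ic)^-1 * (ic * A + (2 * sinhR (tau * pi))%:C * B) =
    ((2 * pi)^-1)%:C * A + ((sinhR (tau * pi) / pi)%:C * (- ic)) * B.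
  have ii : ic^-1 = - ic.
    have i0 : ic != 0 :> R[i] by rewrite eq_complex /= negb_and oner_eq0 orbT.
    by apply: (mulfI i0); rewrite mulfV// mulrN ii2 opprK.
  have -> : ((2 * pi)%:C * ic)^-1 = ((2 * pi)^-1)%:C * (- ic) by rewrite invfM ii -fmorphV.
  transitivity (((2 * pi)^-1)%:C * (- (ic * ic) * A) + ((2 * pi)^-1)%:C * (2 * sinhR (tau * pi))%:C * (- ic) * B).
    by ring.
  rewrite ii2 opprK mul1r -RtoCM; congr (_ + _%:C * _ * _).
  have pn : (pi : R) != 0 by rewrite gt_eqF.
  by move: (sinhR _) => S; move: (@pi R) pn => q pn; field.
have -> : imC (((2 * pi)^-1)%:C * A + ((sinhR (tau * pi) / pi)%:C * (- ic)) * B) =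
    (2 * pi)^-1 * imC A - sinhR (tau * pi) / pi * reC B.
  case: A => a1 a2; case: B => b1 b2; rewrite !reimE; ring.
congr (_ * _ - _ * _).
  apply: eq_Rint => b _; rewrite /hankel_fun -!cexpD.
  have -> : cexp (a +i* b) - nu * (a +i* b) + nu * a%:C + - cexp (a -i* b) = (tau * b) +i* (y * sin b).
    by apply: complex_eq; rewrite /nu !reimE ?cosN ?sinN ea; field.
  by rewrite !reimE.
have ir : intble `]a, +oo[ (fun u => reC (hankel_ray_fun nu u * cexp (nu * a%:C) * cexp (cexp (2 * a - u)%:C))).
  have n1 : -1 <= reC nu by rewrite /nu !reimE; lra.
  apply: (@intble_sech_dom R _ ((expR (- (reC nu + 1) * a) * ((2`!%:R + 0`!%:R) / 2)) * expR (expR a))) => //.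
    have c1 : ccont (fun u : R => cexp (cexp (2 * a - u)%:C)).
      apply: (cder_ccont (f' := fun u => cexp (cexp (2 * a - u)%:C) * (cexp (2 * a - u)%:C * (0 - 1)%:C))) => u.
      by apply/cder_cexp/cder_cexp/cder_real/derB; [exact: der_cst|exact: der_id].
    have : ccont (fun u => hankel_ray_fun nu u * cexp (nu * a%:C) * cexp (cexp (2 * a - u)%:C)).
      by do 2 apply: ccontM => //; [exact: ccont_hankel_ray|exact: ccont_cst].
    by move/(@ccont_cmeas R `]a, +oo[); case.
  move=> u u_; have au : a < u by move: u_; rewrite /= in_itv/= andbT.
  apply: (le_trans (re_le_modC _)); rewrite modCM modCM (modC_cexp (nu * _)).
  rewrite (_ : reC (nu * _) = 0) ?expR0 ?mulr1; last by rewrite /nu !reimE; ring.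
  rewrite mulrAC ler_pM ?modC_ge0//; first exact: hankel_ray_bound.
  rewrite modC_cexp ler_expR; apply: (le_trans (ler_norm _)); apply: (le_trans (re_le_modC _)).
  by rewrite modC_cexp !reimE ler_expR; lra.
transitivity (\int[mu]_(v in (fun x : R => x + a) @^-1` `]a, +oo[)
    reC (hankel_ray_fun nu (v + a) * cexp (nu * a%:C) * cexp (cexp (2 * a - (v + a))%:C))).
  exact: (esym (Rint_shift a (measurable_itv _) ir)).
have -> : (fun x : R => x + a) @^-1` `]a, +oo[ = `]0, +oo[%classic.
  by apply/seteqP; split => x /=; rewrite !in_itv/= !andbT; lra.
apply: eq_Rint => v _; rewrite /hankel_ray_fun -!cexpD.
have -> : - (expR (v + a))%:C - nu * (v + a)%:C + nu * a%:C + cexp (2 * a - (v + a))%:C =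
    (- (y * sinhR v)) +i* (- (tau * v)).
  rewrite (_ : 2 * a - (v + a) = - v + a); last by ring.
  by rewrite cexpR; apply: complex_eq; rewrite /nu !reimE ?expRD ?ea /sinhR; field.
by rewrite !reimE cosN.
Qed.

Lemma Rint_symm (g : R -> R) p : 0 <= p -> continuous g ->
  \int[mu]_(b in `[- p, p]) g b = \int[mu]_(b in `[0, p]) (g b + g (- b)).
Proof.
move=> p0 cg.
have ig (q r : R) : intble `[q, r] g.
  by apply: (@continuous_compact_integrable R g); [exact: segment_compact|exact: continuous_subspaceT].
have E : `[- p, p]%classic = `[- p, 0[ `|` `[0, p] :> set R.
  apply/seteqP; split => x /=; rewrite !in_itv/=.
    by move=> /andP[h1 h2]; have [x0|x0] := ltP x 0; [left; rewrite h1|right].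
  by move=> [] /andP[h1 h2]; apply/andP; split; lra.
have i1 : intble `[- p, 0[ g.
  by apply: (@intbleS _ `[- p, 0[ `[- p, p] _ _ _ _ (ig _ _)) => // x /=; rewrite !in_itv/= => /andP[]; lra.
have i2 := ig 0 p.
rewrite E Rintegral_setU//; last 2 first.
- by rewrite -E; exact: ig.
- by rewrite disj_set2E; apply/eqP/seteqP; split => x //=; rewrite !in_itv/= => -[] /andP[_ h] /andP[]; lra.
rewrite (Rintegral_itv_bndo_bndc i1).
have im : intble `[0, p] (fun b => g (- b)).
  apply: (@continuous_compact_integrable R (fun b => g (- b))); first exact: segment_compact.
  apply: continuous_subspaceT => b; apply: (continuous_comp (f := -%R)); last exact: cg.
  exact: oppr_continuous.
rewrite RintD// addrC; congr (_ + _).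
rewrite -(Rint_negate _ (ig (- p) 0))//.
have -> : (fun x : R => - x) @^-1` `[- p, 0] = `[0, p]%classic.
  by apply/seteqP; split => x /=; rewrite !in_itv/=; lra.
by [].
Qed.

(* The conditionally convergent integral of cos (y cosh v) cos (tau v) over the
   half-line, written with absolutely convergent ones. *)
Definition mehler tau y := coshR (tau * pi / 2) * schlaefli_ray tau y -
  \int[mu]_(b in `[0, pi / 2]) (sin (y * cos b) * coshR (tau * b)).

(** Folding [-pi, pi] at 0, translating by pi / 2 and folding again turns sin (y sin b) into sin (y
    cos b) on [0, pi / 2], with the factor sinh (tau pi / 2) that also divides sinh (tau pi). *)
Lemma im_besselJE tau y : tau != 0 -> 0 < y ->
  imC (besselJ (0 +i* tau) y) = - (2 / pi) * sinhR (tau * pi / 2) * mehler tau y.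
Proof.
move=> t0 y0; have p0 := @pi_gt0 R.
rewrite im_besselJ_schlaefli//.
set g := fun b => expR (tau * b) * sin (y * sin b).
have dsin (x : R) : der (@sin R) x (cos x) by exact: is_derive_sin.
have dcos (x : R) : der (@cos R) x (- sin x) by exact: is_derive_cos.
have cg : continuous g.
  apply: ex_der_continuous => b; eexists; rewrite /g; apply: derM; first by dauto.
  by apply: der_sin; apply: derM; [exact: der_cst|exact: dsin].
rewrite (Rint_symm (ltW p0) cg).
pose G (c : R) := 2 * sinhR (tau * (c + pi / 2)) * sin (y * cos c).
have cG : continuous G.
  apply: ex_der_continuous => b; eexists; rewrite /G; apply: derM.
    apply: derM; first exact: der_cst.
    by apply: (der_comp (f := fun c => tau * (c + pi / 2))); [dauto|exact: der_sinhR].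
  by apply: der_sin; apply: derM; [exact: der_cst|exact: dcos].
have -> : \int[mu]_(b in `[0, pi]) (g b + g (- b)) = \int[mu]_(c in `[- (pi / 2), pi / 2]) G c.
  have iG : intble `[- (pi / 2), pi / 2] G.
    by apply: (@continuous_compact_integrable R G); [exact: segment_compact|exact: continuous_subspaceT].
  rewrite -(Rint_shift (- (pi / 2)) _ iG)// shift_preimage_itv.
  have -> : - (pi / 2) - - (pi / 2) = 0 :> R by lra.
  have -> : pi / 2 - - (pi / 2) = pi :> R by lra.
  by apply: eq_Rint => b _; rewrite /g /G subrK cosBpihalf !sinN !mulrN sinN /sinhR; field.
have p2 : 0 <= pi / 2 :> R by lra.
rewrite (Rint_symm p2 cG).
have -> : \int[mu]_(b in `[0, pi / 2]) (G b + G (- b)) =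
    \int[mu]_(b in `[0, pi / 2]) ((4 * sinhR (tau * pi / 2)) * (sin (y * cos b) * coshR (tau * b))).
  apply: eq_Rint => b _; rewrite /G cosN.
  have -> : tau * (b + pi / 2) = tau * b + tau * pi / 2 by ring.
  have -> : tau * (- b + pi / 2) = - (tau * b) + tau * pi / 2 by ring.
  by rewrite /sinhR /coshR !opprD !opprK !expRD; field.
have iq : intble `[0, pi / 2] (fun b => sin (y * cos b) * coshR (tau * b)).
  apply: (@continuous_compact_integrable R (fun b => sin (y * cos b) * coshR (tau * b))); first exact: segment_compact.
  apply: continuous_subspaceT; apply: ex_der_continuous => b; eexists; apply: derM.
    by apply: der_sin; apply: derM; [exact: der_cst|exact: dcos].
  by apply: (der_comp (f := fun c => tau * c)); [dauto|exact: der_coshR].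
rewrite (RintZl _ _ iq)// /mehler.
have -> : sinhR (tau * pi) = 2 * sinhR (tau * pi / 2) * coshR (tau * pi / 2).
  have {1}-> : tau * pi = tau * pi / 2 + tau * pi / 2 by field.
  by rewrite /sinhR /coshR !opprD !expRD; field.
have pn : (pi : R) != 0 by rewrite gt_eqF.
move: (sinhR _) (coshR _) (schlaefli_ray _ _) (Rintegral _ _ _) => S C r Q; move: (@pi R) pn => q pn.
by field.
Qed.

End BesselJ.

(** * The oscillating integral of cos (y cosh v) cos (tau v) *)

Section Mehler.
Context {R : realType}.
Implicit Types (a b p q u v x y tau : R).

Local Notation ic := ((0 : R) +i* (1 : R)).

Lemma Rint_subset (D E : set R) (f : R -> R) : measurable D -> measurable E -> D `<=` E ->
  intble E f -> (forall x, E x -> 0 <= f x) ->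
  \int[mu]_(x in D) f x <= \int[mu]_(x in E) f x.
Proof.
move=> mD mE DE fi f0.
have H : \int[mu]_(x in D) f x = \int[mu]_(x in E) (f \_ D) x.
  rewrite [RHS]Rintegral_mkcond [LHS]Rintegral_mkcond; congr Rintegral.
  apply/funext => x; rewrite !patchE; case: ifPn => //; case: ifPn => // xD.
  by rewrite !inE in xD * => /DE/mem_set; rewrite (negbTE xD).
have mfD : measurable_fun E (f \_ D).
  apply/(measurable_restrict _ mD mE).
  apply: measurable_funS (intble_meas fi) => //; exact: subIsetl.
have L x : E x -> `|(f \_ D) x| <= f x.
  by move=> Ex; rewrite patchE; case: ifP => _; rewrite ?normr0 ?f0// ger0_norm ?f0.
rewrite H; apply: le_Rintegral => //; first exact: intble_le mfD fi L.
by move=> x Ex; apply: le_trans (L x Ex); exact: ler_norm.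
Qed.

Lemma intble_itv_cont (f : R -> R) p q : continuous f -> intble `[p, q] f.
Proof.
move=> cf; apply: (@continuous_compact_integrable R f); first exact: segment_compact.
exact: continuous_subspaceT.
Qed.

Lemma Rint_cvg_pinfty (f : R -> R) : continuous f -> intble `]0, +oo[ f ->
  \int[mu]_(x in `[0, q]) f x @[q --> +oo] --> \int[mu]_(x in `]0, +oo[) f x.
Proof.
move=> cf fi; apply/cvg_pinftyP => w woo.
have E n : \int[mu]_(x in `[0, w n]) f x = \int[mu]_(x in `]0, w n]) f x.
  rewrite Rintegral_itv_obnd_cbnd//.
  apply: (@intbleS _ `]0, w n] `]0, +oo[ f) => //.
  by move=> x /=; rewrite !in_itv/= => /andP[->].
rewrite (funext E); apply: Rint_exhaust => //.
  by move=> n x /=; rewrite !in_itv/= => /andP[->].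
move=> x; rewrite /= in_itv/= andbT => x0.
have : \forall n \near \oo, x <= w n by move/cvgryPge: woo; exact.
by apply: filterS => n h; rewrite /= in_itv/= x0.
Qed.

Lemma Rint_itv_cat (f : R -> R) p q r : continuous f -> p <= q -> q <= r ->
  \int[mu]_(x in `[p, r]) f x = \int[mu]_(x in `[p, q]) f x + \int[mu]_(x in `[q, r]) f x.
Proof.
move=> cf pq qr.
have E : `[p, r]%classic = `[p, q[ `|` `[q, r] :> set R.
  apply/seteqP; split => x /=; rewrite !in_itv/=.
    by move=> /andP[h1 h2]; have [x0|x0] := ltP x q; [left; rewrite h1|right].
  by move=> [] /andP[h1 h2]; apply/andP; split; lra.
have i1 : intble `[p, q[ f.
  apply: (@intbleS _ `[p, q[ `[p, r] f) => //; last exact: intble_itv_cont.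
  by move=> x /=; rewrite !in_itv/= => /andP[h1 h2]; lra.
rewrite E Rintegral_setU//; last 2 first.
- by rewrite -E; exact: intble_itv_cont.
- by rewrite disj_set2E; apply/eqP/seteqP; split => x //=; rewrite !in_itv/= => -[] /andP[_ h] /andP[]; lra.
by rewrite (Rintegral_itv_bndo_bndc i1).
Qed.

Lemma Rint_itv_opp (f : R -> R) p q : continuous f ->
  \int[mu]_(x in `[p, q]) f x = \int[mu]_(x in `[- q, - p]) f (- x).
Proof.
move=> cf; rewrite -(Rint_negate _ (intble_itv_cont p q cf))//.
have -> : (fun x : R => - x) @^-1` `[p, q] = `[- q, - p]%classic.
  by apply/seteqP; split => x /=; rewrite !in_itv/=; lra.
by [].
Qed.

(** An arbitrary interval is a sum or a difference of intervals that start or end at 0. *)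
Lemma Rint_itv_bounded (g : R -> R) M : continuous g ->
  (forall q, 0 <= q -> `|\int[mu]_(x in `[0, q]) g x| <= M) ->
  (forall q, 0 <= q -> `|\int[mu]_(x in `[0, q]) g (- x)| <= M) ->
  forall p q, p <= q -> `|\int[mu]_(x in `[p, q]) g x| <= 2 * M.
Proof.
move=> cg h1 h2 p q pq.
have M0 : 0 <= M by apply: le_trans (h1 0 (lexx _)).
have cgN : continuous (fun x => g (- x)).
  by move=> x; apply: (continuous_comp (f := -%R)); [exact: oppr_continuous|exact: cg].
have neg r : r <= 0 -> `|\int[mu]_(x in `[r, 0]) g x| <= M.
  by move=> r0; rewrite Rint_itv_opp// oppr0; apply: h2; rewrite oppr_ge0.
have [p0|p0] := leP 0 p.
  have := Rint_itv_cat cg p0 pq; have := h1 p p0; have := h1 q (le_trans p0 pq).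
  by rewrite !ler_norml => /andP[? ?] /andP[? ?] E; apply/andP; split; lra.
have [q0|q0] := leP 0 q.
  have := Rint_itv_cat cg (ltW p0) q0; have := neg p (ltW p0); have := h1 q q0.
  by rewrite !ler_norml => /andP[? ?] /andP[? ?] ->; apply/andP; split; lra.
have := Rint_itv_cat cg pq (ltW q0); have := neg p (ltW p0); have := neg q (ltW q0).
by rewrite !ler_norml => /andP[? ?] /andP[? ?] E; apply/andP; split; lra.
Qed.

Section FixedY.
Variable y : R.
Hypothesis y0 : 0 < y.

(* exp (i tau z - i y cosh z) at z = u - i b; it decays in u on the line
   b = pi / 2, to which the oscillating integral over b = 0 is moved. *)
Definition mehlerH tau u b : R[i] :=
  cexp ((tau * b - y * sinhR u * sin b) +i* (tau * u - y * coshR u * cos b)).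
Definition mehlerH1 tau u b : R[i] :=
  mehlerH tau u b * ((- (y * coshR u * sin b)) +i* (tau - y * sinhR u * cos b)).

Lemma cderMk (f g : R -> R) x d e : der f x d -> der g x e -> cder (fun t => f t +i* g t) x (d +i* e).
Proof. by split. Qed.

Let dsin x : der (@sin R) x (cos x). Proof. exact: is_derive_sin. Qed.
Let dcos x : der (@cos R) x (- sin x). Proof. exact: is_derive_cos. Qed.

Lemma mehlerH_u tau u b : cder (fun u => mehlerH tau u b) u (mehlerH1 tau u b).
Proof.
rewrite /mehlerH1 /mehlerH; apply: cder_eq.
  by apply/cder_cexp/cderMk; dauto.
congr (_ * _).

by apply: (congr2 (@Complex R)); cbv beta; ring.
Qed.

Lemma mehlerH_b tau u b : cder (mehlerH tau u) b (- ic * mehlerH1 tau u b).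
Proof.
rewrite /mehlerH1 /mehlerH; apply: cder_eq.
  apply/cder_cexp/cderMk; apply: derB; first by dauto.
  - by apply: derM; [exact: der_cst|exact: dsin].
  - by dauto.
  - by apply: derM; [exact: der_cst|exact: dcos].
rewrite [RHS](mulrCA (- ic) (cexp _)); congr (_ * _).
by apply: complex_eq; rewrite !reimE; ring.
Qed.

Lemma ccont_mehlerH_b tau u : ccont (mehlerH tau u).
Proof. exact: cder_ccont (mehlerH_b tau u). Qed.

Lemma ccont_mehlerH_u tau b : ccont (fun u => mehlerH tau u b).
Proof. by apply: cder_ccont => u; exact: mehlerH_u. Qed.

Lemma ccontMk (f g : R -> R) : continuous f -> continuous g -> ccont (fun t => f t +i* g t).
Proof. by split. Qed.

Lemma ccont_mehlerH1_u tau b : ccont (fun u => mehlerH1 tau u b).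
Proof.
apply: ccontM; first exact: ccont_mehlerH_u.
by apply: ccontMk; apply: ex_der_continuous => u; eexists; dauto.
Qed.

Lemma modC_mehlerH tau u b : modC (mehlerH tau u b) = expR (tau * b - y * sinhR u * sin b).
Proof. by rewrite modC_cexp. Qed.

(** A crude bound on a bounded rectangle is enough to differentiate under the integral. *)
Lemma mehlerH1_bound tau q u b c : 0 <= u <= q -> `|b| <= c ->
  modC (mehlerH1 tau u b) <=
  expR (`|tau| * c + y * sinhR q) * (y * coshR q + (`|tau| + y * coshR q)).
Proof.
move=> /andP[u0 uq] bc; rewrite /mehlerH1 modCM.
have cu : coshR u <= coshR q by exact: coshR_le.
have c0 := coshR_gt0 u.
have su0 := sinhR_ge0 u0.
have sc : sinhR u <= coshR u by rewrite /sinhR /coshR ler_pM2r//; have := expR_gt0 (- u); lra.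
have sq : sinhR u <= sinhR q.
  rewrite /sinhR ler_pM2r//; apply: lerB; first by rewrite ler_expR.
  by rewrite ler_expR lerN2.
apply: ler_pM; rewrite ?modC_ge0//.
  rewrite modC_mehlerH ler_expR; apply: lerD.
    by apply: (le_trans (ler_norm _)); rewrite normrM ler_wpM2l.
  have /andP[s1 s2] : -1 <= sin b <= 1 by rewrite sin_geN1 sin_le1.
  have : 0 <= y * sinhR u by rewrite mulr_ge0// ltW.
  have : y * sinhR u <= y * sinhR q by rewrite ler_pM2l.
  nra.
apply: (le_trans (modC_le _)); rewrite !reimE; apply: lerD.
  rewrite normrN normrM -[leRHS]mulr1 ler_pM ?sin_max//.
  by rewrite ger0_norm ?ler_pM2l// mulr_ge0// ltW.
apply: (le_trans (ler_normB _ _)); rewrite lerD2l normrM -[leRHS]mulr1 ler_pM ?cos_max//.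
have -> : `|y * sinhR u| = y * sinhR u by rewrite ger0_norm// mulr_ge0// ltW.

by rewrite ler_pM2l//; exact: le_trans sc cu.
Qed.

Definition mehlerI tau q := cintegral `[0, q] (fun u => mehlerH tau u 0).

(** Cauchy's theorem on the rectangle between b = 0 and b = pi / 2, obtained from the derivative in
    b, which is - i times the derivative in u. *)
Lemma mehler_rectangle tau q : 0 <= q ->
  mehlerI tau q = cintegral `[0, q] (fun u => mehlerH tau u (pi / 2)) +
    ic * (cintegral `[0, pi / 2] (mehlerH tau q) - cintegral `[0, pi / 2] (mehlerH tau 0)).
Proof.
move=> q0; have p0 := @pi_gt0 R.
have p2 : 0 <= pi / 2 :> R by rewrite divr_ge0// ltW.
pose G b := cintegral `[0, q] (fun u => mehlerH tau u b).
have dG b : cder G b (- ic * (mehlerH tau q b - mehlerH tau 0 b)).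
  apply: cder_eq.
    apply: (@cder_cint R `[0, q] (fun b u => mehlerH tau u b) (fun b u => - ic * mehlerH1 tau u b)
      (fun=> expR (`|tau| * (`|b| + 1) + y * sinhR q) * (y * coshR q + (`|tau| + y * coshR q))) (b - 1) (b + 1)).
    - by [].
    - by lra.
    - by move=> t _; apply: cintegrable_itv; exact: ccont_mehlerH_u.
    - by apply: intble_itv_cont => x; exact: cvg_cst.
    - move=> t u tb u_; have uq : 0 <= u <= q by move: u_; rewrite /= in_itv.
      split; first exact: mehlerH_b.
      rewrite modCM modCN modC_ii mul1r; apply: mehlerH1_bound => //.
      have := ler_norm b; have := ler_norm (- b); rewrite normrN => h1 h2.
      by rewrite ler_norml; lra.
  have i1 := @cintegrable_itv R (fun u => mehlerH1 tau u b) 0 q (ccont_mehlerH1_u tau b).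
  rewrite cintegralZ//; congr (_ * _).
  by rewrite (cFTC_itv q0 (fun u => mehlerH_u tau u b) (ccont_mehlerH1_u tau b)).
have cH : ccont (fun b => - ic * (mehlerH tau q b - mehlerH tau 0 b)).
  by apply: ccontM; [exact: ccont_cst|apply: ccontD; [|apply: ccontN]; exact: ccont_mehlerH_b].
have := cFTC_itv p2 dG cH.
have j1 := @cintegrable_itv R (mehlerH tau q) 0 (pi / 2) (ccont_mehlerH_b tau q).
have j2 := @cintegrable_itv R (mehlerH tau 0) 0 (pi / 2) (ccont_mehlerH_b tau 0).
rewrite cintegralZ//; last by apply: cintegrableD => //; exact: cintegrableN.
rewrite cintegralB// /G -/(mehlerI tau q) => E.
set A := cintegral _ _ - _ in E *.
have {}E : mehlerI tau q = cintegral `[0, q] (fun u => mehlerH tau u (pi / 2)) + ic * A.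
  by apply/eqP; rewrite -subr_eq0; apply/eqP;
     transitivity (- ic * A - (cintegral `[0, q] (fun u => mehlerH tau u (pi / 2)) - mehlerI tau q));
     [ring|rewrite E subrr].
exact: E.
Qed.

Let C1 tau := expR (tau * (pi / 2)) * (y^-1 + 1).

(** For u >= 0, cosh u <= sinh u + 1 and sinh u exp (- y sinh u) <= 1 / y, whence the constant
    [C1]. *)
Let top_bound tau u : 0 <= u -> modC (mehlerH tau u (pi / 2)) <= C1 tau / coshR u.
Proof.
move=> u0; rewrite modC_mehlerH sin_pihalf mulr1 expRD /C1 -mulrA ler_pM2l ?expR_gt0//.
rewrite ler_pdivlMr ?coshR_gt0//.
have s0 := sinhR_ge0 u0.
have e0 := expR_gt0 (- (y * sinhR u)).
have e1 : expR (- (y * sinhR u)) <= 1 by rewrite -expR0 ler_expR oppr_le0 mulr_ge0// ltW.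
have cs : coshR u <= sinhR u + 1.
  rewrite /coshR /sinhR; have : expR (- u) <= 1 by rewrite -expR0 ler_expR oppr_le0.
  lra.
have := @expR_pow_le R (y * sinhR u) 1 _; rewrite (_ : 1`! = 1)%N// expr1 => /(_ _) h.
have {}h : y * sinhR u * expR (- (y * sinhR u)) <= 1 by apply: h; rewrite mulr_ge0// ltW.
have h2 : sinhR u * expR (- (y * sinhR u)) <= y^-1.
  by rewrite -[y^-1]mul1r ler_pdivlMr// mulrC mulrA.
nra.
Qed.

Let top_integrable tau : cintegrable `]0, +oo[ (fun u => mehlerH tau u (pi / 2)).
Proof.
apply: (@cintegrable_sech R _ _ (C1 tau)) => //.
  by apply: ccont_cmeas => //; exact: ccont_mehlerH_u.
by move=> u u_; apply: top_bound; move: u_; rewrite /= in_itv/= andbT => /ltW.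
Qed.

Let side_bound tau q b : 0 <= q -> 0 <= b <= pi / 2 ->
  modC (mehlerH tau q b) <= expR (`|tau| * (pi / 2)).
Proof.
move=> q0 /andP[b0 b1]; rewrite modC_mehlerH ler_expR.
have s0 := sinhR_ge0 q0.
have sb : 0 <= sin b by apply: sin_ge0_pi; have := @pi_gt0 R; lra.
have := mulr_ge0 (mulr_ge0 (ltW y0) s0) sb.
have : tau * b <= `|tau| * (pi / 2).
  by apply: (le_trans (ler_norm _)); rewrite normrM ler_wpM2l// ger0_norm.
lra.
Qed.

Let side_cvg tau : ccvg +oo (fun q => cintegral `[0, pi / 2] (mehlerH tau q)) 0.
Proof.
have p0 := @pi_gt0 R.
(* Replacing q by its absolute value makes the bounds valid for every real q, as [Rint_dct_pinfty]
   requires. *)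
have nearE (f : R -> R) l : f `|q| @[q --> +oo] --> l -> f q @[q --> +oo] --> l.
  apply: cvg_trans; apply: near_eq_cvg.
  have H : \forall q \near +oo, 0 <= q :> R by apply: nbhs_pinfty_ge; exact: num_real.
  by apply: filterS H => q q0; rewrite ger0_norm.
have key (pr : R[i] -> R) : (forall z, `|pr z| <= modC z) ->
    (forall q, measurable_fun setT (fun b => pr (mehlerH tau q b))) ->
    \int[mu]_(b in `[0, pi / 2]) pr (mehlerH tau q b) @[q --> +oo] --> 0.
  move=> prl prm; apply: nearE.
  (* The end b = 0 is dropped: there the modulus is 1 for every q, whereas for b > 0 it tends to
     0. *)
  have O q : intble `]0, pi / 2] (fun b => pr (mehlerH tau `|q| b)).
    apply: (@intble_le R `]0, pi / 2] _ (fun=> expR (`|tau| * (pi / 2)))) => //.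
    - by apply: measurable_funTS; exact: prm.
    - apply: (@intbleS _ `]0, pi / 2] `[0, pi / 2]) => //.
        by move=> x /=; rewrite !in_itv/= => /andP[/ltW -> ->].
      by apply: intble_itv_cont => x; exact: cvg_cst.
    - move=> b; rewrite /= in_itv/= => /andP[b0 b1]; apply: (le_trans (prl _)).
      by apply: side_bound => //; rewrite ltW.
  have F q : \int[mu]_(b in `[0, pi / 2]) pr (mehlerH tau `|q| b) = \int[mu]_(b in `]0, pi / 2]) pr (mehlerH tau `|q| b).
    by rewrite (Rintegral_itv_obnd_cbnd (O q)).
  rewrite (funext F) -[X in _ --> X](Rint_zero `]0, pi / 2]).
  apply: (@Rint_dct_pinfty R `]0, pi / 2] (fun q b => pr (mehlerH tau `|q| b)) (fun=> 0)
     (fun=> expR (`|tau| * (pi / 2)))) => //.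
  - by move=> q; apply: measurable_funTS; exact: prm.
  - apply: (@intbleS _ `]0, pi / 2] `[0, pi / 2]) => //.
      by move=> x /=; rewrite !in_itv/= => /andP[/ltW -> ->].
    by apply: intble_itv_cont => x; exact: cvg_cst.
  - move=> q b; rewrite /= in_itv/= => /andP[b0 b1]; apply: (le_trans (prl _)).
    by apply: side_bound => //; rewrite ltW.
  - move=> b; rewrite /= in_itv/= => /andP[b0 b1].
    apply: norm_cvg0.
    have sb : 0 < sin b by apply: sin_gt0_pi; lra.
    have K : expR (tau * b) * expR (- (y * sin b * q)) @[q --> +oo] --> (0 : R).
      rewrite -[X in _ --> X](mulr0 (expR (tau * b))); apply: cvgM; first exact: cvg_cst.
      apply: (@cvg_comp _ _ _ (fun q => y * sin b * q) (fun t => expR (- t))); last exact: cvgr_expR.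
      by apply: gt0_cvgMrNy || apply: gt0_cvgMry => //; rewrite mulr_gt0.
    apply: (squeeze_cvgr _ (cvg_cst 0) K).
    have H : \forall q \near +oo, 0 <= q :> R by apply: nbhs_pinfty_ge; exact: num_real.
    apply: filterS H => q q0; rewrite normr_ge0/=; apply: (le_trans (prl _)).
    rewrite (ger0_norm q0) modC_mehlerH -expRD ler_expR lerD2l lerN2.
    by rewrite mulrAC ler_pM2r// ler_pM2l//; exact: sinhR_ge_id.
have m q : cmeas setT (mehlerH tau q) by apply: ccont_cmeas => //; exact: ccont_mehlerH_b.
by split; apply: key => [z|q]; rewrite ?re_le_modC ?im_le_modC//; case: (m q).
Qed.

(** The integral along what remains of the rectangle as q tends to infinity: the line b = pi / 2 and
    the side u = 0. *)
Definition mehlerL tau := cintegral `]0, +oo[ (fun u => mehlerH tau u (pi / 2)) +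
  ic * (0 - cintegral `[0, pi / 2] (mehlerH tau 0)).

Lemma mehlerI_cvg tau : ccvg +oo (mehlerI tau) (mehlerL tau).
Proof.
have H : ccvg +oo (fun q => cintegral `[0, q] (fun u => mehlerH tau u (pi / 2)) +
    ic * (cintegral `[0, pi / 2] (mehlerH tau q) - cintegral `[0, pi / 2] (mehlerH tau 0))) (mehlerL tau).
  apply: ccvgD.
    have [c1 c2] := ccont_mehlerH_u tau (pi / 2); have [i1 i2] := top_integrable tau.
    split; first exact: (Rint_cvg_pinfty c1 i1).
    exact: (Rint_cvg_pinfty c2 i2).
  apply: ccvgM; first exact: ccvg_cst.
  by apply: ccvgD => //; exact: ccvg_cst.
have E : \forall q \near +oo, mehlerI tau q = cintegral `[0, q] (fun u => mehlerH tau u (pi / 2)) +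
    ic * (cintegral `[0, pi / 2] (mehlerH tau q) - cintegral `[0, pi / 2] (mehlerH tau 0)).
  have N : \forall q \near +oo, 0 <= q :> R by apply: nbhs_pinfty_ge; exact: num_real.
  by apply: filterS N => q q0; exact: mehler_rectangle.
case: H => h1 h2; split.
  by apply: cvg_trans h1; apply: near_eq_cvg; apply: filterS E => q ->.
by apply: cvg_trans h2; apply: near_eq_cvg; apply: filterS E => q ->.
Qed.

(** Uniformity in q turns this into a dominating constant for the windows used in the cosine
    transform. *)
Lemma mehlerI_bounded tau : exists M, forall q, 0 <= q -> modC (mehlerI tau q) <= M.
Proof.
have p0 := @pi_gt0 R.
pose M1 := 2 * \int[mu]_u (C1 tau / coshR u).
pose M2 := 2 * \int[mu]_(b in `[(0 : R), pi / 2]) expR (`|tau| * (pi / 2)).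
exists (M1 + (M2 + M2)) => q q0; rewrite mehler_rectangle//.
have C10 : 0 <= C1 tau by rewrite mulr_ge0 ?expR_ge0// addr_ge0// invr_ge0 ltW.
have iC : intble setT (fun u => C1 tau / coshR u) by apply: intbleZl => //; exact: intble_sech.
apply: (le_trans (modCD _ _)); apply: lerD.
  apply: (@le_trans _ _ (2 * \int[mu]_(u in `[0, q]) (C1 tau / coshR u))).
    apply: modC_cintegral_le => //.
    - by apply: ccont_cmeas => //; exact: ccont_mehlerH_u.
    - exact: (intbleS measurableT _ _ iC).
    - by move=> u u_; apply: top_bound; move: u_; rewrite /= in_itv/= => /andP[].
  rewrite /M1 ler_pM2l//; apply: Rint_subset => //.
  by move=> x _; rewrite divr_ge0// ltW// coshR_gt0.
have side q' : 0 <= q' -> modC (cintegral `[0, pi / 2] (mehlerH tau q')) <= M2.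
  move=> q1; apply: modC_cintegral_le => //.
  - by apply: ccont_cmeas => //; exact: ccont_mehlerH_b.
  - by apply: intble_itv_cont => x; exact: cvg_cst.
  - by move=> b b_; apply: side_bound => //; move: b_; rewrite /= in_itv.
rewrite modCM modC_ii mul1r; apply: (le_trans (modCB _ _)); apply: lerD; exact: side.
Qed.

Definition mehler_cos tau v := cos (y * coshR v) * cos (tau * v).
(** It arises when a window symmetric about 0 is translated; being odd, it drops out in the
    limit. *)
Definition mehler_sin tau v := cos (y * coshR v) * sin (tau * v).

Lemma mehler_cosE tau v :
  mehler_cos tau v = 2^-1 * (reC (mehlerH tau v 0) + reC (mehlerH (- tau) v 0)).
Proof.
rewrite /mehler_cos /mehlerH !reimE cos0 sin0 !mulr0 !mulr1 !subrr !expR0 !mul1r.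
rewrite mulNr -opprD cosN cosB cosD; lra.
Qed.

Lemma mehler_sinE tau v :
  mehler_sin tau v = 2^-1 * (imC (mehlerH tau v 0) - imC (mehlerH (- tau) v 0)).
Proof.
rewrite /mehler_sin /mehlerH !reimE cos0 sin0 !mulr0 !mulr1 !subrr !expR0 !mul1r.
rewrite mulNr -opprD sinN sinB sinD; lra.
Qed.

Lemma continuous_mehler_cos tau : continuous (mehler_cos tau).
Proof. by apply: ex_der_continuous => v; eexists; rewrite /mehler_cos; dauto. Qed.

Lemma continuous_mehler_sin tau : continuous (mehler_sin tau).
Proof. by apply: ex_der_continuous => v; eexists; rewrite /mehler_sin; dauto. Qed.

Lemma mehler_cos_int tau q : \int[mu]_(v in `[0, q]) mehler_cos tau v =
  2^-1 * (reC (mehlerI tau q) + reC (mehlerI (- tau) q)).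
Proof.
have [i1 _] := @cintegrable_itv R (fun u => mehlerH tau u 0) 0 q (ccont_mehlerH_u tau 0).
have [i2 _] := @cintegrable_itv R (fun u => mehlerH (- tau) u 0) 0 q (ccont_mehlerH_u (- tau) 0).
have i3 := intbleD (measurable_itv _) i1 i2.
transitivity (2^-1 * \int[mu]_(v in `[0, q]) (reC (mehlerH tau v 0) + reC (mehlerH (- tau) v 0))).
  rewrite -(RintZl 2^-1 (measurable_itv _) i3).
  by apply: eq_Rint => v _; rewrite mehler_cosE.
by rewrite (RintD (measurable_itv _) i1 i2).
Qed.

Lemma mehler_sin_int tau q : \int[mu]_(v in `[0, q]) mehler_sin tau v =
  2^-1 * (imC (mehlerI tau q) - imC (mehlerI (- tau) q)).
Proof.
have [_ i1] := @cintegrable_itv R (fun u => mehlerH tau u 0) 0 q (ccont_mehlerH_u tau 0).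
have [_ i2] := @cintegrable_itv R (fun u => mehlerH (- tau) u 0) 0 q (ccont_mehlerH_u (- tau) 0).
have i3 := intbleB (measurable_itv _) i1 i2.
transitivity (2^-1 * \int[mu]_(v in `[0, q]) (imC (mehlerH tau v 0) - imC (mehlerH (- tau) v 0))).
  rewrite -(RintZl 2^-1 (measurable_itv _) i3).
  by apply: eq_Rint => v _; rewrite mehler_sinE.
by rewrite (RintB (measurable_itv _) i1 i2).
Qed.

Lemma mehler_cosN tau v : mehler_cos tau (- v) = mehler_cos tau v.
Proof. by rewrite /mehler_cos coshRN mulrN cosN. Qed.

Lemma mehler_sinN tau v : mehler_sin tau (- v) = - mehler_sin tau v.
Proof. by rewrite /mehler_sin coshRN mulrN sinN mulrN. Qed.

Let half_bounded tau : exists M, forall q, 0 <= q ->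
  `|\int[mu]_(v in `[0, q]) mehler_cos tau v| <= M /\
  `|\int[mu]_(v in `[0, q]) mehler_sin tau v| <= M.
Proof.
have [M1 h1] := mehlerI_bounded tau; have [M2 h2] := mehlerI_bounded (- tau).
exists (M1 + M2) => q q0; have {}h1 := h1 q q0; have {}h2 := h2 q q0.
have a1 := le_trans (re_le_modC _) h1; have a2 := le_trans (re_le_modC _) h2.
have b1 := le_trans (im_le_modC _) h1; have b2 := le_trans (im_le_modC _) h2.
rewrite mehler_cos_int mehler_sin_int; move: a1 a2 b1 b2.
by rewrite !ler_norml => /andP[? ?] /andP[? ?] /andP[? ?] /andP[? ?]; split; apply/andP; split; lra.
Qed.

Lemma mehler_cos_bounded tau : exists M, forall p q, p <= q ->
  `|\int[mu]_(v in `[p, q]) mehler_cos tau v| <= M.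
Proof.
have [M h] := half_bounded tau; exists (2 * M).
apply: Rint_itv_bounded; first exact: continuous_mehler_cos.
  by move=> q q0; case: (h q q0).
move=> q q0; under eq_Rintegral do rewrite mehler_cosN.
by case: (h q q0).
Qed.

Lemma mehler_sin_bounded tau : exists M, forall p q, p <= q ->
  `|\int[mu]_(v in `[p, q]) mehler_sin tau v| <= M.
Proof.
have [M h] := half_bounded tau; exists (2 * M).
apply: Rint_itv_bounded; first exact: continuous_mehler_sin.
  by move=> q q0; case: (h q q0).
move=> q q0; under eq_Rintegral do rewrite mehler_sinN.
rewrite (RintN (measurable_itv _) (intble_itv_cont 0 q (@continuous_mehler_sin tau))).
by rewrite normrN; case: (h q q0).
Qed.

Lemma re_mehlerL tau : reC (mehlerL tau) = expR (tau * pi / 2) * schlaefli_ray tau y -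
  \int[mu]_(b in `[0, pi / 2]) (expR (tau * b) * sin (y * cos b)).
Proof.
rewrite /mehlerL; set A := cintegral _ _; set B := cintegral _ _.
have -> : reC (A + ic * (0 - B)) = reC A + imC B by case: A => ? ?; case: B => ? ?; rewrite !reimE; ring.
have is_ : intble `]0, +oo[ (fun v => expR (- (y * sinhR v)) * cos (tau * v)).
  have [i1 _] := top_integrable tau.
  apply: (eq_intble _ _ (intbleZl (expR (- (tau * pi / 2))) _ i1)) => // v _.
  rewrite !reimE sin_pihalf cos_pihalf mulr1 mulr0 subr0 [LHS]mulrA -expRD; congr (expR _ * _); ring.
congr (_ + _).
  rewrite /schlaefli_ray -(RintZl _ (measurable_itv _) is_).
  apply: eq_Rint => v _.
  rewrite !reimE sin_pihalf cos_pihalf mulr1 mulr0 subr0 [RHS]mulrA -expRD; congr (expR _ * _); ring.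
rewrite -RintN//; last first.
  apply: intble_itv_cont; apply: ex_der_continuous => b; eexists; apply: derM; first by dauto.
  by apply: der_sin; apply: derM; [exact: der_cst|exact: dcos].
apply: eq_Rint => b _; rewrite !reimE sinhR0 coshR0 mulr0 mul0r subr0 mulr0 sub0r mulr1 sinN; ring.
Qed.

Lemma schlaefli_rayN tau : schlaefli_ray (- tau) y = schlaefli_ray tau y.
Proof. by apply: eq_Rint => v _; rewrite mulNr cosN. Qed.

(** Averaging over tau and - tau turns the exponentials e^(tau b) in the real part of [mehlerL] into
    the hyperbolic cosines of [mehler]. *)
Lemma mehler_cos_cvg tau :
  \int[mu]_(v in `[0, q]) mehler_cos tau v @[q --> +oo] --> mehler tau y.
Proof.
rewrite (funext (mehler_cos_int tau)).
have -> : mehler tau y = 2^-1 * (reC (mehlerL tau) + reC (mehlerL (- tau))).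
  rewrite !re_mehlerL schlaefli_rayN /mehler.
  have ii t : intble `[0, pi / 2] (fun b => expR (t * b) * sin (y * cos b)).
    apply: intble_itv_cont; apply: ex_der_continuous => b; eexists; apply: derM; first by dauto.
    by apply: der_sin; apply: derM; [exact: der_cst|exact: dcos].
  have E : \int[mu]_(b in `[0, pi / 2]) (sin (y * cos b) * coshR (tau * b)) =
      2^-1 * (\int[mu]_(b in `[0, pi / 2]) (expR (tau * b) * sin (y * cos b)) +
              \int[mu]_(b in `[0, pi / 2]) (expR (- tau * b) * sin (y * cos b))).
    rewrite -(RintD (measurable_itv _) (ii tau) (ii (- tau))).
    rewrite -(RintZl _ (measurable_itv _) (intbleD (measurable_itv _) (ii tau) (ii (- tau)))).
    by apply: eq_Rint => b _; rewrite /coshR mulNr; field.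
  by rewrite E /coshR !mulNr; field.
apply: cvgM; first exact: cvg_cst.
by apply: cvgD; [case: (mehlerI_cvg tau)|case: (mehlerI_cvg (- tau))].
Qed.

Lemma mehler_sin_cvg tau : exists l : R,
  \int[mu]_(v in `[0, q]) mehler_sin tau v @[q --> +oo] --> l.
Proof.
exists (2^-1 * (imC (mehlerL tau) - imC (mehlerL (- tau)))).
rewrite (funext (mehler_sin_int tau)); apply: cvgM; first exact: cvg_cst.
by apply: cvgB; [case: (mehlerI_cvg tau)|case: (mehlerI_cvg (- tau))].
Qed.

End FixedY.
End Mehler.

(** * The kernel as a cosine transform *)

Section Rotation.
Context {R : realType}.
Implicit Types (a b c d q s t u v w x y tau rho th Y : R).

Local Notation ic := ((0 : R) +i* (1 : R)).

Let dsin x : der (@sin R) x (cos x). Proof. exact: is_derive_sin. Qed.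
Let dcos x : der (@cos R) x (- sin x). Proof. exact: is_derive_cos. Qed.

Lemma exists_angle c d : 0 < c -> 0 < d -> c ^+ 2 + d ^+ 2 = 1 ->
  exists th, [/\ 0 < th < pi / 2, cos th = c & sin th = d].
Proof.
move=> c0 d0 cd; have p0 := @pi_gt0 R.
have c1 : c < 1 by nra.
have h1 : -1 <= c <= 1 by apply/andP; split; lra.
have ct : cos (acos c) = c by apply: acosK; rewrite in_itv.
have [t0 t1] : 0 <= acos c /\ acos c <= pi by split; [exact: acos_ge0|exact: acos_lepi].
have s0 : 0 <= sin (acos c) by apply: sin_ge0_pi; rewrite t0.
have sd : sin (acos c) = d.
  have := cos2Dsin2 (acos c); rewrite ct => E.
  have : (sin (acos c) - d) * (sin (acos c) + d) = 0 by nra.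
  by move/eqP; rewrite mulf_eq0 => /orP[/eqP|/eqP]; lra.
exists (acos c); split => //; apply/andP; split.
  rewrite lt_neqAle t0 andbT; apply/eqP => e; move: sd; rewrite -e sin0; lra.
rewrite ltNge; apply/negP => h.
have : cos (acos c) <= cos (pi / 2).
  rewrite leNgt; apply/negP => h'.
  move: h; rewrite le_eqVlt => /orP[/eqP e|h]; first by move: h'; rewrite -e ltxx.
  have : cos (acos c) < cos (pi / 2).
    by rewrite ltr_cos// in_itv/=; apply/andP; split; lra.
  by move/(lt_trans h'); rewrite ltxx.
rewrite ct cos_pihalf; lra.
Qed.

Section Contour.
Variable rho : R.
Hypothesis rho0 : 0 < rho.

(* exp (- rho (e^z + i e^-z)) at z = u + i th. *)
Definition rotH u th : R[i] :=
  cexp ((- (rho * (expR u * cos th + expR (- u) * sin th))) +i*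
        (- (rho * (expR u * sin th + expR (- u) * cos th)))).
Definition rotH1 u th : R[i] :=
  rotH u th * ((- (rho * (expR u * cos th - expR (- u) * sin th))) +i*
               (- (rho * (expR u * sin th - expR (- u) * cos th)))).

Lemma rotH_u u th : cder (rotH ^~ th) u (rotH1 u th).
Proof.
rewrite /rotH1 /rotH; apply: cder_eq.
  by apply/cder_cexp/cderMk; dauto.
by congr (_ * _); apply: (congr2 (@Complex R)); cbv beta; ring.
Qed.

Lemma rotH_th u th : cder (rotH u) th (ic * rotH1 u th).
Proof.
rewrite /rotH1 /rotH; apply: cder_eq.
  apply/cder_cexp/cderMk; apply: derN; apply: (derM (der_cst _ _)); apply: derD;
    apply: (derM (der_cst _ _)); first [exact: dsin|exact: dcos].
rewrite [RHS](mulrCA ic (cexp _)); congr (_ * _).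
by apply: complex_eq; rewrite !reimE; ring.
Qed.

Lemma ccont_rotH th : ccont (rotH ^~ th).
Proof. by apply: cder_ccont => u; exact: rotH_u. Qed.

Lemma ccont_rotH1 th : ccont (rotH1 ^~ th).
Proof.
apply: ccontM; first exact: ccont_rotH.
by apply: ccontMk; apply: ex_der_continuous => u; eexists; dauto.
Qed.

(** Second-order decay, because the derivative [rotH1] carries a further factor of order cosh u. *)
Lemma expR_inv_sqr q w : 0 < q -> 0 < w -> expR (- (q * w)) <= 2 / q ^+ 2 / w ^+ 2.
Proof.
move=> q0 w0; have := @expR_pow_le R (q * w) 2 _; rewrite (_ : 2`! = 2)%N// => /(_ _) h.
have {}h : (q * w) ^+ 2 * expR (- (q * w)) <= 2 by apply: h; rewrite mulr_ge0// ltW.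
by rewrite -mulrA -invfM -exprMn ler_pdivlMr ?exprn_gt0 ?mulr_gt0// mulrC.
Qed.

Lemma modC_rotH u th m : 0 < m -> m <= cos th -> m <= sin th ->
  modC (rotH u th) <= expR (- (2 * rho * m * coshR u)).
Proof.
move=> m0 mc ms; rewrite modC_cexp ler_expR lerN2.
have -> : 2 * rho * m * coshR u = rho * (expR u * m + expR (- u) * m).
  by rewrite /coshR; field.
by rewrite ler_pM2l// lerD// ler_pM2l// expR_gt0.
Qed.

Let C m := 2 / (2 * rho * m) ^+ 2.

Lemma rotH_bound u th m : 0 < m -> m <= cos th -> m <= sin th ->
  modC (rotH u th) <= C m / coshR u.
Proof.
move=> m0 mc ms; apply: (le_trans (modC_rotH u m0 mc ms)).
have q0 : 0 < 2 * rho * m by rewrite !mulr_gt0.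
apply: (le_trans (expR_inv_sqr q0 (coshR_gt0 u))).
rewrite ler_pM2l ?divr_gt0 ?exprn_gt0// lef_pV2 ?posrE ?exprn_gt0 ?coshR_gt0//.
by have := coshR_ge1 u => h; nra.
Qed.

Lemma rotH1_bound u th m : 0 < m -> m <= cos th -> m <= sin th ->
  modC (rotH1 u th) <= 4 * rho * C m / coshR u.
Proof.
move=> m0 mc ms; rewrite modCM.
have q0 : 0 < 2 * rho * m by rewrite !mulr_gt0.
have w0 := coshR_gt0 u.
have h1 := le_trans (modC_rotH u m0 mc ms) (expR_inv_sqr q0 w0).
have nn (x y : R) : `|x| <= 1 -> `|y| <= 1 ->
    `|- (rho * (expR u * x - expR (- u) * y))| <= rho * (2 * coshR u).
  move=> x1 y1; rewrite normrN normrM gtr0_norm// ler_pM2l//.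
  apply: (le_trans (ler_normB _ _)); rewrite !normrM !(gtr0_norm (expR_gt0 _)).
  have -> : 2 * coshR u = expR u * 1 + expR (- u) * 1 by rewrite /coshR; field.
  by apply: lerD; rewrite ler_pM2l ?expR_gt0.
have h2 : modC ((- (rho * (expR u * cos th - expR (- u) * sin th))) +i*
               (- (rho * (expR u * sin th - expR (- u) * cos th)))) <= 4 * rho * coshR u.
  apply: (le_trans (modC_le _)); rewrite /=.
  have -> : 4 * rho * coshR u = rho * (2 * coshR u) + rho * (2 * coshR u) by ring.
  by apply: lerD; apply: nn; rewrite ?cos_max ?sin_max.
apply: (le_trans (ler_pM (modC_ge0 _) (modC_ge0 _) h1 h2)).
rewrite le_eqVlt; apply/orP; left; apply/eqP; rewrite /C.
by move: (coshR u) w0 => w w0; field; rewrite !gt_eqF.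
Qed.

Lemma rot_integrable th : 0 < th < pi / 2 -> cintegrable setT (rotH ^~ th).
Proof.
move=> /andP[t0 t1].
have c0 : 0 < cos th by apply: cos_gt0_pihalf; apply/andP; split; lra.
have s0 : 0 < sin th by apply: sin_gt0_pi; lra.
have m0 : 0 < Num.min (cos th) (sin th) by rewrite lt_min c0.
apply: (@cintegrable_sech R _ _ (C (Num.min (cos th) (sin th)))) => //.
  by apply: ccont_cmeas => //; exact: ccont_rotH.
by move=> u _; apply: rotH_bound; rewrite // ge_min lexx ?orbT.
Qed.

(** For th strictly between 0 and pi / 2 both e^z and i e^-z have positive real part on the line Im
    z = th, so the line can be moved freely there. *)
Lemma rot_integral_cst a b : 0 < a < pi / 2 -> 0 < b < pi / 2 ->
  cintegral setT (rotH ^~ a) = cintegral setT (rotH ^~ b).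
Proof.
move=> /andP[a0 a1] /andP[b0 b1].
(* The interval from [c] to [d] contains a and b and stays strictly inside that from 0 to pi / 2, so
   cos and sin have a common positive lower bound on it. *)
pose c := Num.min a b / 2; pose d := (Num.max a b + pi / 2) / 2.
have [ca cb] : c < a /\ c < b by rewrite /c; case: (leP a b) => h; split; lra.
have [da db] : a < d /\ b < d by rewrite /d; case: (leP a b) => h; split; lra.
have c0 : 0 < c by rewrite /c; case: (leP a b) => h; lra.
have d1 : d < pi / 2 by rewrite /d; case: (leP a b) => h; lra.
apply: (@cder_zero_cst R (fun t => cintegral setT (rotH ^~ t)) c d); rewrite ?ca ?cb ?da ?db//.
move=> th /andP[tc td].
pose m := Num.min (cos d) (sin c).
have m0 : 0 < m.
  rewrite lt_min cos_gt0_pihalf/= ?sin_gt0_pi//; apply/andP; split; lra.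
have mt t : c < t < d -> m <= cos t /\ m <= sin t.
  move=> /andP[t1 t2]; split.
    apply: (@le_trans _ _ (cos d)); first by rewrite /m ge_min lexx.
    by apply/ltW; rewrite ltr_cos// in_itv/=; apply/andP; split; lra.
  apply: (@le_trans _ _ (sin c)); first by rewrite /m ge_min lexx orbT.
  by apply/ltW; rewrite ltr_sin// in_itv/=; apply/andP; split; lra.
have [th1 th2] : m <= cos th /\ m <= sin th by apply: mt; rewrite tc.
have i1 : cintegrable setT (rotH1 ^~ th).
  apply: (@cintegrable_sech R _ _ (4 * rho * C m)) => //.
    by apply: ccont_cmeas => //; exact: ccont_rotH1.
  by move=> u _; exact: rotH1_bound.
apply: cder_eq.
  apply: (@cder_cint R setT (fun th u => rotH u th) (fun th u => ic * rotH1 u th)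
    (fun u => 4 * rho * C m / coshR u) c d).
  - by [].
  - by rewrite tc.
  - by move=> t t_; apply: rot_integrable; move/andP: t_ => [? ?]; apply/andP; split; lra.
  - by apply: intbleZl => //; exact: intble_sech.
  - move=> t u t_ _; split; first exact: rotH_th.
    by rewrite modCM modC_ii mul1r; have [? ?] := mt t t_; exact: rotH1_bound.
rewrite cintegralZ// (cFTC_T (l := 0) (m := 0) (fun u => rotH_u u th))//.
- by rewrite subrr mulr0.
- exact: ccont_rotH1.
- by apply: (@ccvg_sech_pinfty R _ (C m)) => u; exact: rotH_bound.
- by apply: (@ccvg_sech_ninfty R _ (C m)) => u; exact: rotH_bound.
Qed.

End Contour.

(* Re K_0 (Y (1 + i)). *)
Definition kap Y : R := \int[mu]_(u in `]0, +oo[) (expR (- (Y * coshR u)) * cos (Y * coshR u)).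

Lemma kap_integrable Y : 0 < Y ->
  intble setT (fun u => expR (- (Y * coshR u)) * cos (Y * coshR u)).
Proof.
move=> Y0; apply: (@intble_sech_dom R _ Y^-1) => //.
  by apply: continuous_measurable_fun; apply: ex_der_continuous => u; eexists; dauto.
move=> u _; rewrite normrM ger0_norm ?expR_ge0//.
apply: (@le_trans _ _ (expR (- (Y * coshR u)))); first by rewrite ler_piMr ?expR_ge0 ?cos_max.
have w0 := coshR_gt0 u.
have := @expR_pow_le R (Y * coshR u) 1 _; rewrite (_ : 1`! = 1)%N// expr1 => /(_ _) h.
have {}h : Y * coshR u * expR (- (Y * coshR u)) <= 1 by apply: h; rewrite mulr_ge0// ltW.
by rewrite -invfM -[leRHS]mul1r ler_pdivlMr ?(mulr_gt0 Y0 w0)// mulrC.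
Qed.

(** The line integral of [rotH] is evaluated at two heights. At pi / 4 the integrand is symmetric
    and gives [kap]; at the angle with tangent e^-s, after a translation by s / 2, the real and
    imaginary parts of the exponent become y cosh u and y cosh (u - s) up to sign. *)
Lemma kap_rotation y s : 0 < y ->
  2 * kap (y * Num.sqrt (coshR s)) =
  \int[mu]_u (expR (- (y * coshR u)) * cos (y * coshR (u - s))).
Proof.
move=> y0; set q := Num.sqrt (coshR s).
have q0 : 0 < q by rewrite sqrtr_gt0 coshR_gt0.
have qq : q ^+ 2 = coshR s by rewrite sqr_sqrtr// ltW// coshR_gt0.
pose r := Num.sqrt (2 : R).
have r0 : 0 < r by rewrite sqrtr_gt0.
have rr : r ^+ 2 = 2 by rewrite sqr_sqrtr.
(* Chosen so that rho / r = y q / 2 at the angle [t1] and rho / (r q) = y / 2 at the angle [t2]. *)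
pose rho := y * q / r.
have rho0 : 0 < rho by rewrite divr_gt0// mulr_gt0.
have ir0 : 0 < r^-1 by rewrite invr_gt0.
have [t1 [t1_ ct1 st1]] : exists th, [/\ 0 < th < pi / 2, cos th = r^-1 & sin th = r^-1].
  by apply: exists_angle => //; rewrite exprVn rr; lra.
have h0 : 0 < r * q by rewrite mulr_gt0.
have [t2 [t2_ ct2 st2]] : exists th, [/\ 0 < th < pi / 2, cos th = expR (s / 2) / (r * q) &
    sin th = expR (- (s / 2)) / (r * q)].
  apply: exists_angle; rewrite ?divr_gt0 ?expR_gt0//.
  rewrite !expr_div_n -mulrDl exprMn rr qq -!expRM_natr.
  have -> : s / 2 * 2 = s by field.
  have -> : - (s / 2) * 2 = - s by field.
  have -> : expR s + expR (- s) = 2 * coshR s by rewrite /coshR; field.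
  by rewrite divff// mulf_neq0// gt_eqF// coshR_gt0.
have E1 u : reC (rotH rho u t1) = expR (- (y * q * coshR u)) * cos (y * q * coshR u).
  have E : rho * (expR u * r^-1 + expR (- u) * r^-1) = y * q * coshR u.
    have -> : rho * (expR u * r^-1 + expR (- u) * r^-1) = y * q * (expR u + expR (- u)) / r ^+ 2.
      by rewrite /rho; field; rewrite gt_eqF.
    by rewrite rr /coshR; field.
  by rewrite /rotH ct1 st1 E /cexp /= cosN.
have E2 u : reC (rotH rho u t2) =
    expR (- (y * coshR (u + s / 2))) * cos (y * coshR (u + s / 2 - s)).
  have Ea : rho * (expR u * (expR (s / 2) / (r * q)) + expR (- u) * (expR (- (s / 2)) / (r * q)))
      = y * coshR (u + s / 2).
    rewrite /coshR opprD !expRD.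
    transitivity (y * (expR u * expR (s / 2) + expR (- u) * expR (- (s / 2))) / r ^+ 2).
      by rewrite /rho; field; rewrite !gt_eqF.
    by rewrite rr; field.
  have Eb : rho * (expR u * (expR (- (s / 2)) / (r * q)) + expR (- u) * (expR (s / 2) / (r * q)))
      = y * coshR (u + s / 2 - s).
    have -> : u + s / 2 - s = u - s / 2 by field.
    rewrite /coshR opprB addrC expRD [in RHS]addrC expRD.
    transitivity (y * (expR u * expR (- (s / 2)) + expR (- u) * expR (s / 2)) / r ^+ 2).
      by rewrite /rho; field; rewrite !gt_eqF.
    by rewrite rr; field.
  by rewrite /rotH ct2 st2 Ea Eb /cexp /= cosN.
have := congr1 (@reC R) (rot_integral_cst rho0 t1_ t2_).
rewrite /cintegral /= => E.
have i1 := kap_integrable (mulr_gt0 y0 q0).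
have e1 x : expR (- (y * q * coshR (- x))) * cos (y * q * coshR (- x)) =
    expR (- (y * q * coshR x)) * cos (y * q * coshR x) by rewrite coshRN.
rewrite /kap -(Rint_even i1 e1).
rewrite -(eq_Rint (fun u _ => E1 u)) E (eq_Rint (fun u _ => E2 u)).
have i2 : intble setT (fun u => expR (- (y * coshR u)) * cos (y * coshR (u - s))).
  have [i3 _] := rot_integrable rho0 t2_.
  have i4 := eq_intble measurableT (fun u _ => E2 u) i3.
  have := intble_shift (- (s / 2)) measurableT i4; rewrite preimage_setT.
  by apply: eq_intble => // u _; rewrite /= subrK.
by have := Rint_shift (s / 2) measurableT i2; rewrite preimage_setT.
Qed.

End Rotation.

(** * The product of K and Im J as a cosine transform *)

Section Product.
Context {R : realType}.
Implicit Types (a b c d q s t u v w x y tau Y : R).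

Lemma expR_inv q w : 0 < q -> 0 < w -> expR (- (q * w)) <= q^-1 / w.
Proof.
move=> q0 w0; have qw := mulr_gt0 q0 w0.
have := @expR_pow_le R (q * w) 1 (ltW qw); rewrite (_ : 1`! = 1)%N// expr1 => h.
by rewrite -invfM -[leRHS]mul1r ler_pdivlMr// mulrC.
Qed.

Lemma intble_exp_cosh q : 0 < q -> intble setT (fun u => expR (- (q * coshR u))).
Proof.
move=> q0; apply: (@intble_sech_dom R _ q^-1) => //.
  by apply: continuous_measurable_fun; apply: ex_der_continuous => u; eexists; dauto.
by move=> u _; rewrite ger0_norm ?expR_ge0//; exact: expR_inv q0 (coshR_gt0 u).
Qed.

(** At Y = y sqrt (cosh s) the factor 1 / Y^2 becomes a multiple of 1 / cosh s. *)
Lemma kap_bound Y : 0 < Y ->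
  `|kap Y| <= 2 / Y ^+ 2 * \int[mu]_(u in `]0, +oo[) ((coshR u)^-1).
Proof.
move=> Y0; have m0 : measurable (`]0, +oo[%classic : set R) by exact: measurable_itv.
have ic : intble `]0, +oo[ (fun u : R => (coshR u)^-1) by apply: intbleS (@intble_sech R).
have ik := intbleS measurableT m0 (@subsetT _ _) (kap_integrable Y0).
rewrite -(RintZl _ m0 ic); apply: Rint_le_norm => //; [exact: intble_meas ik|exact: intbleZl|].
move=> u _; have w1 := coshR_ge1 u; have w0 := coshR_gt0 u.
rewrite normrM ger0_norm ?expR_ge0//.
apply: (@le_trans _ _ (expR (- (Y * coshR u)))); first by rewrite ler_piMr ?expR_ge0 ?cos_max.
apply: (le_trans (expR_inv_sqr Y0 w0)).
rewrite ler_pM2l ?divr_gt0 ?exprn_gt0// lef_pV2 ?posrE ?exprn_gt0//.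
by nra.
Qed.

Lemma kap_continuous Y : 0 < Y -> {for Y, continuous (@kap R)}.
Proof.
move=> Y0; apply: (@Rint_continuous R `]0, +oo[ (fun Y u => expR (- (Y * coshR u)) * cos (Y * coshR u))
  (fun u => expR (- (Y / 2 * coshR u))) (Y / 2) (Y + 1)) => //.
- lra.
- move=> t _; apply: measurable_funTS; apply: continuous_measurable_fun.
  by apply: ex_der_continuous => u; eexists; dauto.
- by apply: (intbleS measurableT _ _ (intble_exp_cosh _)) => //; lra.
- move=> t u /andP[t1 t2] _; rewrite normrM ger0_norm ?expR_ge0//.
  apply: (@le_trans _ _ (expR (- (t * coshR u)))); first by rewrite ler_piMr ?expR_ge0 ?cos_max.
  by rewrite ler_expR lerN2 ler_pM2r ?coshR_gt0// ltW.
- move=> u _ t _; apply: (@ex_der_continuous R (fun t => expR (- (t * coshR u)) * cos (t * coshR u))).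
  by move=> t'; eexists; dauto.
Qed.

Lemma kap_cosh_continuous y : 0 < y -> continuous (fun s => kap (y * Num.sqrt (coshR s))).
Proof.
move=> y0 s; apply: (@continuous_comp _ _ _ (fun s => y * Num.sqrt (coshR s)) (@kap R)).
  apply: cvgM; first exact: cvg_cst.
  by apply: (continuous_comp (f := @coshR R)); [exact: continuous_coshR|exact: sqrt_continuous].
by apply: kap_continuous; rewrite mulr_gt0// sqrtr_gt0 coshR_gt0.
Qed.

Lemma kap_cosh_integrable y : 0 < y -> intble setT (fun s => kap (y * Num.sqrt (coshR s))).
Proof.
move=> y0; pose A := \int[mu]_(u in `]0, +oo[) ((coshR u)^-1) : R.
apply: (@intble_sech_dom R _ (2 / y ^+ 2 * A)) => //.
  by apply: continuous_measurable_fun; exact: kap_cosh_continuous.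
move=> s _; have w0 := coshR_gt0 s.
have q0 : 0 < y * Num.sqrt (coshR s) by rewrite mulr_gt0// sqrtr_gt0.
apply: (le_trans (kap_bound q0)).
by rewrite -/A exprMn (sqr_sqrtr (ltW w0)) invfM !mulrA (mulrAC _ A).
Qed.

Section Shifted.
Variables (y tau : R).
Hypothesis y0 : 0 < y.

Let B T u := \int[mu]_(s in `[- T, T]) (cos (y * coshR (u - s)) * cos (tau * s)).

(** The substitution s = v + u and the addition formula for cos (tau (v + u)) reduce the window to
    those of [mehler_cos] and [mehler_sin]. *)
Let Bcos T u : \int[mu]_(s in `[- T, T]) (cos (y * coshR (u - s)) * cos (tau * s)) =
  cos (tau * u) * \int[mu]_(v in `[- T - u, T - u]) mehler_cos y tau v -
  sin (tau * u) * \int[mu]_(v in `[- T - u, T - u]) mehler_sin y tau v.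
Proof.
have c1 : continuous (fun s => cos (y * coshR (u - s)) * cos (tau * s)).
  by apply: ex_der_continuous => s; eexists; dauto.
rewrite -(Rint_shift u (measurable_itv _) (intble_itv_cont (- T) T c1)) shift_preimage_itv.
have i1 := intble_itv_cont (- T - u) (T - u) (@continuous_mehler_cos R y tau).
have i2 := intble_itv_cont (- T - u) (T - u) (@continuous_mehler_sin R y tau).
have mI := measurable_itv `[- T - u, T - u].
rewrite -(RintZl (cos (tau * u)) mI i1) -(RintZl (sin (tau * u)) mI i2).
rewrite -(RintB mI (intbleZl _ mI i1) (intbleZl _ mI i2)).
apply: eq_Rint => v _; rewrite /mehler_cos /mehler_sin.
have -> : u - (v + u) = - v by ring.
by rewrite coshRN mulrDr cosD; ring.
Qed.

Let B_bounded : exists M, forall T u : R, 0 <= T -> `|B T u| <= M.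
Proof.
have [M1 h1] := mehler_cos_bounded y0 tau; have [M2 h2] := mehler_sin_bounded y0 tau.
exists (M1 + M2) => T u T0; rewrite /B Bcos.
have Tu : - T - u <= T - u by lra.
apply: (le_trans (ler_normB _ _)); rewrite !normrM; apply: lerD.
  by rewrite -[leRHS]mul1r; apply: ler_pM => //; [exact: cos_max|exact: h1].
by rewrite -[leRHS]mul1r; apply: ler_pM => //; [exact: sin_max|exact: h2].
Qed.

Let natB_pinfty u : n%:R - u @[n --> \oo] --> (+oo : set_system R).
Proof.
apply/cvgryPge => A; near=> n; rewrite lerBrDr.
near: n; exact: nbhs_infty_ger.
Unshelve. all: by end_near. Qed.

(** After splitting at 0, the left half is the integral of g (- v) for v from 0 to n + u, so the
    translation by u disappears in the limit. *)
Let window (g : R -> R) (l l' : R) u : continuous g ->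
  \int[mu]_(v in `[0, q]) g v @[q --> +oo] --> l ->
  \int[mu]_(v in `[0, q]) g (- v) @[q --> +oo] --> l' ->
  \int[mu]_(v in `[- n%:R - u, n%:R - u]) g v @[n --> \oo] --> l + l'.
Proof.
move=> cg h1 h2.
have H : \int[mu]_(v in `[0, n%:R - u]) g v + \int[mu]_(v in `[0, n%:R - - u]) g (- v)
    @[n --> \oo] --> l + l'.
  apply: cvgD.
    by apply: (cvg_comp (fun n : nat => n%:R - u) (fun q => \int[mu]_(v in `[0, q]) g v)) h1; exact: natB_pinfty.
  by apply: (cvg_comp (fun n : nat => n%:R - - u) (fun q => \int[mu]_(v in `[0, q]) g (- v))) h2; exact: natB_pinfty.
apply: cvg_trans H; apply: near_eq_cvg; near=> n.
have nu : `|u| <= n%:R by near: n; exact: nbhs_infty_ger.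
move: nu; rewrite ler_norml => /andP[n1 n2].
rewrite (@Rint_itv_cat R g (- n%:R - u) 0 (n%:R - u)) //; [|lra|lra].
rewrite addrC; congr (_ + _); rewrite Rint_itv_opp// oppr0.
by have -> : - (- n%:R - u) = n%:R - - u by ring.
Unshelve. all: by end_near. Qed.

(** The sine windows tend to l - l = 0, since [mehler_sin] is odd; the two halves of the cosine
    window contribute equally. *)
Let B_cvg u : B n%:R u @[n --> \oo] --> 2 * mehler tau y * cos (tau * u).
Proof.
have [l hl] := mehler_sin_cvg y0 tau.
have hc := @mehler_cos_cvg R y y0 tau.
have E1 : (fun q => \int[mu]_(v in `[0, q]) mehler_cos y tau (- v)) =
    (fun q => \int[mu]_(v in `[0, q]) mehler_cos y tau v).
  by apply/funext => q; apply: eq_Rint => v _; rewrite mehler_cosN.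
have E2 : (fun q => \int[mu]_(v in `[0, q]) mehler_sin y tau (- v)) =
    (fun q => - \int[mu]_(v in `[0, q]) mehler_sin y tau v).
  apply/funext => q.
  rewrite -(RintN (measurable_itv _) (intble_itv_cont 0 q (@continuous_mehler_sin R y tau))).
  by apply: eq_Rint => v _; rewrite mehler_sinN.
have hc' := hc; rewrite -E1 in hc'.
have hl' : \int[mu]_(v in `[0, q]) mehler_sin y tau (- v) @[q --> +oo] --> - l.
  by rewrite E2; exact: cvgN hl.
have w1 := window u (@continuous_mehler_cos R y tau) hc hc'.
have w2 := window u (@continuous_mehler_sin R y tau) hl hl'.
rewrite (funext (fun n : nat => Bcos n%:R u)).
have -> : 2 * mehler tau y * cos (tau * u) =
    cos (tau * u) * (mehler tau y + mehler tau y) - sin (tau * u) * (l - l) by ring.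
by apply: cvgB; apply: cvgM => //; exact: cvg_cst.
Qed.

Lemma kap_cos_transform :
  \int[mu]_(s in `]0, +oo[) (kap (y * Num.sqrt (coshR s)) * cos (tau * s)) =
  mehler tau y * \int[mu]_(u in `]0, +oo[) (expR (- (y * coshR u)) * cos (tau * u)).
Proof.
pose e u := expR (- (y * coshR u)).
have ie : intble setT e := intble_exp_cosh y0.
have e0 u : 0 <= e u by exact: expR_ge0.
pose F s u := cos (tau * s) * (e u * cos (y * coshR (u - s))).
have cF s : continuous (F s).
  by apply: ex_der_continuous => u; eexists; rewrite /F /e; dauto.
have cF' u : continuous (F ^~ u).
  by apply: ex_der_continuous => s; eexists; rewrite /F /e; dauto.
have Fb s u : `|F s u| <= e u.
  rewrite /F normrM -[leRHS]mul1r ler_pM ?cos_max// normrM (ger0_norm (e0 u)).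
  by rewrite ler_piMr ?cos_max.
have iF s : intble setT (F s).
  by apply: (intble_le measurableT _ ie) => //; exact: continuous_measurable_fun.
have ik := kap_cosh_integrable y0.
pose g s := cos (tau * s) * (2 * kap (y * Num.sqrt (coshR s))).
have Fint s : \int[mu]_u F s u = g s.
  have i2 : intble setT (fun u => e u * cos (y * coshR (u - s))).
    apply: (intble_le measurableT _ ie) => //.
      by apply: continuous_measurable_fun; apply: ex_der_continuous => u; eexists; rewrite /e; dauto.
    by move=> u _; rewrite normrM (ger0_norm (e0 u)) ler_piMr ?cos_max.
  by rewrite /F (RintZl _ measurableT i2) /g kap_rotation.
have ig : intble setT g.
  apply: (intble_le measurableT _ (intbleZl 2 measurableT (intble_norm measurableT ik))).
    apply: continuous_measurable_fun => s; apply: cvgM.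
      by apply: (@ex_der_continuous R (fun s => cos (tau * s))) => t; eexists; dauto.
    by apply: cvgM; [exact: cvg_cst|exact: kap_cosh_continuous].
  move=> s _; rewrite /g normrM -[leRHS]mul1r ler_pM ?cos_max//.
  by rewrite normrM ger0_norm.
(* Fubini is applied on a bounded window: the majorant exp (- y cosh u) of the integrand is constant
   in s. *)
have fub n : \int[mu]_(s in `[- n%:R, n%:R]) g s = \int[mu]_u (e u * B n%:R u) /\
    measurable_fun setT (fun u => e u * B n%:R u).
  have mD : measurable (`[- n%:R, n%:R]%classic : set R) by exact: measurable_itv.
  have [|||||_ iE FE] := @Rfubini R `[- n%:R, n%:R] setT F (fun=> \int[mu]_u e u) mD measurableT.
  - apply: measurable_funTS.
    have mc : measurable_fun setT (@coshR R) by apply: continuous_measurable_fun; exact: continuous_coshR.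
    have mcos : measurable_fun setT (@cos R) by apply: continuous_measurable_fun; exact: continuous_cos.
    apply: measurable_funM.
      by apply: (measurableT_comp mcos); apply: measurable_funM => //; exact: measurable_fst.
    apply: measurable_funM.
      apply: (@measurableT_comp _ _ _ _ _ _ e); last exact: measurable_snd.
      exact: intble_meas ie.
    apply: (measurableT_comp mcos); apply: measurable_funM => //.
    apply: (measurableT_comp mc); apply: measurable_funB; first exact: measurable_snd.
    exact: measurable_fst.
  - by move=> s _; exact: iF.
  - by move=> u _; exact: intble_itv_cont.
  - by apply: intble_itv_cont => x; exact: cvg_cst.
  - move=> s _; apply: le_Rintegral => //; first exact: intble_norm.
  have BE u : \int[mu]_(s in `[- n%:R, n%:R]) F s u = e u * B n%:R u.
    have c2 : continuous (fun s => cos (y * coshR (u - s)) * cos (tau * s)).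
      by apply: ex_der_continuous => s; eexists; dauto.
    rewrite /B -(RintZl (e u) mD (intble_itv_cont _ _ c2)).
    by apply: eq_Rint => s _; rewrite /F; ring.
  split; last by rewrite -(funext BE); exact: intble_meas iE.
  transitivity (\int[mu]_(s in `[- n%:R, n%:R]) \int[mu]_u F s u).
    by apply: eq_Rint => s _; rewrite Fint.
  by rewrite FE; apply: eq_Rint => u _; exact: BE.
have L1 : \int[mu]_(s in `[- n%:R, n%:R]) g s @[n --> \oo] --> \int[mu]_s g s.
  apply: Rint_exhaust => // s _; near=> n; rewrite /= in_itv/= -ler_norml.
  near: n; exact: nbhs_infty_ger.
have [M hM] := B_bounded.
have L2 : \int[mu]_u (e u * B n%:R u) @[n --> \oo] -->
    \int[mu]_u (e u * (2 * mehler tau y * cos (tau * u))).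
  apply: (proj2 (@Rint_dct R setT (fun n u => e u * B n%:R u) _ (fun u => e u * M) measurableT _ _ _ _)).
  - by move=> n; case: (fub n).
  - exact: intbleZr.
  - by move=> n u _; rewrite normrM (ger0_norm (e0 u)) ler_wpM2l// hM.
  - by move=> u _; apply: cvgM; [exact: cvg_cst|exact: B_cvg].
have {}L1 : \int[mu]_u (e u * B n%:R u) @[n --> \oo] --> \int[mu]_s g s.
  by move: L1; rewrite (funext (fun n => (fub n).1)).
have E : \int[mu]_s g s = \int[mu]_u (e u * (2 * mehler tau y * cos (tau * u))).
  by apply: (cvg_unique _ L1 L2); exact: Rhausdorff.
have m0 : measurable (`]0, +oo[%classic : set R) by exact: measurable_itv.
have ik0 : intble `]0, +oo[ (fun s => kap (y * Num.sqrt (coshR s)) * cos (tau * s)).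
  apply: (intbleS measurableT m0 (@subsetT _ _)).
  apply: (eq_intble measurableT _ (intbleZl 2^-1 measurableT ig)) => s _; rewrite /g; lra.
have ie1 : intble setT (fun u => e u * cos (tau * u)).
  apply: (intble_le measurableT _ ie) => //.
    by apply: continuous_measurable_fun; apply: ex_der_continuous => u; eexists; rewrite /e; dauto.
  by move=> u _; rewrite normrM (ger0_norm (e0 u)) ler_piMr ?cos_max.
have ie0 := intbleS measurableT m0 (@subsetT _ _) ie1.
(* One factor 2 is that of [kap_rotation], the other comes from evenness in s. *)
have gE : \int[mu]_s g s = 4 * \int[mu]_(s in `]0, +oo[) (kap (y * Num.sqrt (coshR s)) * cos (tau * s)).
  have gN z : g (- z) = g z by rewrite /g coshRN mulrN cosN.
  rewrite (Rint_even ig gN).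
  have <- := RintZl 4 m0 ik0.
  have <- := RintZl 2 m0 (intbleS measurableT m0 (@subsetT _ _) ig).
  by apply: eq_Rint => s _; rewrite /g; ring.
have eE : \int[mu]_u (e u * (2 * mehler tau y * cos (tau * u))) =
    4 * (mehler tau y * \int[mu]_(u in `]0, +oo[) (e u * cos (tau * u))).
  have eN u : e (- u) * cos (tau * - u) = e u * cos (tau * u) by rewrite /e coshRN mulrN cosN.
  transitivity (2 * mehler tau y * \int[mu]_u (e u * cos (tau * u))).
    have <- := RintZl (2 * mehler tau y) measurableT ie1.
    by apply: eq_Rint => u _; ring.
  by rewrite (Rint_even ie1 eN); ring.
apply: (@mulfI _ (4 : R)); first by rewrite pnatr_eq0.
by rewrite -gE E eE.
Unshelve. all: by end_near. Qed.

End Shifted.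

Lemma besselK_iE tau y : reC (besselK (0 +i* tau) y%:C) =
  \int[mu]_(u in `]0, +oo[) (expR (- (y * coshR u)) * cos (tau * u)).
Proof.
apply: eq_Rint => u _.
have -> : - y%:C * (coshR u)%:C = (- (y * coshR u))%:C.
  by rewrite -RtoCN -RtoCM mulNr.
have -> : (0 +i* tau) * u%:C = 0 +i* (tau * u) by apply: complex_eq; rewrite !reimE; ring.
have -> : ccosh (0 +i* (tau * u)) = (cos (tau * u))%:C.
  have c2 : (2 : R[i]) = (2 : R)%:C by rewrite rmorph_nat.
  have n2 : (2 : R[i]) != 0 by rewrite pnatr_eq0.
  apply: (mulIf n2); rewrite /ccosh mulfVK // c2 -RtoCM.
  apply/eqP; rewrite eq_complex /= oppr0 expR0 !mul1r cosN sinN subrr eqxx.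
  by rewrite mulr_natr mulr2n eqxx.
by rewrite cexpR /= mulr0 subr0.
Qed.

(** The factor sinh (tau pi / 2) of [im_besselJE] cancels the denominator of the kernel, and
    [kap_cos_transform] rewrites the remaining product of [mehler] and K. *)
Lemma Psi_quotE tau x : tau != 0 -> 0 < x -> Psi_quot tau x = - (2 / pi) *
  \int[mu]_(s in `]0, +oo[) (kap (2 * Num.sqrt (2 * x) * Num.sqrt (coshR s)) * cos (tau * s)).
Proof.
move=> t0 x0; have y0 : 0 < 2 * Num.sqrt (2 * x) by rewrite mulr_gt0// sqrtr_gt0 mulr_gt0.
rewrite /Psi_quot kap_cos_transform// besselK_iE im_besselJE//.
have sn : sinhR (pi * tau / 2) != 0.
  have p0 := @pi_gt0 R.
  apply/eqP; rewrite /sinhR => /eqP; rewrite mulf_eq0 invr_eq0 pnatr_eq0 orbF subr_eq0.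
  move/eqP/expR_inj => E; move/eqP: t0; apply.
  have : pi * tau = 0 by lra.
  by move/eqP; rewrite mulf_eq0 gt_eqF//= => /eqP.
rewrite (mulrC pi tau) in sn *; move: (sinhR _) sn (mehler _ _) (Rintegral _ _ _) (2 / pi).
by move=> S sn m k c; field.
Qed.

End Product.

(** * Bounds by the weight *)

Section Weight.
Context {R : realType}.
Implicit Types (a b c d p q s t u v w x y tau Y : R).

(* K_0 (p). *)
Definition macd p : R := \int[mu]_(u in `]0, +oo[) expR (- (p * coshR u)).

Let m0 : measurable (`]0, +oo[%classic : set R). Proof. exact: measurable_itv. Qed.

Let macd_intble p : 0 < p -> intble `]0, +oo[ (fun u => expR (- (p * coshR u))).
Proof. by move=> p0; exact: intbleS measurableT m0 (@subsetT _ _) (intble_exp_cosh p0). Qed.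

Lemma macd_ge0 p : 0 <= macd p.
Proof. by apply: Rintegral_ge0 => u _; exact: expR_ge0. Qed.

Lemma macd_le p q : 0 < p -> p <= q -> macd q <= macd p.
Proof.
move=> p0 pq; apply: le_Rintegral => //.
- exact: macd_intble (lt_le_trans p0 pq).
- exact: macd_intble.
by move=> u _; rewrite ler_expR lerN2 ler_pM2r// coshR_gt0.
Qed.

Lemma kap_le_macd Y : 0 < Y -> `|kap Y| <= macd Y.
Proof.
move=> Y0; apply: Rint_le_norm => //.
- exact: intble_meas (intbleS measurableT m0 (@subsetT _ _) (kap_integrable Y0)).
- exact: macd_intble.
by move=> u _; rewrite normrM ger0_norm ?expR_ge0// ler_piMr ?expR_ge0 ?cos_max.
Qed.

Lemma macd_continuous Y : 0 < Y -> {for Y, continuous macd}.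
Proof.
move=> Y0; apply: (@Rint_continuous R `]0, +oo[ (fun Y u => expR (- (Y * coshR u)))
  (fun u => expR (- (Y / 2 * coshR u))) (Y / 2) (Y + 1)) => //.
- lra.
- move=> t _; apply: measurable_funTS; apply: continuous_measurable_fun.
  by apply: ex_der_continuous => u; eexists; dauto.
- by apply: macd_intble; lra.
- move=> t u /andP[t1 t2] _; rewrite ger0_norm ?expR_ge0//.
  by rewrite ler_expR lerN2 ler_pM2r ?coshR_gt0// ltW.
- move=> u _ t _; apply: (@ex_der_continuous R (fun t => expR (- (t * coshR u)))).
  by move=> t'; eexists; dauto.
Qed.

Let full_macd p : 0 < p -> \int[mu]_u expR (- (p * coshR u)) = 2 * macd p.
Proof.
move=> p0; rewrite /macd.
have eN u : expR (- (p * coshR (- u))) = expR (- (p * coshR u)) by rewrite coshRN.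
exact: (Rint_even (intble_exp_cosh p0) eN).
Qed.

(* cosh (u + s/2) + cosh (u - s/2) = 2 cosh u cosh (s/2), so the square of the
   integral over the line is an iterated integral of the same kind. *)
Lemma macd_sqr p : 0 < p ->
  intble `]0, +oo[ (fun s => macd (2 * p * coshR (s / 2))) /\
  \int[mu]_(s in `]0, +oo[) macd (2 * p * coshR (s / 2)) = macd p ^+ 2.
Proof.
move=> p0; pose e u := expR (- (p * coshR u)).
have ie : intble setT e := intble_exp_cosh p0.
have e0 u : 0 <= e u by exact: expR_ge0.
pose F v s := e v * e (s - v).
have shiftE v : \int[mu]_s e (s - v) = \int[mu]_s e s.
  by have := Rint_shift (- v) measurableT ie; rewrite preimage_setT.
have shiftI v : intble setT (fun s => e (s - v)).
  by have := intble_shift (- v) measurableT ie; rewrite preimage_setT.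
have iF v : intble setT (F v) by exact: intbleZl.
have inner s : intble setT (F ^~ s) /\ \int[mu]_v F v s = 2 * macd (2 * p * coshR (s / 2)).
  have q0 : 0 < 2 * p * coshR (s / 2) by rewrite mulr_gt0 ?coshR_gt0// mulr_gt0.
  have E v : F v s = expR (- (2 * p * coshR (s / 2) * coshR (v - s / 2))).
    rewrite /F /e -expRD; congr expR.
    move: (v - s / 2) (subrK (s / 2) v) => w <-.
    have -> : s - (w + s / 2) = - (w - s / 2) by field.
    by rewrite coshRN !coshRD coshRN sinhRN; ring.
  have i0 := intble_exp_cosh q0.
  split.
    have i1 : intble setT (fun v => expR (- (2 * p * coshR (s / 2) * coshR (v - s / 2)))).
      by have := intble_shift (- (s / 2)) measurableT i0; rewrite preimage_setT.
    by apply: (eq_intble measurableT _ i1) => v _; rewrite E.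
  rewrite -(full_macd q0).
  have := Rint_shift (- (s / 2)) measurableT i0; rewrite preimage_setT => <-.
  by apply: eq_Rint => v _; rewrite E.
have mF : measurable_fun (setT `*` setT) (fun z : R * R => F z.1 z.2).
  have me : measurable_fun setT e by exact: intble_meas ie.
  apply: measurable_funTS; apply: measurable_funM.
    by apply: (measurableT_comp me); exact: measurable_fst.
  apply: (measurableT_comp me); apply: measurable_funB; first exact: measurable_snd.
  exact: measurable_fst.
have [|||I1 I2 E] := @Rfubini R setT setT F (fun v => e v * (2 * macd p)) measurableT measurableT mF
    (fun v _ => iF v).
- by move=> s _; case: (inner s).
- exact: intbleZr.
- move=> v _; rewrite -(full_macd p0) -(shiftE v).
  have <- := RintZl (e v) measurableT (shiftI v).
  rewrite le_eqVlt; apply/orP; left; apply/eqP; apply: eq_Rint => s _.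
  by rewrite /F ger0_norm// mulr_ge0.
have I3 : intble setT (fun s => macd (2 * p * coshR (s / 2))).
  apply: (eq_intble measurableT _ (intbleZl 2^-1 measurableT I2)) => s _.
  apply: (etrans (congr1 (fun z => 2^-1 * z) (inner s).2)).
  by rewrite mulKf// pnatr_eq0.
split; first exact: intbleS measurableT m0 (@subsetT _ _) I3.
have mN s : macd (2 * p * coshR (- s / 2)) = macd (2 * p * coshR (s / 2)) by rewrite mulNr coshRN.
have E1 : \int[mu]_v \int[mu]_s F v s = 4 * macd p ^+ 2.
  transitivity (\int[mu]_v (2 * macd p * e v)).
    apply: eq_Rint => v _; rewrite -(full_macd p0) -(shiftE v) mulrC.
    exact: (RintZl (e v) measurableT (shiftI v)).
  by rewrite (RintZl _ measurableT ie) (full_macd p0); ring.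
have E2 : \int[mu]_s \int[mu]_v F v s = 4 * \int[mu]_(s in `]0, +oo[) macd (2 * p * coshR (s / 2)).
  transitivity (2 * \int[mu]_s macd (2 * p * coshR (s / 2))).
    have <- := RintZl 2 measurableT I3.
    by apply: eq_Rint => s _; exact: (inner s).2.
  by rewrite (Rint_even I3 mN); ring.
have n4 : (4 : R) != 0 by rewrite pnatr_eq0.
exact: (mulfI n4 (etrans (esym E2) (etrans (esym E) E1))).
Qed.

Lemma besselK0E p : reC (besselK 0 p%:C) = macd p.
Proof.
have -> : (0 : R[i]) = 0 +i* 0 by [].
by rewrite besselK_iE; apply: eq_Rint => u _; rewrite mul0r cos0 mulr1.
Qed.

Lemma L0_weightE x : L0_weight x = macd (Num.sqrt (2 * x)) ^+ 2.
Proof. by rewrite /L0_weight besselK0E. Qed.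

Lemma L0_weight_ge0 x : 0 <= L0_weight x. Proof. exact: sqr_ge0. Qed.

(* Re K_0 (4 e^(i pi / 4) sqrt (x cosh t)). *)
Definition kap2 x t := kap (2 * Num.sqrt (2 * x) * Num.sqrt (coshR t)).

Let arg0 x t : 0 < x -> 0 < 2 * Num.sqrt (2 * x) * Num.sqrt (coshR t).
Proof. by move=> x0; rewrite !mulr_gt0// sqrtr_gt0 ?coshR_gt0// mulr_gt0. Qed.

Lemma kap2_le x t : 0 < x -> `|kap2 x t| <= macd (2 * Num.sqrt (2 * x) * coshR (t / 2)).
Proof.
move=> x0; apply: (le_trans (kap_le_macd (arg0 t x0))).
have c0 := coshR_gt0 (t / 2).
have p0 : 0 < 2 * Num.sqrt (2 * x) by rewrite mulr_gt0// sqrtr_gt0 mulr_gt0.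
apply: macd_le; first exact: mulr_gt0.
have cE : coshR (t / 2) = Num.sqrt (coshR (t / 2) ^+ 2) by rewrite sqrtr_sqr ger0_norm// ltW.
(* With c = cosh (t / 2) >= 1, cosh t = 2 c^2 - 1 >= c^2. *)
rewrite ler_pM2l// cE; apply: ler_wsqrtr; rewrite (cosh_half t).
by have := coshR_ge1 (t / 2) => h; nra.
Qed.

Let weight_intble x : 0 < x ->
  intble `]0, +oo[ (fun t => macd (2 * Num.sqrt (2 * x) * coshR (t / 2))) /\
  \int[mu]_(t in `]0, +oo[) macd (2 * Num.sqrt (2 * x) * coshR (t / 2)) = L0_weight x.
Proof.
by move=> x0; rewrite L0_weightE; apply: macd_sqr; rewrite sqrtr_gt0 mulr_gt0.
Qed.

Lemma kap2_intble x : 0 < x -> intble setT (kap2 x).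
Proof. by move=> x0; apply: kap_cosh_integrable; rewrite mulr_gt0// sqrtr_gt0 mulr_gt0. Qed.

Lemma kap2_norm_int x : 0 < x -> \int[mu]_(t in `]0, +oo[) `|kap2 x t| <= L0_weight x.
Proof.
move=> x0; have [i1 <-] := weight_intble x0; apply: le_Rintegral => //.
  exact: intble_norm (intbleS measurableT m0 (@subsetT _ _) (kap2_intble x0)).
by move=> t _; exact: kap2_le.
Qed.

(** The majorant of [kap2_le] is nonincreasing in t, so t times its value at t is at most its
    integral up to t, hence at most the weight. This makes the integral over x exist for every t >
    0. *)
Lemma kap2_pointwise x t : 0 < x -> 0 < t -> `|kap2 x t| <= t^-1 * L0_weight x.
Proof.
move=> x0 t0; apply: (le_trans (kap2_le t x0)).
have [i1 i2] := weight_intble x0.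
have p0 : 0 < 2 * Num.sqrt (2 * x) by rewrite mulr_gt0// sqrtr_gt0 mulr_gt0.
have := fun s (s0 : 0 < s <= t) => @macd_le (2 * Num.sqrt (2 * x) * coshR (s / 2)) (2 * Num.sqrt (2 * x) * coshR (t / 2)).
move: (macd _) => k kle.
have {}kle s : 0 < s <= t -> k <= macd (2 * Num.sqrt (2 * x) * coshR (s / 2)).
  move=> st; apply: (kle s st); first by rewrite mulr_gt0// coshR_gt0.
  by move/andP: st => [s0 s1]; rewrite ler_pM2l//; apply: coshR_le; lra.
rewrite mulrC ler_pdivlMr// -i2.
have mt : measurable (`]0, t]%classic : set R) by exact: measurable_itv.
have st : (`]0, t]%classic : set R) `<=` `]0, +oo[%classic by move=> s /=; rewrite !in_itv/= => /andP[->].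
apply: (le_trans _ (Rint_subset mt m0 st i1 _)); last by move=> s _; exact: macd_ge0.
have -> : k * t = \int[mu]_(s in `]0, t]) k.
  by rewrite Rintegral_cst//= lebesgue_measure_itv/= lte_fin t0/= subr0.
have ck : continuous (fun _ : R => k) by move=> z; exact: cvg_cst.
have tS : (`]0, t]%classic : set R) `<=` `[0, t]%classic.
  by move=> s /=; rewrite !in_itv/= => /andP[/ltW -> ->].
apply: Rint_le => //.
- exact: (intbleS (measurable_itv _) mt tS (intble_itv_cont 0 t ck)).
- exact: (intbleS m0 mt st i1).
Qed.

Lemma measurable_kap : measurable_fun halfline (@kap R).
Proof.
apply: open_continuous_measurable_fun; first exact: interval_open.
by move=> Y; rewrite inE /halfline/= in_itv/= andbT => Y0; exact: kap_continuous.
Qed.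

Let msqrt : measurable_fun setT (@Num.sqrt R).
Proof. by apply: continuous_measurable_fun; exact: sqrt_continuous. Qed.

Lemma measurable_kap2 : measurable_fun (halfline `*` halfline) (fun z : R * R => kap2 z.1 z.2).
Proof.
apply: (@measurable_comp _ _ _ _ _ _ halfline (@kap R)) => //.
- by move=> _ [[x t] /= [x0 _] <-] /=; move: x0; rewrite /halfline/= !in_itv/= !andbT => x0; exact: arg0.
- exact: measurable_kap.
apply: measurable_funTS; apply: measurable_funM.
  apply: measurable_funM => //.
  apply: (@measurableT_comp _ _ _ _ _ _ (@Num.sqrt R)); first exact: msqrt.
  by apply: measurable_funM => //; exact: measurable_fst.
apply: (@measurableT_comp _ _ _ _ _ _ (@Num.sqrt R)); first exact: msqrt.
apply: (@measurableT_comp _ _ _ _ _ _ (@coshR R)); last exact: measurable_snd.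
by apply: continuous_measurable_fun; exact: continuous_coshR.
Qed.

Lemma measurable_L0_weight : measurable_fun halfline (@L0_weight R).
Proof.
rewrite (funext L0_weightE).
apply: (@measurable_funX _ _ R halfline (fun x => macd (Num.sqrt (2 * x))) 2).
apply: (@measurable_comp _ _ _ _ _ _ halfline macd) => //.
- move=> z [x]; rewrite /halfline/= !in_itv/= !andbT => x0 <-; rewrite sqrtr_gt0 mulr_gt0//.
- apply: open_continuous_measurable_fun; first exact: interval_open.
  by move=> Y; rewrite inE /halfline/= in_itv/= andbT => Y0; exact: macd_continuous.
apply: measurable_funTS.
apply: (@measurableT_comp _ _ _ _ _ _ (@Num.sqrt R)); first exact: msqrt.
exact: measurable_funM.
Qed.

(** 4 e^(i pi / 4) sqrt (x cosh t) is (1 + i) Y, since 4 / sqrt 2 = 2 sqrt 2; the values at pi / 4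
    come from tan (pi / 4) = 1. *)
Lemma K0_kernel_cosh x t : 0 < x -> K0_kernel (coshR t) x = kap2 x t.
Proof.
move=> x0; rewrite /K0_kernel /kap2.
have c0 := coshR_gt0 t.
have tp := @tan_piquarter R.
have cs : cos (pi / 4) = (Num.sqrt 2)^-1 :> R /\ sin (pi / 4) = (Num.sqrt 2)^-1 :> R.
  have p0 := @pi_gt0 R.
  have cp : 0 < cos (pi / 4 : R) by apply: cos_gt0_pihalf; apply/andP; split; lra.
  have E : sin (pi / 4) = cos (pi / 4) :> R.
    by move: tp; rewrite /tan => /(congr1 (fun z => z * cos (pi / 4))); rewrite mul1r divfK// gt_eqF.
  have := @cos2Dsin2 R (pi / 4); rewrite E => h.
  suff -> : cos (pi / 4 : R) = (Num.sqrt 2)^-1 by [].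
  apply: (@mulIf _ (Num.sqrt (2 : R))); first by rewrite gt_eqF// sqrtr_gt0.
  rewrite mulVf ?gt_eqF ?sqrtr_gt0//.
  have r0 : 0 < Num.sqrt (2 : R) by rewrite sqrtr_gt0.
  have rr : Num.sqrt (2 : R) ^+ 2 = 2 by rewrite sqr_sqrtr.
  have : (cos (pi / 4) * Num.sqrt 2) ^+ 2 = 1 :> R by rewrite exprMn rr; lra.
  move/eqP; rewrite sqrf_eq1 => /orP[/eqP//|/eqP h']; have := mulr_gt0 cp r0; lra.
have r0 : 0 < Num.sqrt (2 : R) by rewrite sqrtr_gt0.
have rr : Num.sqrt (2 : R) ^+ 2 = 2 by rewrite sqr_sqrtr.
set Y := 2 * _ * _.
have -> : 4 * cexp (0 +i* (pi / 4)) * (Num.sqrt (coshR t * x))%:C = Y +i* Y.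
  have -> : (4 : R[i]) = (4 : R)%:C by rewrite rmorph_nat.
  have YE : 4 * ((Num.sqrt 2)^-1 * Num.sqrt (coshR t * x)) = Y.
    rewrite /Y (sqrtrM x (ltW c0)) (sqrtrM x (ler0n R 2)).
    transitivity (2 * Num.sqrt (2 : R) ^+ 2 / Num.sqrt 2 * (Num.sqrt (coshR t) * Num.sqrt x)).
      by rewrite rr; ring.
    by field; rewrite gt_eqF.
  rewrite -{1 2}YE.
  case: cs => c s; apply: complex_eq; rewrite !reimE /= expR0 c s !mul1r; ring.
apply: eq_Rint => u _.
have -> : ccosh (0 * u%:C) = 1.
  by rewrite mul0r /ccosh oppr0 cexp0 -mulr2n -mulr_natr mul1r divff// pnatr_eq0.
rewrite mulr1.
have -> : - (Y +i* Y) * (coshR u)%:C = (- (Y * coshR u)) +i* (- (Y * coshR u)).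
  by apply: complex_eq; rewrite !reimE; ring.
by rewrite /cexp /= cosN.
Qed.

End Weight.

(** * Transforms of real densities *)

Section Kernel.
Context {R : realType}.
Implicit Types (a b c d p q s t u v w x y tau : R).

Let m0 : measurable (halfline : set R). Proof. exact: measurable_itv. Qed.

Let pi0 : 0 < 2 / pi :> R. Proof. by rewrite divr_gt0// pi_gt0. Qed.

Let halflineP x : halfline x -> 0 < x.
Proof. by rewrite /halfline/= in_itv/= andbT. Qed.

(** The cosine transform is defined and continuous at tau = 0 too, which identifies the limit in
    [Psi]. *)
Definition PsiI tau x : R := - (2 / pi) * \int[mu]_(t in halfline) (kap2 x t * cos (tau * t)).

Lemma kap2_continuous x : 0 < x -> continuous (kap2 x).
Proof. by move=> x0; apply: kap_cosh_continuous; rewrite mulr_gt0// sqrtr_gt0 mulr_gt0. Qed.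

Let kap2_half x : 0 < x -> intble halfline (kap2 x).
Proof. by move=> x0; exact: intbleS measurableT m0 (@subsetT _ _) (kap2_intble x0). Qed.

Let mkap2cos x tau : 0 < x -> measurable_fun setT (fun t => kap2 x t * cos (tau * t)).
Proof.
move=> x0; apply: continuous_measurable_fun => t; apply: cvgM; first exact: kap2_continuous.
by apply: (@ex_der_continuous R (fun t => cos (tau * t))) => s; eexists; dauto.
Qed.

Lemma kap2_cos_le x tau t : `|kap2 x t * cos (tau * t)| <= `|kap2 x t|.
Proof. by rewrite normrM ler_piMr// cos_max. Qed.

Lemma kap2_cos_intble x tau : 0 < x -> intble halfline (fun t => kap2 x t * cos (tau * t)).
Proof.
move=> x0; apply: (intble_le m0 _ (intble_norm m0 (kap2_half x0))).
  by apply: measurable_funTS; exact: mkap2cos.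
by move=> t _; exact: kap2_cos_le.
Qed.

Lemma PsiI_continuous x : 0 < x -> continuous (PsiI ^~ x).
Proof.
move=> x0 tau; apply: cvgM; first exact: cvg_cst.
apply: (@Rint_continuous R halfline (fun tau t => kap2 x t * cos (tau * t)) (fun t => `|kap2 x t|)
  (tau - 1) (tau + 1)) => //.
- lra.
- by move=> s _; apply: measurable_funTS; exact: mkap2cos.
- by apply: intble_norm => //; exact: kap2_half.
- by move=> s t _ _; exact: kap2_cos_le.
- move=> t _ s _; apply: cvgM; first exact: cvg_cst.
  by apply: (@ex_der_continuous R (fun s => cos (s * t))) => r; eexists; dauto.
Qed.

Let Psi_quot_near x : 0 < x -> \forall tau \near (0 : R)^', PsiI tau x = Psi_quot tau x.
Proof.
move=> x0; near=> tau; rewrite Psi_quotE//.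
by near: tau; exact: nbhs_dnbhs_neq.
Unshelve. all: by end_near. Qed.

Lemma Psi_quot_cvg x : 0 < x -> Psi_quot tau x @[tau --> (0 : R)^'] --> PsiI 0 x.
Proof.
move=> x0; have : PsiI tau x @[tau --> (0 : R)^'] --> PsiI 0 x.
  by apply: cvg_within_filter; exact: PsiI_continuous.
apply: cvg_trans; apply: near_eq_cvg; exact: Psi_quot_near.
Qed.

Lemma PsiE tau x : 0 < x -> Psi tau x = PsiI tau x.
Proof.
move=> x0; rewrite /Psi; case: eqVneq => [->|t0]; last by rewrite Psi_quotE.
by apply: cvg_lim => //; exact: Psi_quot_cvg.
Qed.

Lemma PsiI_bound tau x : 0 < x -> `|PsiI tau x| <= 2 / pi * L0_weight x.
Proof.
move=> x0; rewrite /PsiI normrM normrN (gtr0_norm pi0) ler_pM2l//.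
apply: (le_trans _ (kap2_norm_int x0)).
apply: Rint_le_norm => //; first by apply: measurable_funTS; exact: mkap2cos.
  by apply: intble_norm => //; exact: kap2_half.
by move=> t _; exact: kap2_cos_le.
Qed.

Lemma PsiIN tau x : PsiI (- tau) x = PsiI tau x.
Proof. by congr (_ * _); apply: eq_Rint => t _; rewrite mulNr cosN. Qed.

Let kap2N x t : kap2 x (- t) = kap2 x t. Proof. by rewrite /kap2 coshRN. Qed.

(** A bound by 1 / cosh survives translations of length at most 1 up to a constant, as the
    domination of the modulus of continuity requires. *)
Let kap2_sech x : 0 < x -> exists2 C, 0 <= C & forall t, `|kap2 x t| <= C / coshR t.
Proof.
move=> x0; pose A : R := \int[mu]_(u in `]0, +oo[) ((coshR u)^-1).
have A0 : 0 <= A by apply: Rintegral_ge0 => u _; rewrite invr_ge0 ltW// coshR_gt0.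
pose y := 2 * Num.sqrt (2 * x).
have y0 : 0 < y by rewrite mulr_gt0// sqrtr_gt0 mulr_gt0.
exists (2 / y ^+ 2 * A); first by rewrite mulr_ge0// divr_ge0// exprn_ge0// ltW.
move=> t; have c0 := coshR_gt0 t.
have q0 : 0 < y * Num.sqrt (coshR t) by rewrite mulr_gt0// sqrtr_gt0.
apply: (le_trans (kap_bound q0)).
by rewrite -/A exprMn (sqr_sqrtr (ltW c0)) invfM !mulrA (mulrAC _ A).
Qed.

(* Riemann--Lebesgue: translating by a half period changes the sign of the
   cosine, so the integral is at most half the L1 modulus of continuity. *)
Lemma PsiI_decay x : 0 < x -> PsiI tau x @[tau --> +oo] --> 0.
Proof.
move=> x0; have [C C0 hC] := kap2_sech x0.
have ik := kap2_intble x0.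
pose W d := \int[mu]_t `|kap2 x t - kap2 x (t + d)|.
have shiftI d : intble setT (fun t => kap2 x (t + d)).
  by have := intble_shift d measurableT ik; rewrite preimage_setT.
have W0 : W 0 = 0.
  rewrite -[RHS](Rint_zero setT); apply: eq_Rint => t _.
  by rewrite addr0 subrr normr0.
have cW : {for 0, continuous W}.
  apply: (@Rint_continuous R setT (fun d t => `|kap2 x t - kap2 x (t + d)|)
    (fun t => (C + C * (2 * coshR 1)) / coshR t) (-1) 1) => //.
  - lra.
  - by move=> d _; exact: intble_meas (intble_norm measurableT (intbleB measurableT ik (shiftI d))).
  - by apply: intbleZl => //; exact: intble_sech.
  - move=> d t /andP[d1 d2] _; rewrite normr_id (le_trans (ler_normB _ _))// mulrDl.
    apply: lerD; first exact: hC.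
    apply: (le_trans (hC _)).
    have c1 := coshR_gt0 t; have c2 := coshR_gt0 (t + d).
    have cd : coshR d <= coshR 1.
      have [dp|dn] := leP 0 d; first by apply: coshR_le; lra.
      by rewrite -coshRN; apply: coshR_le; lra.
    (* From cosh (a + b) + cosh (a - b) = 2 cosh a cosh b. *)
    have ab a b : coshR (a + b) <= 2 * coshR b * coshR a.
      by have := coshR_gt0 (a - b); rewrite !coshRD coshRN sinhRN; lra.
    have key : coshR t <= 2 * coshR 1 * coshR (t + d).
      have := ab (t + d) (- d); rewrite addrK coshRN => h; apply: (le_trans h).
      by rewrite ler_pM2r// ler_pM2l.
    by rewrite ler_pdivrMr// mulrAC ler_pdivlMr// -(mulrA C) ler_wpM2l.
  - move=> t _ d _; apply: (@continuous_comp _ _ _ _ (fun z : R => `|z|)); last exact: norm_continuous.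
    apply: cvgB; first exact: cvg_cst.
    apply: (@continuous_comp _ _ _ (fun d => t + d) (kap2 x)); last exact: kap2_continuous.
    by apply: cvgD; [exact: cvg_cst|exact: cvg_id].
have bound tau : 0 < tau -> `|PsiI tau x| <= 2 / pi * W (pi / tau).
  move=> t0; rewrite /PsiI normrM normrN (gtr0_norm pi0) ler_pM2l//.
  pose g t := kap2 x t * cos (tau * t).
  have ig : intble setT g.
    apply: (intble_le measurableT _ (intble_norm measurableT ik)); first exact: mkap2cos.
    by move=> t _; exact: kap2_cos_le.
  have gN t : g (- t) = g t by rewrite /g kap2N mulrN cosN.
  have E1 := Rint_even ig gN.
  have i2 : intble setT (fun t => kap2 x (t + pi / tau) * cos (tau * t)).
    apply: (intble_le measurableT _ (intble_norm measurableT (shiftI (pi / tau)))).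
      apply: measurable_funM; first exact: intble_meas (shiftI _).
      by apply: continuous_measurable_fun; apply: ex_der_continuous => t; eexists; dauto.
    by move=> t _; rewrite normrM ler_piMr// cos_max.
  have E2 : \int[mu]_t g t = - \int[mu]_t (kap2 x (t + pi / tau) * cos (tau * t)).
    have <- := RintN measurableT i2.
    have := Rint_shift (pi / tau) measurableT ig; rewrite preimage_setT => <-.
    apply: eq_Rint => t _; rewrite /g mulrDr.
    have -> : tau * (pi / tau) = pi by rewrite mulrC divfK// gt_eqF.
    by rewrite cosDpi mulrN.
  have E3 : 2 * \int[mu]_t g t = \int[mu]_t ((kap2 x t - kap2 x (t + pi / tau)) * cos (tau * t)).
    transitivity (\int[mu]_t (g t - kap2 x (t + pi / tau) * cos (tau * t))).
      apply: (etrans _ (esym (RintB measurableT ig i2))).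
      by rewrite mulr_natl mulr2n {2}E2.
    by apply: eq_Rint => t _; rewrite mulrBl.
  have B : `|\int[mu]_t ((kap2 x t - kap2 x (t + pi / tau)) * cos (tau * t))| <= W (pi / tau).
    apply: Rint_le_norm => //.
    - apply: (@eq_measurable_fun _ _ _ _ _ (fun t => g t - kap2 x (t + pi / tau) * cos (tau * t))).
        by move=> t _; rewrite mulrBl.
      exact: intble_meas (intbleB measurableT ig i2).
    - exact: intble_norm measurableT (intbleB measurableT ik (shiftI _)).
    - by move=> t _; rewrite normrM ler_piMr// cos_max.
  move: B; rewrite -E3 E1; move: (W _) => w.
  rewrite /g -/(@halfline R); move: (Rintegral _ _ _) => J; rewrite !normrM (ger0_norm (ler0n R 2)).
  by apply: le_trans; rewrite mulrA ler_peMl// -natrM ler1n.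
have L : 2 / pi * W (pi / tau) @[tau --> +oo] --> (0 : R).
  have E0 : 2 / pi * W 0 = 0 by rewrite W0 mulr0.
  rewrite -[X in _ --> X]E0.
  apply: cvgM; first exact: cvg_cst.
  have Lp : pi / tau @[tau --> +oo] --> (0 : R).
    rewrite -[X in _ --> X](mulr0 pi); apply: cvgM; first exact: cvg_cst.
    have pos : \forall tau \near +oo, 0 < tau :> R by exact: nbhs_pinfty_gt.
    exact: ((gtr0_cvgV0 pos).2 cvg_id).
  by apply: (@cvg_comp _ _ _ (fun tau : R => pi / tau) W _ _ _ Lp); exact: cW.
apply: norm_cvg0; apply: (squeeze_cvgr _ (cvg_cst 0) L).
near=> tau; rewrite normr_ge0/=; apply: bound.
by near: tau; exact: nbhs_pinfty_gt.
Unshelve. all: by end_near. Qed.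

Section RealDensity.
Variable phi : R -> R.
Hypothesis mphi : measurable_fun halfline phi.
Hypothesis iphi : intble halfline (fun x => L0_weight x * `|phi x|).

Let msec t : measurable_fun halfline (fun x => kap2 x t).
Proof.
apply: (@measurable_comp _ _ _ _ _ _ halfline (@kap R)) => //.
- move=> z [x /halflineP x0 <-]; rewrite /halfline/= in_itv/= andbT.
  by rewrite !mulr_gt0 ?sqrtr_gt0 ?coshR_gt0 ?mulr_gt0.
- exact: measurable_kap.
apply: measurable_funTS; apply: measurable_funM => //; apply: measurable_funM => //.
apply: (@measurableT_comp _ _ _ _ _ _ (@Num.sqrt R)); last exact: measurable_funM.
by apply: continuous_measurable_fun; exact: sqrt_continuous.
Qed.

Lemma kap2_density_intble t : 0 < t -> intble halfline (fun x => kap2 x t * phi x).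
Proof.
move=> t0; apply: (intble_le m0 _ (intbleZl t^-1 m0 iphi)).
  by apply: measurable_funM => //; exact: msec.
move=> x /halflineP x0; rewrite normrM mulrA ler_wpM2r//.
exact: kap2_pointwise.
Qed.

Let F tau x t := kap2 x t * cos (tau * t) * phi x.

(** Tonelli's condition is [kap2_norm_int]: the integral over t of |kap2 x t| is at most the weight,
    which is where the norm of L^0 enters. *)
Let fub tau :
  [/\ intble halfline (fun x => \int[mu]_(t in halfline) F tau x t),
      intble halfline (fun t => \int[mu]_(x in halfline) F tau x t) &
      \int[mu]_(x in halfline) \int[mu]_(t in halfline) F tau x t =
      \int[mu]_(t in halfline) \int[mu]_(x in halfline) F tau x t].
Proof.
apply: (@Rfubini R halfline halfline (F tau) (fun x => L0_weight x * `|phi x|) m0 m0) => //.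
- apply: measurable_funM.
    apply: measurable_funM; first exact: measurable_kap2.
    apply: measurable_funTS.
    have mc : measurable_fun setT (@cos R) by apply: continuous_measurable_fun; exact: continuous_cos.
    by apply: (measurableT_comp mc); apply: measurable_funM => //; exact: measurable_snd.
  apply: (@measurable_comp _ _ _ _ _ _ halfline phi) => //.
    by move=> z [[x t] [x0 _] <-].
  by apply: measurable_funTS; exact: measurable_fst.
- by move=> x /halflineP x0; apply: intbleZr => //; exact: kap2_cos_intble.
- move=> t /halflineP t0; apply: (eq_intble m0 _ (intbleZl (cos (tau * t)) m0 (kap2_density_intble t0))).
  by move=> x _; rewrite /F; ring.
- move=> x /halflineP x0.
  apply: (@le_trans _ _ (\int[mu]_(t in halfline) (`|kap2 x t| * `|phi x|))).
    have ik := kap2_half x0.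
    apply: Rint_le => //.
    + by apply: intble_norm => //; apply: intbleZr => //; exact: kap2_cos_intble.
    + by apply: intbleZr => //; exact: intble_norm.
    + by move=> t _; rewrite /F normrM ler_wpM2r// kap2_cos_le.
  rewrite (_ : \int[mu]_(t in halfline) (`|kap2 x t| * `|phi x|) =
    `|phi x| * \int[mu]_(t in halfline) `|kap2 x t|); last first.
    have <- := RintZl `|phi x| m0 (intble_norm m0 (kap2_half x0)).
    by apply: eq_Rint => t _; rewrite mulrC.
  by rewrite mulrC ler_wpM2r//; exact: kap2_norm_int.
Qed.

Let innerE tau x : 0 < x -> PsiI tau x * phi x = - (2 / pi) * \int[mu]_(t in halfline) F tau x t.
Proof.
move=> x0; rewrite /PsiI -mulrA; congr (_ * _); rewrite mulrC.
have <- := RintZl (phi x) m0 (kap2_cos_intble tau x0).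
by apply: eq_Rint => t _; rewrite mulrC.
Qed.

Lemma PsiI_density_intble tau : intble halfline (fun x => PsiI tau x * phi x).
Proof.
have [i1 _ _] := fub tau.
apply: (eq_intble m0 _ (intbleZl (- (2 / pi)) m0 i1)) => x /halflineP x0.
by rewrite innerE.
Qed.

(** Up to the factor - sqrt (2 / pi), the operator K_0 applied to [phi] and evaluated at cosh t. *)
Definition dual t := \int[mu]_(x in halfline) (kap2 x t * phi x).

Let dualE tau t : 0 < t -> \int[mu]_(x in halfline) F tau x t = dual t * cos (tau * t).
Proof.
move=> t0; rewrite mulrC.
have <- := RintZl (cos (tau * t)) m0 (kap2_density_intble t0).
by apply: eq_Rint => x _; rewrite /F; ring.
Qed.

Lemma dual_cos_intble tau : intble halfline (fun t => dual t * cos (tau * t)).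
Proof.
have [_ i2 _] := fub tau.
by apply: (eq_intble m0 _ i2) => t /halflineP t0; exact: dualE.
Qed.

Lemma dual_intble : intble halfline dual.
Proof.
by apply: (eq_intble m0 _ (dual_cos_intble 0)) => t _; rewrite mul0r cos0 mulr1.
Qed.

Lemma PsiI_density_dual tau : \int[mu]_(x in halfline) (PsiI tau x * phi x) =
  - (2 / pi) * \int[mu]_(t in halfline) (dual t * cos (tau * t)).
Proof.
have [i1 _ E] := fub tau.
transitivity (- (2 / pi) * \int[mu]_(x in halfline) \int[mu]_(t in halfline) F tau x t).
  have <- := RintZl (- (2 / pi)) m0 i1.
  by apply: eq_Rint => x /halflineP x0; exact: innerE.
by congr (_ * _); rewrite E; apply: eq_Rint => t /halflineP t0; exact: dualE.
Qed.

Let domin tau x : halfline x -> `|PsiI tau x * phi x| <= 2 / pi * (L0_weight x * `|phi x|).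
Proof. by move=> /halflineP x0; rewrite normrM mulrA ler_wpM2r//; exact: PsiI_bound. Qed.

Lemma PsiI_density_bound tau : `|\int[mu]_(x in halfline) (PsiI tau x * phi x)| <=
  2 / pi * \int[mu]_(x in halfline) (L0_weight x * `|phi x|).
Proof.
have <- := RintZl (2 / pi) m0 iphi.
apply: Rint_le_norm => //; first exact: intble_meas (PsiI_density_intble tau).
- exact: intbleZl.
- exact: domin.
Qed.

Lemma PsiI_density_continuous :
  continuous (fun tau => \int[mu]_(x in halfline) (PsiI tau x * phi x)).
Proof.
move=> tau; apply: (@Rint_continuous R halfline (fun tau x => PsiI tau x * phi x)
  (fun x => 2 / pi * (L0_weight x * `|phi x|)) (tau - 1) (tau + 1)) => //.
- lra.
- by move=> s _; exact: intble_meas (PsiI_density_intble s).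
- exact: intbleZl.
- by move=> s x _; exact: domin.
- by move=> x /halflineP x0 s _; apply: cvgM; [exact: PsiI_continuous|exact: cvg_cst].
Qed.

(** Dominated convergence over x, with the decay [PsiI_decay] at each x and the majorant from
    [PsiI_bound]. *)
Lemma PsiI_density_decay :
  \int[mu]_(x in halfline) (PsiI tau x * phi x) @[tau --> +oo] --> 0.
Proof.
rewrite -[X in _ --> X](Rint_zero (halfline : set R)).
apply: (@Rint_dct_pinfty R halfline (fun tau x => PsiI tau x * phi x) (fun=> 0)
  (fun x => 2 / pi * (L0_weight x * `|phi x|))) => //.
- by move=> s; exact: intble_meas (PsiI_density_intble s).
- exact: intbleZl.
- move=> x /halflineP x0; rewrite -[X in _ --> X](mul0r (phi x)).
  by apply: cvgM; [exact: PsiI_decay|exact: cvg_cst].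
Qed.

Lemma PsiI_density_decayN :
  \int[mu]_(x in halfline) (PsiI tau x * phi x) @[tau --> -oo] --> 0.
Proof.
apply/cvgNy_compNP; move: PsiI_density_decay; apply: cvg_trans; apply: near_eq_cvg.
by near=> tau; rewrite /=; apply: eq_Rint => x _; rewrite PsiIN.
Unshelve. all: by end_near. Qed.

End RealDensity.
End Kernel.

(** * The index transform *)

Section Assembly.
Context {R : realType}.
Implicit Types (x t tau : R) (f g : R -> R[i]).

Let m0 : measurable (halfline : set R). Proof. exact: measurable_itv. Qed.

Let halflineP x : halfline x -> 0 < x.
Proof. by rewrite /halfline/= in_itv/= andbT. Qed.

Lemma measurable_modC f : measurable_fun halfline (fun x => reC (f x)) ->
  measurable_fun halfline (fun x => imC (f x)) -> measurable_fun halfline (fun x => modC (f x)).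
Proof.
move=> mr mi.
have E x : modC (f x) = Num.sqrt (reC (f x) ^+ 2 + imC (f x) ^+ 2) by case: (f x).
rewrite (funext E).
have ms : measurable_fun setT (@Num.sqrt R).
  by apply: continuous_measurable_fun; exact: sqrt_continuous.
apply: (measurableT_comp ms); apply: measurable_funD.
  exact: (@measurable_funX _ _ R halfline (fun x => reC (f x)) 2).
exact: (@measurable_funX _ _ R halfline (fun x => imC (f x)) 2).
Qed.

(** The real counterpart of [L0_norm]; the two agree on L^0 because the integral is finite there. *)
Definition L0_int f := \int[mu]_(x in halfline) (L0_weight x * modC (f x)).

Lemma in_L0_intble f : in_L0 f -> intble halfline (fun x => L0_weight x * modC (f x)).
Proof.
move=> [mr mi fin]; apply/integrableP; split.
  apply/measurable_EFinP; apply: measurable_funM; first exact: measurable_L0_weight.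
  exact: measurable_modC.
move: fin; rewrite /L0_norm; congr (_ < _)%E; apply: eq_integral => x _.
by rewrite /= ger0_norm// mulr_ge0 ?L0_weight_ge0 ?modC_ge0.
Qed.

Lemma L0_normE f : in_L0 f -> L0_norm f = (L0_int f)%:E.
Proof.
move=> hf; rewrite /L0_int /Rintegral fineK//.
exact: integrable_fin_num (in_L0_intble hf).
Qed.

Let part f (pr : R[i] -> R) := fun x => pr (f x).

Lemma in_L0_re f : in_L0 f -> measurable_fun halfline (part f (@reC R)) /\
  intble halfline (fun x => L0_weight x * `|part f (@reC R) x|).
Proof.
move=> hf; have [mr _ _] := hf; split => //.
apply: (intble_le m0 _ (in_L0_intble hf)).
  apply: measurable_funM; first exact: measurable_L0_weight.
  by apply: measurableT_comp.
move=> x _; rewrite normrM normr_id ger0_norm ?L0_weight_ge0//.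
by rewrite ler_wpM2l ?L0_weight_ge0// re_le_modC.
Qed.

Lemma in_L0_im f : in_L0 f -> measurable_fun halfline (part f (@imC R)) /\
  intble halfline (fun x => L0_weight x * `|part f (@imC R) x|).
Proof.
move=> hf; have [_ mi _] := hf; split => //.
apply: (intble_le m0 _ (in_L0_intble hf)).
  apply: measurable_funM; first exact: measurable_L0_weight.
  by apply: measurableT_comp.
move=> x _; rewrite normrM normr_id ger0_norm ?L0_weight_ge0//.
by rewrite ler_wpM2l ?L0_weight_ge0// im_le_modC.
Qed.

Let re_scale (c : R) (z : R[i]) : reC (c%:C * z) = c * reC z.
Proof. by rewrite !reimE; ring. Qed.
Let im_scale (c : R) (z : R[i]) : imC (c%:C * z) = c * imC z.
Proof. by rewrite !reimE; ring. Qed.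

Lemma index_transformE f tau : index_transform f tau =
  (\int[mu]_(x in halfline) (PsiI tau x * reC (f x))) +i*
  (\int[mu]_(x in halfline) (PsiI tau x * imC (f x))).
Proof.
rewrite /index_transform /cintegral; apply: (congr2 (@Complex R)); apply: eq_Rint => x /halflineP x0.
  by rewrite re_scale PsiE.
by rewrite im_scale PsiE.
Qed.

Lemma index_transform_integrable f tau : in_L0 f ->
  cintegrable halfline (fun x => (Psi tau x)%:C * f x).
Proof.
move=> hf; have [mr ir] := in_L0_re hf; have [mi ii] := in_L0_im hf.
split.
  apply: (eq_intble m0 _ (PsiI_density_intble mr ir tau)) => x /halflineP x0.
  by rewrite re_scale PsiE.
apply: (eq_intble m0 _ (PsiI_density_intble mi ii tau)) => x /halflineP x0.
by rewrite im_scale PsiE.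
Qed.

(** The bound of the kernel contributes 2 / pi, and the separate treatment of real and imaginary
    parts the other factor 2. *)
Lemma index_transform_bound f tau : in_L0 f ->
  modC (index_transform f tau) <= 2 * (2 / pi) * L0_int f.
Proof.
move=> hf; have [mr ir] := in_L0_re hf; have [mi ii] := in_L0_im hf.
have p0 : 0 < 2 / pi :> R by rewrite divr_gt0// pi_gt0.
rewrite index_transformE; apply: (le_trans (modC_le _)).
have -> : 2 * (2 / pi) * L0_int f = 2 / pi * L0_int f + 2 / pi * L0_int f by ring.
have iw := in_L0_intble hf.
apply: lerD.
  apply: (le_trans (PsiI_density_bound mr ir tau)); rewrite ler_pM2l//.
  by apply: Rint_le => // x _; rewrite ler_wpM2l ?L0_weight_ge0// re_le_modC.
apply: (le_trans (PsiI_density_bound mi ii tau)); rewrite ler_pM2l//.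
by apply: Rint_le => // x _; rewrite ler_wpM2l ?L0_weight_ge0// im_le_modC.
Qed.

Lemma index_transform_C0 f : in_L0 f -> in_C0 (index_transform f).
Proof.
move=> hf; have [mr ir] := in_L0_re hf; have [mi ii] := in_L0_im hf.
have Er : (fun tau => reC (index_transform f tau)) =
    (fun tau => \int[mu]_(x in halfline) (PsiI tau x * reC (f x))).
  by apply/funext => tau; rewrite index_transformE.
have Ei : (fun tau => imC (index_transform f tau)) =
    (fun tau => \int[mu]_(x in halfline) (PsiI tau x * imC (f x))).
  by apply/funext => tau; rewrite index_transformE.
have cr := PsiI_density_continuous mr ir; rewrite -Er in cr.
have ci := PsiI_density_continuous mi ii; rewrite -Ei in ci.
have dr := PsiI_density_decay mr ir; rewrite -Er in dr.
have di := PsiI_density_decay mi ii; rewrite -Ei in di.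
have dNr := PsiI_density_decayN mr ir; rewrite -Er in dNr.
have dNi := PsiI_density_decayN mi ii; rewrite -Ei in dNi.
split.
- by move=> tau; apply: ccvg_cvg; split; [exact: (cr tau)|exact: (ci tau)].
- by exists (2 * (2 / pi) * L0_int f) => t; exact: index_transform_bound.
- by apply: ccvg_cvg.
- by apply: ccvg_cvg.
Qed.

Lemma index_transform_linear (a : R[i]) f g : in_L0 f -> in_L0 g ->
  index_transform (fun x => a * f x + g x) =
  (fun tau => a * index_transform f tau + index_transform g tau).
Proof.
move=> hf hg; apply/funext => tau.
have i1 := index_transform_integrable tau hf; have i2 := index_transform_integrable tau hg.
rewrite /index_transform -(cintegralZ _ m0 i1) -cintegralD//; last exact: cintegrableZ.
by apply: eq_cintegral => x _; rewrite mulrDr mulrCA.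
Qed.

Lemma index_transform_bounded : bounded_operator_L0_C0 (@index_transform R).
Proof.
split; [exact: index_transform_C0|exact: index_transform_linear|].
have p0 : 0 < 2 / pi :> R by rewrite divr_gt0// pi_gt0.
exists (2 * (2 / pi)); first by rewrite mulr_ge0// ltW.
move=> f hf; rewrite L0_normE// -EFinM lee_fin; apply: ge_sup.
  by exists (modC (index_transform f 0)); exists 0.
by move=> _ [t _ <-]; exact: index_transform_bound.
Qed.

Lemma K0_density_integrable f t : in_L0 f -> 0 < t ->
  cintegrable halfline (fun s => (K0_kernel (coshR t) s)%:C * f s).
Proof.
move=> hf t0; have [mr ir] := in_L0_re hf; have [mi ii] := in_L0_im hf.
split.
  apply: (eq_intble m0 _ (kap2_density_intble mr ir t0)) => x /halflineP x0.
  by rewrite re_scale K0_kernel_cosh.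
apply: (eq_intble m0 _ (kap2_density_intble mi ii t0)) => x /halflineP x0.
by rewrite im_scale K0_kernel_cosh.
Qed.

Let k : R := Num.sqrt (2 / pi).

Lemma K0_op_cosh f t : K0_op f (coshR t) =
  (- k * dual (part f (@reC R)) t) +i* (- k * dual (part f (@imC R)) t).
Proof.
rewrite /K0_op -/k /cintegral.
have -> (a b : R) : - k%:C * (a +i* b) = (- k * a) +i* (- k * b).
  by apply: complex_eq; rewrite !reimE; ring.
apply: (congr2 (@Complex R)); congr (_ * _); apply: eq_Rint => x /halflineP x0.
  by rewrite re_scale K0_kernel_cosh.
by rewrite im_scale K0_kernel_cosh.
Qed.

Lemma K0_op_integrable f : in_L0 f -> cintegrable halfline (fun t => K0_op f (coshR t)).
Proof.
move=> hf; have [mr ir] := in_L0_re hf; have [mi ii] := in_L0_im hf.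
rewrite (funext (K0_op_cosh f)).
split; apply: intbleZl => //; [exact: (dual_intble mr ir)|exact: (dual_intble mi ii)].
Qed.

Lemma index_transform_Fcos f tau : in_L0 f ->
  index_transform f tau = Fcos (fun t => K0_op f (coshR t)) tau.
Proof.
move=> hf; have [mr ir] := in_L0_re hf; have [mi ii] := in_L0_im hf.
(* The constant 2 / pi of the kernel is split evenly between the cosine transform and the operator
   K_0. *)
have kk : k * k = 2 / pi.
  by rewrite -expr2 sqr_sqrtr// divr_ge0// ltW// pi_gt0.
have key phi : intble halfline (fun t => dual phi t * cos (tau * t)) ->
    k * \int[mu]_(t in halfline) ((- k * dual phi t) * cos (tau * t)) =
    - (2 / pi) * \int[mu]_(t in halfline) (dual phi t * cos (tau * t)).
  move=> id; rewrite -kk -mulrN -mulrA; congr (_ * _).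
  have <- := RintZl (- k) m0 id.
  by apply: eq_Rint => t _; rewrite mulrA.
rewrite index_transformE (PsiI_density_dual mr ir) (PsiI_density_dual mi ii).
rewrite -(key _ (dual_cos_intble mr ir tau)) -(key _ (dual_cos_intble mi ii tau)).
rewrite /Fcos -/k /cintegral.
have -> (a b : R) : k%:C * (a +i* b) = (k * a) +i* (k * b).
  by apply: complex_eq; rewrite !reimE; ring.
apply: (congr2 (@Complex R)); congr (_ * _); apply: eq_Rint => t _; rewrite K0_op_cosh.
  by rewrite reMR.
by rewrite imMR.
Qed.

End Assembly.

Theorem theorem1 (R : realType) :
  (* the kernel at tau = 0 and the integral defining the transform exist *)
  [/\ forall x : R, 0 < x -> cvg (Psi_quot tau x @[tau --> (0 : R)^']),
      forall f : R -> R[i], in_L0 f ->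
        forall tau : R, cintegrable halfline (fun x => (Psi tau x)%:C * f x),
      bounded_operator_L0_C0 (@index_transform R) &
  (* composition representation, whose integrals exist as well *)
      forall f : R -> R[i], in_L0 f ->
        [/\ forall t : R, 0 < t ->
              cintegrable halfline
                (fun s => (K0_kernel (coshR t) s)%:C * f s),
            cintegrable halfline (fun t => K0_op f (coshR t)) &
            forall tau : R,
              index_transform f tau = Fcos (fun t => K0_op f (coshR t)) tau]].
Proof.
split.
- by move=> x x0; apply/cvg_ex; exists (PsiI 0 x); exact: Psi_quot_cvg.
- by move=> f hf tau; exact: index_transform_integrable.
- exact: index_transform_bounded.
- move=> f hf; split; first by move=> t; exact: K0_density_integrable.
    exact: K0_op_integrable.
  by move=> tau; exact: index_transform_Fcos.
Qed.
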